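(* Let $n,r,d$ be integers such that $n\ge 2$, $d\ge 1$ is odd, and $1\le r\le n-1$. For $a=0,1,\dots,\lfloor rd/2\rfloor$ write $\alpha=\lfloor a/(n-r)\rfloor$ and $s=a\bmod (n-r)$, and let $K_a(\lambda)$ be any $n\times n$ complex symmetric matrix polynomial of degree exactly $d$ and rank exactly $r$ whose complete eigenstructure (with respect to grade $d$) consists of: $s$ left minimal indices equal to $\alpha+1$ and $n-r-s$ left minimal indices equal to $\alpha$; right minimal indices equal to the left minimal indices; and $rd-2a$ linear elementary divisors $(\lambda-\mu_1),\dots,(\lambda-\mu_{rd-2a})$ with pairwise distinct $\mu_i\in\mathbb C$ (and no infinite elementary divisors). Then the set $\bigcup_{0\le a\le\lfloor rd/2\rfloor}\mathrm B^s(K_a)$ is open and dense in $\mathrm{POL}^s_{d,n\times n}(r)$.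
   Context: A matrix polynomial of grade $d$ is $P(\lambda)=\lambda^dA_d+\cdots+\lambda A_1+A_0$ with complex matrix coefficients, where $A_d$ may be zero (so the degree, i.e. the largest $i$ with $A_i\neq 0$, is at most $d$); it is symmetric if all $A_i^\top=A_i$. $\mathrm{POL}^s_{d,n\times n}$ is the space of $n\times n$ complex symmetric matrix polynomials of grade $d$, with distance $d(P,\widetilde P)=\big(\sum_{i=0}^d\|A_i-\widetilde A_i\|_F^2\big)^{1/2}$ (Frobenius norm). The rank of $P$ is its rank over the field $\mathbb C(\lambda)$, and $\mathrm{POL}^s_{d,n\times n}(r)$ is the subset of polynomials in $\mathrm{POL}^s_{d,n\times n}$ of rank at most $r$, with the induced metric topology. Finite eigenvalues and finite elementary divisors $(\lambda-\mu)^{\delta}$ are those obtained from the Smith form of $P$ (prime-power factors of the invariant polynomials). $P$, regarded with grade $d$, has $\infty$ as an eigenvalue if $0$ is an eigenvalue of $\operatorname{rev}P(\lambda):=\lambda^dP(1/\lambda)$, and the infinite elementary divisors of $P$ are the elementary divisors of $\operatorname{rev}P$ at $0$. The right (left) minimal indices of $P$ are the degrees of the vectors in a minimal basis (polynomial basis with minimal sum of degrees) of the right (left) null-space of $P$ over $\mathbb C(\lambda)$; for symmetric $P$ the left and right minimal indices coincide. The complete eigenstructure of $P$ is the collection of all its elementary divisors (finite and infinite) and its left and right minimal indices. The symmetric bundle $\mathrm B^s(P)\subset\mathrm{POL}^s_{d,n\times n}$ of $P\in\mathrm{POL}^s_{d,n\times n}$ is the set of symmetric matrix polynomials with the same size,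 grade and complete eigenstructure as $P$, except that the values of the distinct eigenvalues (which may include $\infty$) are unspecified as long as they remain distinct. For each $a=0,1,\dots,\lfloor rd/2\rfloor$ and each choice of distinct $\mu_i$ a polynomial $K_a$ as described exists, and $\mathrm B^s(K_a)$ does not depend on the choice. *)

(* Defs.v *)
From HB Require Import structures.
From mathcomp Require Import all_boot all_order all_algebra.
From mathcomp Require Import complex.
From mathcomp Require Import boolp classical_sets reals.

Set Implicit Arguments.
Unset Strict Implicit.
Unset Printing Implicit Defensive.

Import Order.TTheory GRing.Theory Num.Theory.

Local Open Scope ring_scope.
Local Open Scope classical_set_scope.

(** * Polynomial matrices over a field *)

Definition ratmx (F : fieldType) (m n : nat) (A : 'M[{poly F}]_(m, n)) :
    'M[{fraction {poly F}}]_(m, n) :=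
  map_mx (@tofrac {poly F}) A.

Definition pmxrank (F : fieldType) (m n : nat) (A : 'M[{poly F}]_(m, n)) : nat :=
  \rank (ratmx A).

(** [s] lists the invariant polynomials, i.e. the nonzero diagonal entries
    of the Smith form; the remaining diagonal entries are [s`_i = 0]. *)
Definition smith_invariants (F : fieldType) (n : nat) (A : 'M[{poly F}]_n)
    (s : seq {poly F}) : Prop :=
  [/\ (size s <= n)%N,
      all (fun p => p \is monic) s,
      sorted (@dvdp F) s
    & exists U V : 'M[{poly F}]_n,
        [/\ U \in unitmx, V \in unitmx
          & U *m A *m V = \matrix_(i < n, j < n) (s`_i *+ (i == j))]].

(** The convention here is that the zero vector has degree 0; it never
    occurs in a basis. *)
Definition vdeg (F : fieldType) (n : nat) (v : 'rV[{poly F}]_n) : nat :=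
  \max_(j < n) (size (v ord0 j)).-1.

(** The rows of [N] are polynomial vectors forming a basis, over the field of
    rational functions, of the left null-space of [A]. *)
Definition left_null_poly_basis (F : fieldType) (m n k : nat)
    (A : 'M[{poly F}]_(m, n)) (N : 'M[{poly F}]_(k, m)) : bool :=
  row_free (ratmx N) && (ratmx N == kermx (ratmx A))%MS.

Definition left_minimal_basis (F : fieldType) (m n k : nat)
    (A : 'M[{poly F}]_(m, n)) (N : 'M[{poly F}]_(k, m)) : Prop :=
  left_null_poly_basis A N /\
  forall N' : 'M[{poly F}]_(k, m), left_null_poly_basis A N' ->
    (\sum_(i < k) vdeg (row i N) <= \sum_(i < k) vdeg (row i N'))%N.

(** Sequences of minimal indices (and of elementary divisors below) stand for
    multisets: they are only determined up to permutation. *)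
Definition left_minimal_indices (F : fieldType) (m n : nat)
    (A : 'M[{poly F}]_(m, n)) (l : seq nat) : Prop :=
  exists (k : nat) (N : 'M[{poly F}]_(k, m)),
    left_minimal_basis A N /\ perm_eq l [seq vdeg (row i N) | i <- enum 'I_k].

Definition right_minimal_indices (F : fieldType) (m n : nat)
    (A : 'M[{poly F}]_(m, n)) (l : seq nat) : Prop :=
  left_minimal_indices A^T l.

(** * Square matrix polynomials of grade [d] *)

(** [P i] is the coefficient of [lambda ^ i]; the leading one may vanish. *)
Definition matpoly (F : fieldType) (d n : nat) : Type :=
  {ffun 'I_d.+1 -> 'M[F]_n}.

Definition matpoly_mx (F : fieldType) (d n : nat) (P : matpoly F d n) :
    'M[{poly F}]_n :=
  \sum_(i < d.+1) 'X^i *: map_mx polyC (P i).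

(** [lambda ^ d P(1 / lambda)] *)
Definition rev_matpoly (F : fieldType) (d n : nat) (P : matpoly F d n) :
    matpoly F d n :=
  [ffun i => P (rev_ord i)].

Definition mprank (F : fieldType) (d n : nat) (P : matpoly F d n) : nat :=
  pmxrank (matpoly_mx P).

(** The multiset [E] of elementary divisors, for [F] algebraically closed:
    the pair [(Some mu, k)] stands for the finite elementary divisor
    [(lambda - mu) ^ k], and [(None, k)] for an infinite elementary divisor of
    exponent [k]. *)
Definition elementary_divisors (F : fieldType) (d n : nat) (P : matpoly F d n)
    (E : seq (option F * nat)) : Prop :=
  exists s t : seq {poly F},
    [/\ smith_invariants (matpoly_mx P) s,
        smith_invariants (matpoly_mx (rev_matpoly P)) t
      & forall (e : option F) (k : nat),
          count_mem (e, k) E =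
          if e is Some mu
          then count (fun p => (0 < k)%N && (mup mu p == k)) s
          else count (fun p => (0 < k)%N && (mup 0 p == k)) t].

(** [E]: elementary divisors, [L], [M]: left and right minimal indices *)
Definition complete_eigenstructure (F : fieldType) (d n : nat)
    (P : matpoly F d n) (E : seq (option F * nat)) (L M : seq nat) : Prop :=
  [/\ elementary_divisors P E,
      left_minimal_indices (matpoly_mx P) L
    & right_minimal_indices (matpoly_mx P) M].

Definition POLs (F : fieldType) (d n : nat) : set (matpoly F d n) :=
  [set P | forall i, (P i)^T = P i].

Definition POLs_rank (F : fieldType) (d n r : nat) : set (matpoly F d n) :=
  [set P | POLs P /\ (mprank P <= r)%N].

(** [f] renames the eigenvalues of [P], possibly moving them to or from
    infinity ([None]), while keeping distinct ones distinct. *)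
Definition sym_bundle (F : fieldType) (d n : nat) (P : matpoly F d n) :
    set (matpoly F d n) :=
  [set Q | POLs Q /\
     exists (E : seq (option F * nat)) (L M : seq nat)
            (f : option F -> option F),
       [/\ complete_eigenstructure P E L M,
           {in [seq e.1 | e <- E] &, injective f}
         & complete_eigenstructure Q [seq (f e.1, e.2) | e <- E] L M]].

(** * The metric *)

Definition frobenius_norm (R : realType) (m n : nat) (A : 'M[R[i]]_(m, n)) : R :=
  Num.sqrt (\sum_(i < m) \sum_(j < n) Normc.normc (A i j) ^+ 2).

Definition mpdist (R : realType) (d n : nat) (P Q : matpoly R[i] d n) : R :=
  Num.sqrt (\sum_(i < d.+1) frobenius_norm (P i - Q i) ^+ 2).

(** [U] is an open, resp. dense, subset of the space [X] with the induced
    metric topology. *)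
Definition mp_open_in (R : realType) (d n : nat)
    (X U : set (matpoly R[i] d n)) : Prop :=
  U `<=` X /\
  forall P, U P -> exists2 e : R, 0 < e &
    forall Q, X Q -> mpdist P Q < e -> U Q.

Definition mp_dense_in (R : realType) (d n : nat)
    (X U : set (matpoly R[i] d n)) : Prop :=
  U `<=` X /\
  forall P, X P -> forall e : R, 0 < e -> exists2 Q, U Q & mpdist P Q < e.

(** * The generic eigenstructures *)

Definition generic_indices (n r a : nat) : seq nat :=
  let alpha := (a %/ (n - r))%N in
  let s := (a %% (n - r))%N in
  nseq s alpha.+1 ++ nseq (n - r - s) alpha.

Definition is_generic_sym (R : realType) (d n r a : nat)
    (K : matpoly R[i] d n) : Prop :=
  [/\ POLs K, K ord_max != 0, mprank K = r
    & exists mu : seq R[i],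
        [/\ size mu = (r * d - 2 * a)%N, uniq mu
          & complete_eigenstructure K [seq (Some x, 1%N) | x <- mu]
              (generic_indices n r a) (generic_indices n r a)]].

(* Main.v *)
Require Import Defs.
From HB Require Import structures.
From mathcomp Require Import all_boot all_order all_fingroup all_algebra.
From mathcomp Require Import generic_quotient ring lra zify.
From mathcomp Require Import complex.
From mathcomp Require Import boolp classical_sets reals.

(* A symmetric P of rank r factors as W G W^T, where the columns of W form a minimal basis with
   degrees eta_j whose sum is the sum a of the left minimal indices, and G is regular and symmetric
   with deg G_jl <= d - eta_j - eta_l.  So P has a generic eigenstructure iff its minimal indices
   are balanced and det G, of grade r d - 2 a, has only simple roots on the projective line.

   Openness: the minimal indices are read off the ranks of coefficient matrices, and for a general
   constant matrix X the polynomial det (X^T P X) = det G det (W^T X)^2 has at least r d - 2 a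
   simple roots, which is again a rank condition.  All these conditions are lower bounds on ranks,
   and they force the eigenstructure to be generic.

   Density: the products W G W^T with a given degree pattern eta form a family closed under
   segments in (W, G), so a polynomial condition that holds at one member holds at members
   arbitrarily close to any other.  Explicit members of the family have balanced minimal indices
   (zigzag matrices W) or a determinant with simple roots (tridiagonal G); the latter exist once
   the factorization of P is chosen with the largest possible degree sum.  Polynomials of smaller
   rank are first perturbed by symmetric rank-one constants. *)

Set Implicit Arguments.
Unset Strict Implicit.
Unset Printing Implicit Defensive.

Import Order.TTheory GRing.Theory Num.Theory.

Local Open Scope ring_scope.

(** * Minimal bases of null spaces *)

(** The obstacle to density is that the degrees [eta] may force multiple roots. If the degree bounds
    make [G] vanish where its last [kk] rows meet the columns from [kk] on, then for every [G] of
    the pattern [det G] is, up to sign, a middle minor times the square of a corner minor. A maximal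
    degree sum removes this: the paired columns could be recombined so that their degrees add up to
    [d], so they already do, the corner minor is constant, and no double root is forced. The factor
    [W] obtained this way need not be a minimal basis; only its degree pattern matters.

    Openness is a squeeze. Rank bounds say that few null vectors of low degree exist, hence bound
    the minimal indices from below; the number of simple roots bounds the degree sum from above. The
    bounds meet at [a] because dual minimal bases have equal degree sums.

    Infinity needs no separate count: reversal turns it into 0, and a Moebius change of variable
    makes all [r d] roots finite, so that one matrix of fixed size detects the simple ones. *)

Lemma frac_clear (R : idomainType) (x : {fraction R}) :
  exists p q : R, q != 0 /\ x * (tofrac q) = tofrac p.
Proof.
elim/quotW: x => x; exists (frac x).1, (frac x).2; split; first exact: denom_ratioP.
unlock tofrac; rewrite -[LHS]FracField.pi_mul; apply/eqmodP.
rewrite /= FracField.equivfE /FracField.mulf.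
by rewrite !numden_Ratio ?mulr1 ?oner_eq0 ?denom_ratioP // mulrC.
Qed.

Section PolyMatrices.
Variable F : fieldType.
Implicit Types (m n k : nat).

Lemma mx_clear m n (A : 'M[{fraction {poly F}}]_(m, n)) :
  exists (h : {poly F}) (U : 'M[{poly F}]_(m, n)),
    h != 0 /\ tofrac h *: A = ratmx U.
Proof.
have H (ij : 'I_m * 'I_n) : exists pq : {poly F} * {poly F},
    pq.2 != 0 /\ A ij.1 ij.2 * tofrac pq.2 = tofrac pq.1.
  by have [p [q [q0 e]]] := frac_clear (A ij.1 ij.2); exists (p, q).
have [f fP] := fin_all_exists H.
exists (\prod_ij (f ij).2).
exists (\matrix_(i, j) ((f (i, j)).1 * \prod_(kl | kl != (i, j)) (f kl).2)).
split; first by apply/prodf_neq0 => ij _; case: (fP ij).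
apply/matrixP => i j; rewrite !mxE (bigD1 (i, j)) //= !rmorphM /=.
by rewrite -(fP (i, j)).2 /= mulrC mulrA.
Qed.

Lemma ratmx_eq0 m n (A : 'M[{poly F}]_(m, n)) : (ratmx A == 0) = (A == 0).
Proof.
apply/eqP/eqP => [/matrixP e | ->]; last by rewrite /ratmx map_mx0.
apply/matrixP => i j; move: (e i j); rewrite !mxE => /eqP.
by rewrite tofrac_eq0 => /eqP.
Qed.

Lemma ratmxM m n k (A : 'M[{poly F}]_(m, n)) (B : 'M_(n, k)) :
  ratmx (A *m B) = ratmx A *m ratmx B.
Proof. exact: map_mxM. Qed.

Lemma ratmxT m n (A : 'M[{poly F}]_(m, n)) : ratmx A^T = (ratmx A)^T.
Proof. by rewrite /ratmx map_trmx. Qed.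

Lemma ratmx_inj m n : injective (@ratmx F m n).
Proof.
move=> A B e; apply/eqP; rewrite -subr_eq0 -ratmx_eq0 /ratmx map_mxB.
by rewrite -/(ratmx A) e subrr.
Qed.

(** Freeness tested on polynomial rows; clearing denominators shows that it agrees with full row
    rank over the fraction field. *)
Definition pfree m n (A : 'M[{poly F}]_(m, n)) :=
  forall u : 'rV[{poly F}]_m, u *m A = 0 -> u = 0.

Lemma pfreeP m n (A : 'M[{poly F}]_(m, n)) : pfree A <-> row_free (ratmx A).
Proof.
split=> [fA | rA u uA0].
  rewrite -kermx_eq0; apply/eqP/row_matrixP => i; rewrite row0.
  set c := row i _.
  have cA0 : c *m ratmx A = 0.
    by apply/sub_kermxP; exact: row_sub.
  have [h [U [h0 e]]] := mx_clear c.
  have /fA U0 : U *m A = 0.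
    apply/eqP; rewrite -ratmx_eq0 ratmxM -e -scalemxAl cA0 scaler0 //.
  move: e; rewrite U0 /ratmx map_mx0 => /eqP; rewrite scaler_eq0 tofrac_eq0.
  by rewrite (negbTE h0) /= => /eqP.
apply/eqP; rewrite -ratmx_eq0; apply/eqP.
by apply: (row_free_inj rA); rewrite mul0mx -ratmxM uA0 /ratmx map_mx0.
Qed.

Lemma pfree_mul m n k (A : 'M[{poly F}]_(m, n)) (B : 'M[{poly F}]_(k, m)) :
  pfree A -> B *m A = 0 -> B = 0.
Proof.
move=> fA BA0; apply/row_matrixP => i; rewrite row0; apply: fA.
by rewrite -row_mul BA0 row0.
Qed.

Lemma left_null_poly_basisP m n k (A : 'M[{poly F}]_(m, n)) (N : 'M_(k, m)) :
  left_null_poly_basis A N <->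
  [/\ pfree N, N *m A = 0 & k = (m - pmxrank A)%N].
Proof.
rewrite /left_null_poly_basis; split.
  case/andP=> rN /eqmxP e; split; first exact/pfreeP.
    apply/eqP; rewrite -ratmx_eq0 ratmxM; apply/eqP/sub_kermxP.
    by rewrite e submx_refl.
  by rewrite /pmxrank -mxrank_ker -e; apply/esym/eqP.
case=> /pfreeP rN NA0 kE; rewrite rN /=.
have sub : (ratmx N <= kermx (ratmx A))%MS.
  by apply/sub_kermxP; rewrite -ratmxM NA0 /ratmx map_mx0.
rewrite -(geq_leqif (mxrank_leqif_eq sub)) mxrank_ker.
by rewrite (eqP rN) kE.
Qed.

(** Since [u 0 i != 0], replacing row [i] of [N] by [v] gives another basis, and minimality of the
    degree sum compares the two rows. *)
Lemma left_min_exchange m n k (A : 'M[{poly F}]_(m, n)) (N : 'M_(k, m)) :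
  left_minimal_basis A N ->
  forall (v : 'rV_m) (u : 'rV_k) (h : {poly F}) (i : 'I_k),
    v *m A = 0 -> h != 0 -> h *: v = u *m N -> u 0 i != 0 ->
    (vdeg (row i N) <= vdeg v)%N.
Proof.
case=> bN minN v u h i vA0 h0 hv ui0.
have [fN NA0 kE] := (left_null_poly_basisP A N).1 bN.
pose N' := \matrix_j (if j == i then v else row j N).
have rowN' j : row j N' = if j == i then v else row j N by rewrite rowK.
have bN' : left_null_poly_basis A N'.
  apply/left_null_poly_basisP; split=> //; last first.
    apply/row_matrixP => j; rewrite row_mul rowN' row0.
    by case: eqP => // _; rewrite -row_mul NA0 row0.
  move=> w wN'0.
  pose w' := w 0 i *: u + h *: (\row_j (if j == i then 0 else w 0 j)).
  have /fN w'0 : w' *m N = 0.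
    rewrite /w' mulmxDl -!scalemxAl -hv.
    apply: (etrans _ (scaler0 _ h)); rewrite -wN'0.
    rewrite (mulmx_sum_row w N') (bigD1 i) //= rowN' eqxx.
    rewrite (mulmx_sum_row _ N) (bigD1 i) //= mxE eqxx scale0r add0r.
    rewrite scalerDr !scalerA mulrC; congr (_ + h *: _).
    apply: eq_bigr => j /negbTE ji; by rewrite mxE rowN' ji.
  have wi0 : w 0 i = 0.
    move: (congr1 (fun x : 'rV_k => x 0 i) w'0); rewrite !mxE eqxx mulr0 addr0.
    by move/eqP; rewrite mulf_eq0 (negbTE ui0) orbF => /eqP.
  apply/rowP => j; rewrite mxE.
  have [-> // | /negbTE ji] := eqVneq j i.
  move: (congr1 (fun x : 'rV_k => x 0 j) w'0); rewrite !mxE ji wi0 mul0r add0r.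
  by move/eqP; rewrite mulf_eq0 (negbTE h0) /= => /eqP.
move: (minN N' bN'); rewrite (bigD1 i) //= [X in (_ <= X)%N](bigD1 i) //=.
rewrite rowN' eqxx.
under [X in (_ <= _ + X)%N]eq_bigr => j /negbTE ji do rewrite rowN' ji.
by rewrite leq_add2r.
Qed.

Lemma left_minimal_basis_exists m n (A : 'M[{poly F}]_(m, n)) :
  exists N : 'M_(m - pmxrank A, m), left_minimal_basis A N.
Proof.
set k := (m - pmxrank A)%N.
have [N0 bN0] : exists N : 'M_(k, m), left_null_poly_basis A N.
  have ek : \rank (kermx (ratmx A)) = k by rewrite mxrank_ker.
  have [B fB eB] : exists2 B : 'M_(k, m), row_free B & (B :=: kermx (ratmx A))%MS.
    by rewrite -ek; exists (row_base (kermx (ratmx A))); rewrite ?row_base_free //;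
       exact: eq_row_base.
  have [h [U [h0 e]]] := mx_clear B.
  exists U; rewrite /left_null_poly_basis -e.
  have h0' : tofrac h != 0 by rewrite tofrac_eq0.
  have eU := eqmx_scale B h0'.
  rewrite /row_free eU; apply/andP; split; first exact: fB.
  by apply/eqmxP/(eqmx_trans eU).
have [s] := ubnP (\sum_(i < k) vdeg (row i N0)).
elim: s N0 bN0 => // s IHs N0 bN0 les.
case: (EM (exists2 N : 'M_(k, m), left_null_poly_basis A N &
    (\sum_(i < k) vdeg (row i N) < \sum_(i < k) vdeg (row i N0))%N)).
  by case=> N bN lt; apply: (IHs N bN); apply: leq_trans lt _; rewrite -ltnS.
move=> no; exists N0; split=> // N' bN'; rewrite leqNgt; apply/negP => lt.
by apply: no; exists N'.
Qed.

Lemma vdeg_leP n (v : 'rV[{poly F}]_n) e :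
  (vdeg v <= e)%N <-> (forall j, (size (v 0%R j) <= e.+1)%N).
Proof.
split=> [le j | H].
  have := leq_trans (leq_bigmax (F := fun j => (size (v ord0 j)).-1) j) le.
  by case: (size _).
by apply/bigmax_leqP => j _; move: (H j); case: (size _).
Qed.

(** [vdeg] does not tell zero from a nonzero constant, so the strict drop in degree is expressed by
    sizes; against a row of degree 0 it means [v = 0]. *)
Lemma left_min_exchange_size m n k (A : 'M[{poly F}]_(m, n)) (N : 'M_(k, m)) :
  left_minimal_basis A N ->
  forall (v : 'rV_m) (u : 'rV_k) (h : {poly F}) (i : 'I_k),
    v *m A = 0 -> h != 0 -> h *: v = u *m N -> u 0 i != 0 ->
    ~ (forall j, (size (v 0%R j) <= vdeg (row i N))%N).
Proof.
move=> mN v u h i vA0 h0 e ui0 H.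
have := left_min_exchange mN vA0 h0 e ui0; move: H.
case E: (vdeg (row i N)) => [|d] H; last first.
  by move=> lt; have /(leq_trans lt) := (vdeg_leP v d).2 H; rewrite ltnn.
have v0 : v = 0.
  by apply/rowP => j; move: (H j); rewrite mxE leqn0 size_poly_eq0 => /eqP.
have [fN _ _] := (left_null_poly_basisP A N).1 mN.1.
move: ui0; rewrite (fN u); first by rewrite mxE eqxx.
by rewrite -e v0 scaler0.
Qed.

Lemma coefM_top (p q : {poly F}) a b :
  (size p <= a.+1)%N -> (size q <= b.+1)%N -> (p * q)`_(a + b) = p`_a * q`_b.
Proof.
move=> sp sq; rewrite coefM.
have ha : (a < (a + b).+1)%N by rewrite ltnS leq_addr.
rewrite (bigD1 (Ordinal ha)) //= addKn big1 ?addr0 // => i ne.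
have [lt | ge] := ltnP a i; first by rewrite (nth_default _ (leq_trans sp lt)) mul0r.
have {}ne : (i < a)%N.
  by rewrite ltn_neqAle ge andbT; apply: contraNneq ne => e; apply/eqP/val_inj.
rewrite [X in _ * X]nth_default ?mulr0 //; apply: leq_trans sq _; lia.
Qed.

Lemma size_mul_bound (p q : {poly F}) a b c :
  (size p <= a)%N -> (size q <= b)%N -> (a + b <= c.+1)%N -> (size (p * q)%R <= c)%N.
Proof. by move=> sp sq le; have := size_polyMleq p q; lia. Qed.

Lemma size_mul_cancel (h p : {poly F}) e :
  h != 0 -> (size (h * p)%R <= (size h).-1 + e)%N -> (size p <= e)%N.
Proof.
move=> h0; have [-> | p0] := eqVneq p 0; first by rewrite size_poly0.
rewrite size_mul //; move: h0 p0; rewrite -!size_poly_gt0.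
case: (size h) => // a; case: (size p) => // b _ _.
lia.
Qed.

(* A basis of the left null space of [A] over the polynomial ring, with the
   predictable degree property relative to the row degrees [eps]. *)
Definition null_basis m n k (A : 'M[{poly F}]_(m, n)) (N : 'M_(k, m))
    (eps : 'I_k -> nat) : Prop :=
  [/\ N *m A = 0, forall i j, (size (N i j) <= (eps i).+1)%N, pfree N &
      forall v : 'rV_m, v *m A = 0 -> exists u : 'rV_k, v = u *m N /\
        forall h, (forall j, (size (v 0%R j) <= h)%N) ->
          forall i, (size (u 0%R i) <= h - eps i)%N].

(** Clear denominators to [h *: v = u *m N] and divide the coefficients by [h]. A nonzero remainder
    [r] would give a null vector [r *m N / h] of degree strictly below the largest row degree that
    it involves, against the exchange property. *)
Lemma min_basis_saturated m n k (A : 'M[{poly F}]_(m, n)) (N : 'M_(k, m)) :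
  left_minimal_basis A N -> forall v : 'rV_m, v *m A = 0 ->
  exists u : 'rV_k, v = u *m N.
Proof.
move=> mN v vA0; have [bN _] := mN.
have [fN NA0 _] := (left_null_poly_basisP A N).1 bN.
have [/andP[_ /eqmxP eN]] := bN.
have /submxP[c ec] : (ratmx v <= ratmx N)%MS.
  by rewrite eN; apply/sub_kermxP; rewrite -ratmxM vA0 /ratmx map_mx0.
have [h [u [h0 eu]]] := mx_clear c.
have {eu ec} hv : h *: v = u *m N.
  by apply: ratmx_inj; rewrite ratmxM -eu -scalemxAl -ec /ratmx map_mxZ.
pose q : 'rV_k := \row_i (u 0 i %/ h); pose r : 'rV_k := \row_i (u 0 i %% h).
have eu : u = h *: q + r.
  by apply/rowP => i; rewrite !mxE mulrC -divp_eq.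
pose v' := v - q *m N.
have hv' : h *: v' = r *m N.
  by rewrite scalerBr hv eu mulmxDl scalemxAl addrC addKr.
have v'A0 : v' *m A = 0 by rewrite mulmxBl vA0 -mulmxA NA0 mulmx0 subr0.
exists q; apply/eqP; rewrite -subr_eq0 -/v'.
case: (pickP (fun i => r 0 i != 0)) => [i0 ri0 | r0]; last first.
  have r0' : r = 0 by apply/rowP => i; rewrite [RHS]mxE; apply/eqP; move: (r0 i) => /negbFE.
  by have := scalemx_eq0 h v'; rewrite hv' r0' mul0mx eqxx (negbTE h0).
case: (@arg_maxnP _ i0 (fun i => r 0 i != 0) (fun i => vdeg (row i N)) ri0) => i ri /= imax.
exfalso; apply: (left_min_exchange_size mN v'A0 h0 hv' ri) => j.
apply: (size_mul_cancel h0).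
move: (congr1 (fun x : 'rV_m => x 0 j) hv'); rewrite mxE => ->; rewrite mxE.
apply: (leq_trans (size_sum _ _ _)); apply/bigmax_leqP => l _.
have [-> | rl] := eqVneq (r 0 l) 0; first by rewrite mul0r size_poly0.
have s1 : (size (r 0%R l) < size h)%N by rewrite mxE ltn_modp.
have s2 := (vdeg_leP (row l N) _).1 (imax l rl) j; rewrite mxE in s2.
apply: (size_mul_bound (leqnn _) s2); rewrite addnS ltnS leq_add2r.
by case: (size h) s1.
Qed.

(** If the top terms of [u *m N] cancelled, the same cancellation among leading coefficients would
    produce a null vector of too small degree involving a row of [N]. *)
Lemma min_basis_predictable m n k (A : 'M[{poly F}]_(m, n)) (N : 'M_(k, m)) :
  left_minimal_basis A N -> forall (u : 'rV_k) h,
  (forall j, (size ((u *m N)%R 0%R j) <= h)%N) ->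
  forall i, (size (u 0%R i) <= h - vdeg (row i N))%N.
Proof.
move=> mN u h sv i1; rewrite leqNgt; apply/negP => lt1.
have [fN NA0 _] := (left_null_poly_basisP A N).1 mN.1.
pose eps i := vdeg (row i N).
have sN i j : (size (N i j) <= (eps i).+1)%N.
  by have := (vdeg_leP (row i N) _).1 (leqnn _) j; rewrite mxE.
have u1 : u 0 i1 != 0 by rewrite -size_poly_gt0; lia.
case: (@arg_maxnP _ i1 (fun i => u 0 i != 0)
  (fun i => (size (u 0%R i) + eps i)%N) u1) => i2 u2 max2.
pose D := (size (u 0%R i2) + eps i2)%N.
have ltD : (h < D)%N.
  have := max2 i1 u1; rewrite -/D; move: lt1; rewrite /eps; lia.
pose I := [pred i | (u 0 i != 0) && (size (u 0%R i) + eps i == D)%N].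
have I2 : I i2 by rewrite /I /= u2 eqxx.
case: (@arg_maxnP _ i2 I eps I2) => i0 /andP[u0 /eqP D0] max0.
(* [I] selects the terms of top degree, [i0] the largest row degree among them. The monomials align
   all these terms at degree [eps i0], so that this coefficient of [w *m N] is the vanishing top
   coefficient of [u *m N]. *)
pose w : 'rV_k := \row_i (if I i then lead_coef (u 0 i) *: 'X^(eps i0 - eps i) else 0).
have w0 : w 0 i0 != 0.
  rewrite mxE /I /= u0 D0 eqxx subnn expr0 scaler_eq0 lead_coef_eq0 oner_eq0.
  by rewrite (negbTE u0).
apply: (left_min_exchange_size mN (v := w *m N) _ (oner_neq0 _) _ w0).
- by rewrite -mulmxA NA0 mulmx0.
- by rewrite scale1r.
move=> j; rewrite -/(eps i0).
have s1 : (size ((w *m N)%R 0%R j) <= (eps i0).+1)%N.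
  rewrite mxE; apply: (leq_trans (size_sum _ _ _)); apply/bigmax_leqP => l _.
  rewrite mxE; case: ifP => [Il | _]; last by rewrite mul0r size_poly0.
  rewrite -scalerAl; apply: (leq_trans (size_scale_leq _ _)).
  have := max0 l Il; rewrite /= => le.
  by apply: (size_mul_bound (a := (eps i0 - eps l).+1) _ (sN l j)); rewrite ?size_polyXn //; lia.
apply/leq_sizeP => c; rewrite leq_eqVlt => /orP[/eqP <- | lt]; last first.
  by rewrite nth_default //; apply: leq_trans s1 lt.
have : ((u *m N) 0 j)`_D.-1 = 0.
  by rewrite nth_default //; apply: leq_trans (sv j) _; lia.
rewrite !mxE !coef_sum => e; rewrite -[RHS]e; apply: eq_bigr => l _.
rewrite mxE; case: ifP => [Il | nI].
  have le := max0 l Il; have /andP[ul /eqP Dl] := Il; simpl in le.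
  have sl : (0 < size (u 0%R l))%N by rewrite size_poly_gt0.
  have -> : D.-1 = ((size (u 0%R l)).-1 + eps l)%N by lia.
  rewrite (coefM_top _ (sN l j)) ?prednK // -scalerAl coefZ lead_coefE; congr (_ * _).
  by rewrite coefXnM ltnNge leq_subr /= subKn.
rewrite mul0r coef0 nth_default //.
have [-> | ul] := eqVneq (u 0 l) 0; first by rewrite mul0r size_poly0.
have /= := max2 l ul; rewrite -/D leq_eqVlt => /orP[De | lt].
  by move: nI; rewrite /I /= ul De.
by apply: (size_mul_bound (leqnn _) (sN l j)); rewrite addnS; apply: leq_trans lt (leqSpred _).
Qed.

Lemma null_basis_min m n k (A : 'M[{poly F}]_(m, n)) (N : 'M_(k, m)) :
  left_minimal_basis A N -> null_basis A N (fun i => vdeg (row i N)).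
Proof.
move=> mN; have [fN NA0 _] := (left_null_poly_basisP A N).1 mN.1; split=> //.
  by move=> i j; have := (vdeg_leP (row i N) _).1 (leqnn _) j; rewrite mxE.
move=> v vA0; have [u ev] := min_basis_saturated mN vA0; exists u; split=> // h.
rewrite ev => sv i; exact: (min_basis_predictable mN sv i).
Qed.

Lemma null_basis_exists m n (A : 'M[{poly F}]_(m, n)) :
  exists (N : 'M_(m - pmxrank A, m)) eps,
    [/\ left_minimal_basis A N, null_basis A N eps
      & eps = (fun i => vdeg (row i N))].
Proof.
have [N mN] := left_minimal_basis_exists A.
by exists N, (fun i => vdeg (row i N)); split=> //; exact: null_basis_min.
Qed.

End PolyMatrices.

(** * Coefficient matrices *)

Section Coefficients.
Variable F : fieldType.
Implicit Types (m n k : nat).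

Definition sidx m (d : 'I_m -> nat) := {j : 'I_m & 'I_(d j)}.

Lemma card_sidx m (d : 'I_m -> nat) : #|{: sidx d}| = (\sum_j d j)%N.
Proof.
rewrite -sum1_card -(@sig_big_dep _ _ _ _ _ predT (fun _ => predT) (fun _ _ => 1%N)) /=.
by apply: eq_bigr => j _; rewrite sum1_card card_ord.
Qed.

Definition ival m (d : 'I_m -> nat) (x : 'I_#|{: sidx d}|) : sidx d := enum_val x.
Definition ivar m (d : 'I_m -> nat) (x : 'I_#|{: sidx d}|) : 'I_m := tag (ival x).
Definition iexp m (d : 'I_m -> nat) (x : 'I_#|{: sidx d}|) : nat := tagged (ival x).

Definition enc m (d : 'I_m -> nat) (v : 'rV[{poly F}]_m) : 'rV[F]_#|{: sidx d}| :=
  \row_x (v 0 (ivar x))`_(iexp x).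

Definition dec m (d : 'I_m -> nat) (c : 'rV[F]_#|{: sidx d}|) : 'rV[{poly F}]_m :=
  \row_j \sum_(l < d j) c 0 (enum_rank (Tagged (fun j => 'I_(d j)) l)) *: 'X^l.

(** Block Toeplitz matrix of [v |-> v *m A] on rows with size bounds [d]. Coefficients beyond the
    bounds [d'] are cut off; [fits] is the condition that nothing is lost. *)
Definition pmx m n (d : 'I_m -> nat) (d' : 'I_n -> nat) (A : 'M[{poly F}]_(m, n)) :
    'M[F]_(#|{: sidx d}|, #|{: sidx d'}|) :=
  \matrix_(x, y) ('X^(iexp x) * A (ivar x) (ivar y))`_(iexp y).

Lemma coef_dec m (d : 'I_m -> nat) c j (l : 'I_(d j)) :
  (dec c 0 j)`_l = c 0 (enum_rank (Tagged (fun j => 'I_(d j)) l)).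
Proof.
rewrite mxE coef_sum (bigD1 l) //= coefZ coefXn eqxx mulr1 big1 ?addr0 // => i ne.
rewrite coefZ coefXn; case: eqP => [e|]; last by rewrite mulr0.
by case/eqP: ne; apply/val_inj.
Qed.

Lemma size_dec m (d : 'I_m -> nat) (c : 'rV[F]_#|{: sidx d}|) j :
  (size (dec c 0%R j) <= d j)%N.
Proof.
rewrite mxE; apply: (leq_trans (size_sum _ _ _)); apply/bigmax_leqP => l _.
by apply: (leq_trans (size_scale_leq _ _)); rewrite size_polyXn.
Qed.

Lemma encK m (d : 'I_m -> nat) (c : 'rV[F]_#|{: sidx d}|) : enc d (dec c) = c.
Proof.
apply/rowP => x; rewrite mxE coef_dec; congr (c _ _).
by rewrite /ivar /iexp /ival -[RHS]enum_valK; case: (enum_val x).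
Qed.

Lemma decK m (d : 'I_m -> nat) (v : 'rV[{poly F}]_m) :
  (forall j, (size (v 0%R j) <= d j)%N) -> dec (enc d v) = v.
Proof.
move=> sv; apply/rowP => j; apply/polyP => l.
have [lt | ge] := ltnP l (d j).
  by rewrite (coef_dec _ (Ordinal lt)) mxE /ivar /iexp /ival enum_rankK.
by rewrite !nth_default //; [apply: leq_trans (sv j) ge | apply: leq_trans (size_dec _ _) ge].
Qed.

Lemma enc0 m (d : 'I_m -> nat) : enc d 0 = 0.
Proof. by apply/rowP => x; rewrite !mxE coef0. Qed.

Lemma enc_eq0 m (d : 'I_m -> nat) (v : 'rV[{poly F}]_m) :
  (forall j, (size (v 0%R j) <= d j)%N) -> enc d v = 0 -> v = 0.
Proof.
move=> sv e; rewrite -(decK sv) e; apply/rowP => j; rewrite !mxE big1 // => l _.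
by rewrite mxE scale0r.
Qed.

Lemma mul_pmx m n (d : 'I_m -> nat) (d' : 'I_n -> nat) (A : 'M[{poly F}]_(m, n)) c :
  c *m pmx d d' A = enc d' (dec c *m A).
Proof.
apply/rowP => y; rewrite !mxE coef_sum.
rewrite (eq_bigr (fun j => \sum_(l < d j) (c 0 (enum_rank (Tagged (fun j => 'I_(d j)) l))) *
   ('X^l * A j (ivar y))`_(iexp y))); last first.
  by move=> j _; rewrite mxE mulr_suml coef_sum; apply: eq_bigr => l _; rewrite -scalerAl coefZ.
pose G (t : sidx d) := c 0 (enum_rank t) *
   ('X^(tagged t) * A (tag t) (ivar y))`_(iexp y).
rewrite (eq_bigr (fun j => \sum_(l < d j) G (Tagged (fun j => 'I_(d j)) l))) //.
rewrite (@sig_big_dep _ _ _ _ _ predT (fun _ => predT)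
  (fun j l => G (Tagged (fun j => 'I_(d j)) l))) /=.
rewrite (reindex_onto (@enum_val (sidx d) predT) enum_rank) /=; last by move=> t _; rewrite enum_rankK.
apply: eq_big => [x | x _]; first by rewrite enum_valK eqxx.
rewrite mxE /G /ivar /iexp /ival.
have -> : Tagged (fun j => 'I_(d j)) (tagged (enum_val x)) = enum_val x by case: (enum_val x).
by rewrite enum_valK.
Qed.

Definition fits m n (d : 'I_m -> nat) (d' : 'I_n -> nat) (A : 'M[{poly F}]_(m, n)) :=
  forall v : 'rV[{poly F}]_m, (forall j, (size (v 0%R j) <= d j)%N) ->
  forall j, (size ((v *m A)%R 0%R j) <= d' j)%N.

Lemma fits_size m n (d : 'I_m -> nat) (d' : 'I_n -> nat) (A : 'M[{poly F}]_(m, n)) :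
  (forall i j, A i j != 0 -> (0 < d i)%N -> (d i + size (A i j) <= (d' j).+1)%N) ->
  fits d d' A.
Proof.
move=> sA v sv j; rewrite mxE; apply: (leq_trans (size_sum _ _ _)); apply/bigmax_leqP => i _.
have [-> | v0] := eqVneq (v 0 i) 0; first by rewrite mul0r size_poly0.
have [-> | A0] := eqVneq (A i j) 0; first by rewrite mulr0 size_poly0.
apply: (size_mul_bound (sv i) (leqnn _)); apply: sA => //.
by apply: leq_trans (sv i); rewrite size_poly_gt0.
Qed.

Lemma null_basis_fits m n k (A : 'M[{poly F}]_(m, n)) (N : 'M_(k, m)) eps h :
  null_basis A N eps -> fits (fun i => (h - eps i)%N) (fun _ => h) N.
Proof.
by case=> _ sN _ _; apply: fits_size => i j _ h0; move: (sN i j) h0; move: (size _); lia.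
Qed.

Lemma kermx_pmx_sub m n k (A : 'M[{poly F}]_(m, n)) (N : 'M_(k, m)) (eps : 'I_k -> nat) h d' :
  (forall v : 'rV_m, v *m A = 0 -> exists u : 'rV_k, v = u *m N /\
     forall h, (forall j, (size (v 0%R j) <= h)%N) ->
     forall i, (size (u 0%R i) <= h - eps i)%N) ->
  fits (fun _ => h) d' A ->
  (kermx (pmx (fun _ => h) d' A) <= pmx (fun i => (h - eps i)%N) (fun _ => h) N)%MS.
Proof.
move=> sat fA; apply/row_subP => x; set c := row x _.
have : c *m pmx (fun _ => h) d' A = 0 by apply/sub_kermxP; apply: row_sub.
rewrite mul_pmx => /enc_eq0 e.
have /sat[u [eu su]] : dec c *m A = 0 by apply: e; apply: fA; apply: size_dec.
apply/submxP; exists (enc (fun i => (h - eps i)%N) u).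
rewrite mul_pmx decK -?eu ?encK // => i; apply: su => j; exact: size_dec.
Qed.

(** Kernel vectors encode rows [u *m N] with [size (u 0 i) <= h - eps i], a space of dimension at
    most the sum. This one-sided form serves the explicit zigzag matrices. *)
Lemma rank_pmx_ge m n k (A : 'M[{poly F}]_(m, n)) (N : 'M_(k, m)) (eps : 'I_k -> nat) h d' :
  (forall v : 'rV_m, v *m A = 0 -> exists u : 'rV_k, v = u *m N /\
     forall h, (forall j, (size (v 0%R j) <= h)%N) ->
     forall i, (size (u 0%R i) <= h - eps i)%N) ->
  fits (fun _ => h) d' A ->
  (m * h <= \rank (pmx (fun _ => h) d' A) + \sum_i (h - eps i))%N.
Proof.
move=> sat fA; set B := pmx _ _ _.
have : (#|{: sidx (fun _ : 'I_m => h)}| - \rank B <= \sum_i (h - eps i))%N.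
  rewrite -mxrank_ker -card_sidx; apply: leq_trans (rank_leq_row _).
  exact: mxrankS (kermx_pmx_sub sat fA).
by rewrite leq_subLR {1}card_sidx sum_nat_const card_ord.
Qed.

(** The kernel is exactly the space of encoded [u *m N] with bounded [u], so these ranks, for all
    [h], carry the row degrees [eps]. *)
Lemma rank_pmx m n k (A : 'M[{poly F}]_(m, n)) (N : 'M_(k, m)) eps h d' :
  null_basis A N eps -> fits (fun _ => h) d' A ->
  (\rank (pmx (fun _ => h) d' A) + \sum_i (h - eps i) = m * h)%N.
Proof.
move=> nb fA; have fN := null_basis_fits (h := h) nb; case: nb => NA0 sN fr sat.
set B := pmx _ _ _; pose K := pmx (fun i => (h - eps i)%N) (fun _ => h) N.
have rK : \rank K = (\sum_i (h - eps i))%N.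
  rewrite -card_sidx; apply/eqP/inj_row_free => c.
  rewrite mul_pmx => /enc_eq0 e; rewrite -[c]encK (fr (dec c)) ?enc0 //.
  by apply: e; apply: fN; apply: size_dec.
have KB : (K <= kermx B)%MS.
  apply/row_subP => x; apply/sub_kermxP; rewrite rowE mul_pmx /B mul_pmx decK; last first.
    by apply: fN; apply: size_dec.
  by rewrite -mulmxA NA0 mulmx0 enc0.
have BK := kermx_pmx_sub sat fA : (kermx B <= K)%MS.
have -> : (\sum_i (h - eps i) = \rank (kermx B))%N.
  by rewrite -rK; apply/eqP; rewrite eqn_leq !mxrankS.
rewrite mxrank_ker subnKC ?rank_leq_row //.
by rewrite card_sidx sum_nat_const card_ord.
Qed.

End Coefficients.

(** * Symmetric factorization *)

Section Factorization.
Variable F : fieldType.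
Implicit Types (m n k : nat).

Lemma null_basis_mx m n k p (A : 'M[{poly F}]_(m, n)) (N : 'M_(k, m)) eps
    (B : 'M_(p, m)) :
  null_basis A N eps -> B *m A = 0 -> exists X : 'M_(p, k), B = X *m N /\
    forall h i, (forall j, (size (B i j) <= h)%N) ->
      forall l, (size (X i l) <= h - eps l)%N.
Proof.
case=> _ _ _ sat BA0.
have H i : exists u : 'rV_k, row i B = u *m N /\
    forall h, (forall j, (size (row i B 0%R j) <= h)%N) ->
          forall l, (size (u 0%R l) <= h - eps l)%N.
  by apply: sat; rewrite -row_mul BA0 row0.
have [f fP] := fin_all_exists H.
exists (\matrix_i f i); split.
  by apply/row_matrixP => i; rewrite row_mul rowK; case: (fP i).
move=> h i sB l; have [_ /(_ h)] := fP i; rewrite mxE; apply.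
by move=> j; rewrite mxE.
Qed.

Lemma null_basis_sat_cols m n k (A : 'M[{poly F}]_(m, n)) (N : 'M_(k, m)) eps p
    (B : 'M_(m, p)) :
  null_basis A N eps -> (forall v : 'rV_m, v *m A = 0 <-> v *m B = 0) ->
  null_basis B N eps.
Proof.
move=> [NA0 sN fN sat] e; split=> //; last by move=> v /e; exact: sat.
by apply/row_matrixP => i; rewrite row0 row_mul; apply/e; rewrite -row_mul NA0 row0.
Qed.

(** For [h] above all [eps i] the rank of the coefficient matrix is [r * h + \sum eps], while it has
    only [r * h + \sum eta] columns. *)
Lemma sum_indices_le m k r (W : 'M[{poly F}]_(m, r)) (N : 'M_(k, m)) eps eta :
  null_basis W N eps -> (forall i j, size (W i j) <= (eta j).+1)%N -> (m = k + r)%N ->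
  (\sum_i eps i <= \sum_j eta j)%N.
Proof.
move=> nb sW mE; pose h := (\sum_i eps i).+1.
have le_h i : (eps i <= h)%N.
  by rewrite /h (bigD1 i) //= -addnS leq_addr.
have fW : fits (fun _ => h) (fun j => (h + eta j)%N) W.
  by apply: fits_size => i j _ _; rewrite -addnS leq_add2l.
have := rank_pmx nb fW; have := rank_leq_col (pmx (fun _ => h) (fun j => (h + eta j)%N) W).
rewrite [X in (_ <= X)%N]card_sidx big_split /= sum_nat_const card_ord.
have : (\sum_i (h - eps i) + \sum_i eps i = k * h)%N.
  rewrite -big_split /= (eq_bigr (fun _ => h)) ?sum_nat_const ?card_ord // => i _.
  by rewrite subnK.
move: (\rank _) => b; rewrite mE mulnDl; move: (\sum_i (_ - _))%N => a.
by move: (\sum_i eps i)%N (\sum_i eta i)%N (k * h)%N (r * h)%N; clear; lia.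
Qed.

(** The columns of [W] form a minimal basis of the vectors orthogonal to the null space [N], and the
    last clause is the equality of degree sums of dual bases. Truncated subtraction makes [G j l]
    vanish when [eta j + eta l > d]. *)
Definition sym_factor n r q d (P : 'M[{poly F}]_n) (N : 'M_(q, n)) (eps : 'I_q -> nat)
   (W : 'M_(n, r)) (eta : 'I_r -> nat) (G : 'M_r) : Prop :=
  [/\ null_basis N^T W^T eta, P = W *m G *m W^T, G^T = G,
      forall j l, (size (G j l) <= d.+1 - eta j - eta l)%N
    & \det G != 0 /\ (\sum_i eps i)%N = (\sum_j eta j)%N :> nat].

Lemma null_basis_tr_free n r q (N : 'M[{poly F}]_(q, n)) (W : 'M_(n, r)) eta :
  null_basis N^T W^T eta -> forall p (B : 'M_(p, r)), B *m W^T = 0 -> B = 0.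
Proof. by case=> _ _ fW _ p B; exact: pfree_mul. Qed.

Lemma det_neq0_cancel r p (G : 'M[{poly F}]_r) (B : 'M_(p, r)) :
  \det G != 0 -> B *m G = 0 -> B = 0.
Proof.
move=> G0 /(congr1 (mulmxr (\adj G))) /=; rewrite -mulmxA mul_mx_adj mul0mx.
by rewrite mul_mx_scalar => /eqP; rewrite scalemx_eq0 (negbTE G0) => /eqP.
Qed.

Lemma pmxrank_det r (G : 'M[{poly F}]_r) : (\det G != 0) = (pmxrank G == r).
Proof.
have -> : (pmxrank G == r) = row_free (ratmx G) by [].
by rewrite row_free_unit unitmxE unitfE /ratmx det_map_mx tofrac_eq0.
Qed.

(** The rows of [P] are orthogonal to [N], hence combinations of the rows of [W^T]; by symmetry the
    coefficient matrix factors through [W] again. Predictable degrees bound [G], and cancelling [W]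
    on both sides makes it symmetric. *)
Lemma sym_factor_exists n r q d (P : 'M[{poly F}]_n) (N : 'M_(q, n)) eps :
  P^T = P -> (forall i j, size (P i j) <= d.+1)%N -> null_basis P N eps ->
  pmxrank P = r -> (n = q + r)%N ->
  exists (W : 'M_(n, r)) eta G, sym_factor d P N eps W eta G.
Proof.
move=> symP sP nb rP nE; have [NP0 sN fN sat] := nb.
have rN : (n - pmxrank N^T = r)%N.
  rewrite /pmxrank ratmxT mxrank_tr; have /pfreeP/eqP -> := fN; lia.
have [W1 [eta [nbW sW]]] : exists (W1 : 'M_(r, n)) eta, null_basis N^T W1 eta /\ True.
  by have [W1 [eta [_ h _]]] := null_basis_exists N^T; move: W1 eta h; rewrite rN => W1 eta; exists W1, eta.
pose W := W1^T; have {}nbW : null_basis N^T W^T eta by rewrite trmxK.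
have can := null_basis_tr_free nbW.
have PN0 : P *m N^T = 0 by rewrite -symP -trmx_mul NP0 trmx0.
have [X [eX sX]] := null_basis_mx nbW PN0.
have PX : P = W *m X^T by rewrite -symP {1}eX trmx_mul trmxK.
have XN0 : X^T *m N^T = 0.
  rewrite -[LHS]trmxK; rewrite (can _ (X^T *m N^T)^T) ?trmx0 //.
  by rewrite -trmx_mul mulmxA -PX PN0 trmx0.
have [G [eG sG]] := null_basis_mx nbW XN0.
have PG : P = W *m G *m W^T by rewrite -mulmxA -eG.
have symG : G^T = G.
  have : W *m (G^T - G) *m W^T = 0.
    have e : W *m G^T *m W^T = P by rewrite -[RHS]symP [in RHS]PG !trmx_mul !trmxK mulmxA.
    by rewrite mulmxBr mulmxBl e -PG subrr.
  move/can => e; have /can : (G^T - G)^T *m W^T = 0 by rewrite -trmx_mul e trmx0.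
  by move/(congr1 trmx); rewrite trmxK trmx0 => /eqP; rewrite subr_eq0 => /eqP.
have dG : \det G != 0.
  rewrite pmxrank_det eqn_leq rank_leq_row -{1}rP PG /pmxrank !ratmxM.
  by rewrite (leq_trans (mxrankM_maxl _ _)) // mxrankM_maxr.
exists W, eta, G; split=> //.
  move=> j l; apply: sG => i; rewrite mxE.
  exact: sX.
(* [N] is a basis for the left null space of [W] and [W^T] for that of [N^T], so the comparison of
   degree sums applies both ways. *)
split=> //; apply/eqP; rewrite eqn_leq; apply/andP; split.
  apply: (@sum_indices_le n q r W N) => //; last first.
    by move=> i j; have [_ h _ _] := nbW; have := h j i; rewrite mxE.
  apply: null_basis_sat_cols nb _ => v; split.
    by rewrite PG !mulmxA => /can /(det_neq0_cancel dG).
  by move=> e; rewrite PG !mulmxA e !mul0mx.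
apply: (@sum_indices_le n r q N^T W^T) => //; last by rewrite addnC.
by move=> i j; rewrite mxE.
Qed.

Lemma det_size_rows r (A : 'M[{poly F}]_r) (eta : 'I_r -> nat) :
  (forall i j, size (A i j) <= (eta i).+1)%N ->
  (size (\det A) <= (\sum_i eta i).+1)%N.
Proof.
move=> sA; apply: (leq_trans (size_sum _ _ _)); apply/bigmax_leqP => s _.
rewrite mulr_sign (fun_if (fun p : {poly F} => size p)) size_polyN if_same.
have [-> | /prodf_neq0 nz] := eqVneq (\prod_i A i (s i)) 0; first by rewrite size_poly0.
rewrite size_prod; last by move=> i _; apply: nz.
rewrite leq_subLR addnS ltnS -sum1_card -big_split /=; apply: leq_sum => i _; exact: sA.
Qed.

(** Along a permutation [s] each [eta i] is subtracted once for its row and once for its column, so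
    the grade does not depend on [s]. A nonzero product needs [eta i + eta (s i) <= d] for all [i],
    whence the second part. *)
Lemma det_size_sym r d (G : 'M[{poly F}]_r) (eta : 'I_r -> nat) :
  (forall j l, size (G j l) <= d.+1 - eta j - eta l)%N ->
  (size (\det G) <= (r * d - 2 * \sum_i eta i).+1)%N /\
  (\det G != 0 -> (2 * \sum_i eta i <= r * d)%N).
Proof.
move=> sG.
have key (s : 'S_r) : \prod_i G i (s i) != 0 ->
    (2 * \sum_i eta i <= r * d)%N /\
    (size (\prod_i G i (s i))%R <= (r * d - 2 * \sum_i eta i).+1)%N.
  move/prodf_neq0 => nz.
  have le_d i : (eta i + eta (s i) <= d)%N.
    have := nz i isT; rewrite -size_poly_gt0; have := sG i (s i); move: (size _); lia.
  have e : (\sum_i (d - eta i - eta (s i)) + 2 * \sum_i eta i = r * d)%N.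
    rewrite mul2n -addnn [in X in (_ + (X + _))%N](reindex_perm s) /= -!big_split /=.
    rewrite (eq_bigr (fun _ => d)) ?sum_nat_const ?card_ord // => i _.
    by have := le_d i; lia.
  rewrite -e leq_addl addnK size_prod; last by move=> i _; apply: nz.
  split=> //; rewrite leq_subLR addnS ltnS -sum1_card -big_split /=; apply: leq_sum => i _.
  by have := sG i (s i); have := le_d i; move: (size _); lia.
split.
  apply: (leq_trans (size_sum _ _ _)); apply/bigmax_leqP => s _.
  have [-> | nz] := eqVneq (\prod_i G i (s i)) 0; first by rewrite mulr0 size_poly0.
  have [_ h] := key s nz.
  by rewrite mulr_sign; case: ifP => _; rewrite ?size_polyN.
move=> d0; have /existsP[s nz] : [exists s : 'S_r, \prod_i G i (s i) != 0].
  rewrite -[X in is_true X]negbK negb_exists; apply/negP => /forallP h.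
  move: d0; rewrite /determinant big1 ?eqxx // => s _.
  by have /negbNE/eqP -> := h s; rewrite mulr0.
by have [] := key s nz.
Qed.

End Factorization.

(** * Moebius transformations *)

Section Moebius.
Variable F : fieldType.
Implicit Types (p q : {poly F}) (c : F) (k l : nat).

(* [X^k p(c + 1/X)] *)
Definition moeb c k p : {poly F} :=
  \sum_(i < k.+1) p`_i *: ((1 + c *: 'X) ^+ i * 'X^(k - i)).

Lemma moeb_is_linear c k : linear (moeb c k).
Proof.
move=> a p q; rewrite /moeb scaler_sumr -big_split /=; apply: eq_bigr => i _.
by rewrite coefD coefZ scalerDl scalerA.
Qed.
HB.instance Definition _ c k :=
  GRing.isLinear.Build F {poly F} {poly F} *:%R (moeb c k) (moeb_is_linear c k).

Lemma horner_moeb0 c k p : (moeb c k p).[0] = p`_k.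
Proof.
rewrite /moeb horner_sum (bigD1 ord_max) //= big1 => [|i ne].
  rewrite !(hornerE, hornerXn, horner_exp) subnn. by rewrite /= expr1n expr0 !mulr1.
rewrite !(hornerE, hornerXn, horner_exp) expr0n subn_eq0 leqNgt.
suff -> : (i < k)%N by rewrite /= ?mulr0.
by rewrite ltn_neqAle -ltnS ltn_ord andbT.
Qed.

Lemma horner_moeb c k p x : (size p <= k.+1)%N -> x != 0 ->
  (moeb c k p).[x] = x ^+ k * p.[c + x^-1].
Proof.
move=> sp x0; rewrite horner_sum (horner_coef_wide _ sp) mulr_sumr.
apply: eq_bigr => i _; rewrite !(hornerE, hornerXn, horner_exp).
have -> : 1 + c * x = x * (c + x^-1) by rewrite mulrDr mulfV // addrC mulrC.
have ek : x ^+ k = x ^+ (k - i) * x ^+ i by rewrite -exprD subnK // -ltnS.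
rewrite exprMn /= ek.
by move: (x ^+ (k - i)) (x ^+ i) ((c + x^-1) ^+ i) (p`_i) => *; ring.
Qed.

Lemma size_moeb c k p : (size (moeb c k p) <= k.+1)%N.
Proof.
apply: (leq_trans (size_sum _ _ _)); apply/bigmax_leqP => i _.
apply: (leq_trans (size_scale_leq _ _)); have := ltn_ord i; rewrite ltnS => le_ik.
apply: (size_mul_bound (a := i.+1) (b := (k - i).+1)); rewrite ?size_polyXn //; last by lia.
have s1 : (size (1 + c *: 'X)%R <= 2)%N.
  apply: (leq_trans (size_polyD _ _)); rewrite geq_max size_poly1 /=.
  by apply: (leq_trans (size_scale_leq _ _)); rewrite size_polyX.
apply: (leq_trans (size_poly_exp_leq _ _)); rewrite ltnS.
by case: (size _) s1 => [|[|[|]]] //= _; rewrite ?mul0n ?mul1n.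
Qed.

Lemma moebXn c k i : (i <= k)%N -> moeb c k 'X^i = (1 + c *: 'X) ^+ i * 'X^(k - i).
Proof.
move=> le_ik; rewrite /moeb (bigD1 (Ordinal (n := k.+1) (m := i) le_ik)) //=.
rewrite coefXn eqxx scale1r big1 ?addr0 // => j ne; rewrite coefXn.
case: eqP => [e|]; last by rewrite scale0r.
by case/eqP: ne; apply/val_inj.
Qed.

Lemma moebM c k l p q : (size p <= k.+1)%N -> (size q <= l.+1)%N ->
  moeb c (k + l) (p * q) = moeb c k p * moeb c l q.
Proof.
move=> sp sq.
have sum_wide n (s : {poly F}) : (size s <= n)%N -> s = \sum_(i < n) s`_i *: 'X^i.
  by move=> ss; rewrite -poly_def; apply/polyP => i; rewrite coef_poly; case: ltnP => // ge;
     rewrite nth_default // (leq_trans ss ge).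
rewrite (sum_wide _ _ sp) (sum_wide _ _ sq) mulr_suml !linear_sum /= mulr_suml.
apply: eq_bigr => i _; rewrite mulr_sumr linear_sum /= mulr_sumr.
apply: eq_bigr => j _; rewrite -!scalerAl -!scalerAr !linearZ /= -scalerAl -scalerAr.
have := ltn_ord i; have := ltn_ord j; rewrite !ltnS => lej lei.
rewrite -exprD !moebXn ?leq_add //.
have -> : (k + l - (i + j) = (k - i) + (l - j))%N by lia.
by rewrite !exprD; congr (_ *: (_ *: _)); ring.
Qed.

Lemma coef_rev k p i : (moeb 0 k p)`_i = if (i <= k)%N then p`_(k - i) else 0.
Proof.
case: leqP => [le_ik | lt]; last by rewrite nth_default // (leq_trans (size_moeb _ _ _)).
rewrite coef_sum (bigD1 (Ordinal (leq_subr i k : k - i < k.+1)%N)) //=.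
rewrite scale0r addr0 expr1n mul1r coefZ coefXn subKn // eqxx mulr1.
rewrite big1 ?addr0 // => j ne; rewrite expr1n mul1r coefZ coefXn.
case: eqP => [e|]; last by rewrite mulr0.
case/eqP: ne; apply/val_inj => /=; have := ltn_ord j; lia.
Qed.

Lemma moeb0K k p : (size p <= k.+1)%N -> moeb 0 k (moeb 0 k p) = p.
Proof.
move=> sp; apply/polyP => i; rewrite !coef_rev; case: leqP => [le_ik | lt].
  by rewrite leq_subr subKn.
by rewrite nth_default // (leq_trans sp).
Qed.

Lemma moeb_prod c (I : finType) (k : I -> nat) (f : I -> {poly F}) :
  (forall i, (size (f i) <= (k i).+1)%N) ->
  moeb c (\sum_i k i) (\prod_i f i) = \prod_i moeb c (k i) (f i).
Proof.
move=> sf.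
suff [] : (size (\prod_i f i)%R <= (\sum_i k i).+1)%N /\
  moeb c (\sum_i k i) (\prod_i f i) = \prod_i moeb c (k i) (f i) by [].
elim/big_rec3: _ => [|i a b e _ [sb <-]].
  by split; [rewrite size_poly1 | have := moebXn c (leqnn 0); rewrite !expr0 mul1r].
split; last by rewrite moebM.
by apply: (size_mul_bound (sf i) sb); lia.
Qed.

Lemma moeb_det c r d (G : 'M[{poly F}]_r) (eta : 'I_r -> nat) :
  (forall i j, (size (G i j) <= d.+1 - eta i - eta j)%N) ->
  \det (\matrix_(i, j) moeb c (d - eta i - eta j) (G i j)) =
  moeb c (r * d - 2 * \sum_i eta i) (\det G).
Proof.
move=> sG; rewrite /determinant linear_sum /=; apply: eq_bigr => s _.
rewrite (eq_bigr (fun i => moeb c (d - eta i - eta (s i)) (G i (s i)))); last first.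
  by move=> i _; rewrite mxE.
have -> : forall a : {poly F}, (-1) ^+ s * a = (-1) ^+ s *: a.
  by move=> a; case: (odd_perm s); rewrite ?expr0 ?expr1 ?mul1r ?scale1r ?mulN1r ?scaleN1r.
have -> : forall a : {poly F}, (-1) ^+ s * a = (-1) ^+ s *: a.
  by move=> a; case: (odd_perm s); rewrite ?expr0 ?expr1 ?mul1r ?scale1r ?mulN1r ?scaleN1r.
rewrite linearZ /=; congr (_ *: _); rewrite -moeb_prod; last first.
  by move=> i; have := sG i (s i); move: (size _); lia.
(* A vanishing product is set apart: for it the truncated differences need not add up to the common
   grade. *)
have [-> | /prodf_neq0 nz] := eqVneq (\prod_i G i (s i)) 0; first by rewrite !linear0.
congr (moeb c _ _).
have le_d i : (eta i + eta (s i) <= d)%N.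
  have := nz i isT; rewrite -size_poly_gt0; have := sG i (s i); move: (size _); lia.
have e : (\sum_i (d - eta i - eta (s i)) + 2 * \sum_i eta i = r * d)%N.
  rewrite mul2n -addnn [in X in (_ + (X + _))%N](reindex_perm s) /= -!big_split /=.
  rewrite (eq_bigr (fun _ => d)) ?sum_nat_const ?card_ord // => i _.
  by have := le_d i; lia.
by rewrite -e addnK.
Qed.

Definition rev_cols m n (d : 'I_n -> nat) (A : 'M[{poly F}]_(m, n)) :=
  \matrix_(i, j) moeb 0 (d j) (A i j).
Definition rev_rows m n (d : 'I_m -> nat) (A : 'M[{poly F}]_(m, n)) :=
  \matrix_(i, j) moeb 0 (d i) (A i j).

Lemma rev_mul m k n (e : 'I_m -> nat) (d : 'I_n -> nat)
    (A : 'M[{poly F}]_(m, k)) (B : 'M[{poly F}]_(k, n)) :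
  (forall i j, (size (A i j) <= (e i).+1)%N) ->
  (forall i j, (size (B i j) <= (d j).+1)%N) -> forall i j,
  (rev_rows e A *m rev_cols d B) i j = moeb 0 (e i + d j) ((A *m B) i j).
Proof.
move=> sA sB i j; rewrite !mxE linear_sum /=; apply: eq_bigr => l _.
by rewrite !mxE moebM.
Qed.

Lemma rev_rowsK m n (d : 'I_m -> nat) (A : 'M[{poly F}]_(m, n)) :
  (forall i j, (size (A i j) <= (d i).+1)%N) -> rev_rows d (rev_rows d A) = A.
Proof. by move=> sA; apply/matrixP => i j; rewrite !mxE moeb0K. Qed.

Lemma rev_row_comb n k K (N : 'M[{poly F}]_(k, n)) (eps : 'I_k -> nat) (u : 'rV[{poly F}]_k) :
  (forall i j, (size (N i j) <= (eps i).+1)%N) ->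
  (forall i, (size (u 0%R i) <= K.+1 - eps i)%N) ->
  rev_rows (fun _ => K) (u *m N) =
  (\row_i moeb 0 (K - eps i) (u 0 i)) *m rev_rows eps N.
Proof.
move=> sN su; apply/rowP => j; rewrite !mxE linear_sum /=; apply: eq_bigr => i _.
rewrite !mxE.
have [-> | u0] := eqVneq (u 0 i) 0; first by rewrite !(mul0r, linear0).
have le_K : (eps i <= K)%N.
  by have := su i; move: u0; rewrite -size_poly_gt0; move: (size _); lia.
by rewrite -moebM ?subnK //; have := su i; move: (size _); lia.
Qed.

(** Reversal with respect to row and column grades is multiplicative and involutive, so null vectors
    and their degree bounds can be carried back and forth. This makes statements at 0 available at
    infinity. *)
Lemma null_basis_rev m n k (A : 'M[{poly F}]_(m, n)) (N : 'M[{poly F}]_(k, m)) eps d :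
  (forall i j, (size (A i j) <= (d j).+1)%N) ->
  null_basis A N eps -> null_basis (rev_cols d A) (rev_rows eps N) eps.
Proof.
move=> sA [NA0 sN fN sat].
have s_rev : forall i j, (size (rev_rows eps N i j) <= (eps i).+1)%N.
  by move=> i j; rewrite mxE size_moeb.
split=> //.
- by apply/matrixP => i j; rewrite rev_mul // NA0 !mxE linear0.
- move=> u e; pose K := (\sum_i (size (u 0%R i) + eps i))%N.
  have leK i : (size (u 0%R i) + eps i <= K)%N by rewrite /K (bigD1 i) //= leq_addr.
  have su i : (size (u 0%R i) <= K.+1 - eps i)%N by have := leK i; lia.
  have := rev_row_comb s_rev su; rewrite e (rev_rowsK sN).
  have -> : rev_rows (fun _ : 'I_1 => K) (0 : 'M[{poly F}]_(1, m)) = 0.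
    by apply/matrixP => i j; rewrite !mxE linear0.
  move/esym/fN => u0; apply/rowP => i.
  have := congr1 (fun x : 'rV_k => moeb 0 (K - eps i) (x 0 i)) u0.
  by rewrite !mxE linear0 moeb0K //; have := leK i; lia.
move=> v vA0; pose K := vdeg v.
have sv := (vdeg_leP v K).1 (leqnn _).
have [v0 | nz] := eqVneq v 0.
  by exists 0; rewrite mul0mx; split=> // h _ i; rewrite mxE size_poly0.
pose v' := rev_rows (fun _ => K) v.
have /sat[u' [eu su]] : v' *m A = 0.
  have sr : forall i j, (size (rev_cols d A i j) <= (d j).+1)%N.
    by move=> i j; rewrite mxE size_moeb.
  have -> : A = rev_cols d (rev_cols d A).
    by apply/matrixP => i j; rewrite !mxE moeb0K.
  apply/matrixP => i j; rewrite rev_mul //; first by rewrite vA0 !mxE linear0.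
  by move=> i' j'; rewrite ord1.
have {}su := su K.+1 _; have {}su i : (size (u' 0%R i) <= K.+1 - eps i)%N.
  by apply: su => j; rewrite mxE size_moeb.
exists (\row_i moeb 0 (K - eps i) (u' 0 i)); split.
  rewrite -rev_row_comb // -eu rev_rowsK // => i j; by rewrite ord1.
move=> h sh i; have ltKh : (K < h)%N.
  rewrite ltnNge; apply/negP => le; case/negP: nz; apply/eqP/rowP => j.
  have : (vdeg v <= h.-1)%N.
    by apply/vdeg_leP => l; apply: leq_trans (sh l) _; exact: leqSpred.
  rewrite -/K mxE => le2; apply/eqP; rewrite -size_poly_eq0 -leqn0.
  by apply: leq_trans (sh j) _; move: le le2; case: (h) => // a; lia.
rewrite mxE; have [-> | u0] := eqVneq (u' 0 i) 0; first by rewrite linear0 size_poly0.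
apply: leq_trans (size_moeb _ _ _) _.
have := su i; move: u0; rewrite -size_poly_gt0; move: (size _); lia.
Qed.

(** A minimal basis has no zeros: if [c *m N] vanishes at [x], then [c *m N / (X - x)] is a
    polynomial null vector, hence some [u *m N]. So [c = (X - x) u], and evaluation at [x] gives
    [c = 0]. *)
Lemma null_basis_eval m n k (A : 'M[{poly F}]_(m, n)) (N : 'M[{poly F}]_(k, m)) eps x :
  null_basis A N eps -> row_free (map_mx (horner_eval x) N).
Proof.
case=> NA0 sN fN sat; apply/inj_row_free => c cN0.
pose c' := map_mx polyC c.
have H j : exists w, (c' *m N) 0 j = w * ('X - x%:P).
  apply/factor_theorem; rewrite /root mxE horner_sum.
  have := congr1 (fun y : 'rV_m => y 0 j) cN0; rewrite !mxE => e.
  rewrite -[X in _ == X]e; apply/eqP.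
  by apply: eq_bigr => i _; rewrite !mxE hornerM hornerC.
have [f fP] := fin_all_exists H.
pose v : 'rV_m := \row_j f j.
have ev : c' *m N = ('X - x%:P) *: v by apply/rowP => j; rewrite fP !mxE mulrC.
have vA0 : v *m A = 0.
  have := congr1 (mulmxr A) ev; rewrite /= -mulmxA NA0 mulmx0 -scalemxAl => /esym/eqP.
  by rewrite scalemx_eq0 polyXsubC_eq0 /= => /eqP.
have [u [eu _]] := sat v vA0.
have : (c' - ('X - x%:P) *: u) *m N = 0.
  by rewrite mulmxBl ev -scalemxAl -eu subrr.
move/fN => e; apply/rowP => i.
have := congr1 (fun y : 'rV_k => (y 0 i).[x]) e.
by rewrite !mxE !hornerE subrr mul0r subr0.
Qed.

End Moebius.

(** * Smith form and simple eigenvalues *)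

Section Smith.
Variable F : fieldType.
Implicit Types (m n k : nat).

Definition pequiv n (A B : 'M[{poly F}]_n) :=
  exists U V : 'M[{poly F}]_n, [/\ U \in unitmx, V \in unitmx & B = U *m A *m V].

Lemma pequiv_refl n (A : 'M[{poly F}]_n) : pequiv A A.
Proof. by exists 1%:M, 1%:M; rewrite !unitmx1 mul1mx mulmx1. Qed.

Lemma pequiv_trans n (A B C : 'M[{poly F}]_n) : pequiv A B -> pequiv B C -> pequiv A C.
Proof.
move=> [U [V [uU uV ->]]] [U' [V' [uU' uV' ->]]].
by exists (U' *m U), (V *m V'); rewrite !unitmx_mul uU uV uU' uV' !mulmxA.
Qed.

Lemma pequiv_mull n (A U : 'M[{poly F}]_n) : U \in unitmx -> pequiv A (U *m A).
Proof. by move=> uU; exists U, 1%:M; rewrite unitmx1 mulmx1. Qed.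

Lemma pequiv_mulr n (A V : 'M[{poly F}]_n) : V \in unitmx -> pequiv A (A *m V).
Proof. by move=> uU; exists 1%:M, V; rewrite unitmx1 mul1mx. Qed.

Lemma unit_lower n (y : 'cV[{poly F}]_n) :
  (block_mx 1%:M 0 y 1%:M : 'M_(1 + n)) \in unitmx.
Proof. by rewrite unitmxE det_lblock !det1 mulr1 unitr1. Qed.

Lemma unit_upper n (x : 'rV[{poly F}]_n) :
  (block_mx 1%:M x 0 1%:M : 'M_(1 + n)) \in unitmx.
Proof. by rewrite unitmxE det_ublock !det1 mulr1 unitr1. Qed.

Lemma unit_diag n (U : 'M[{poly F}]_n) : U \in unitmx ->
  (block_mx 1%:M 0 0 U : 'M_(1 + n)) \in unitmx.
Proof. by move=> uU; rewrite unitmxE det_lblock det1 mul1r -unitmxE. Qed.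

(** Minimality ranges over all equivalent matrices, so a single division with nonzero remainder is
    already a contradiction; this replaces the Euclidean loop of the elimination. *)
Definition min_pivot n (A : 'M[{poly F}]_(1 + n)) (p : {poly F}) :=
  p != 0 /\ forall B i j, pequiv A B -> B i j != 0 -> (size p <= size (B i j))%N.

Lemma min_pivot_row n (A : 'M[{poly F}]_(1 + n)) p x y C :
  min_pivot A p -> pequiv A (block_mx p%:M x y C) ->
  exists x', x = p *: x'.
Proof.
move=> [p0 pmin] eqv; exists (map_mx (fun q => q %/ p) x).
apply/rowP => j; rewrite !mxE mulrC.
pose V : 'M[{poly F}]_(1 + n) := block_mx 1%:M (- map_mx (fun q => q %/ p) x) 0 1%:M.
have eV : pequiv A (block_mx p%:M x y C *m V).
  by apply: (pequiv_trans eqv); apply: pequiv_mulr; apply: unit_upper.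
apply/eqP; rewrite {1}(divp_eq (x 0 j) p) -subr_eq0 addrAC subrr add0r.
apply: contraT => nz; have := pmin _ (lshift n 0) (rshift 1 j) eV.
rewrite mulmx_block block_mxEur !mxE big_ord1 !mxE eqxx mulr1n.
rewrite (bigD1 j) //= !mxE eqxx mulr1 big1 => [|i ne]; last first.
  by rewrite !mxE (negbTE ne) mulr0n mulr0.
have -> : p * - (x 0 j %/ p) + (x 0 j + 0) = x 0 j %% p.
  by rewrite addr0 {2}(divp_eq (x 0 j) p); ring.
by move=> /(_ nz); rewrite leqNgt ltn_modp p0.
Qed.

Lemma pequiv_tr n (A B : 'M[{poly F}]_n) : pequiv A B -> pequiv A^T B^T.
Proof.
by move=> [U [V [uU uV ->]]]; exists V^T, U^T; rewrite !unitmx_tr !trmx_mul mulmxA.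
Qed.

Lemma min_pivot_tr n (A : 'M[{poly F}]_(1 + n)) p : min_pivot A p -> min_pivot A^T p.
Proof.
move=> [p0 pmin]; split=> // B i j /pequiv_tr; rewrite trmxK => eqv nz.
by have := pmin B^T j i eqv; rewrite mxE; apply.
Qed.

Lemma min_pivot_col n (A : 'M[{poly F}]_(1 + n)) p x y C :
  min_pivot A p -> pequiv A (block_mx p%:M x y C) ->
  exists y', y = p *: y'.
Proof.
move=> /min_pivot_tr mp /pequiv_tr; rewrite tr_block_mx tr_scalar_mx => eqv.
have [x' e] := min_pivot_row mp eqv; exists x'^T.
by rewrite -[LHS]trmxK e linearZ.
Qed.

Lemma smith_step n (A : 'M[{poly F}]_(1 + n)) : A != 0 ->
  exists (p : {poly F}) (C : 'M_n), [/\ p \is monic, pequiv A (block_mx p%:M 0 0 C)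
    & forall i j, p %| C i j].
Proof.
move=> A0.
have [q [mq [B [i [j [eB eq]]]]]] : exists q, min_pivot A q /\
    exists B i j, pequiv A B /\ B i j = q.
  pose S s := exists B i j, [/\ pequiv A B, B i j != 0 & size (B i j) = s].
  have exS : exists s, S s.
    have [i [j nz]] : exists i j, A i j != 0.
      apply: contrapT => no; case/eqP: A0; apply/matrixP => i j; rewrite mxE.
      by apply/eqP; apply: contraT => nz; case: no; exists i, j.
    by exists (size (A i j)), A, i, j; split=> //; apply: pequiv_refl.
  have exb : exists s, `[< S s >] by case: exS => s h; exists s; apply/asboolP.
  case: (ex_minnP exb) => s /asboolP[B [i [j [eB nz sB]]]] smin.
  exists (B i j); split; last by exists B, i, j.
  split=> // B' i' j' eB' nz'; rewrite sB; apply: smin; apply/asboolP.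
  by exists B', i', j'.
have [q0 qmin] := mq.
pose p := (lead_coef q)^-1 *: q.
have lq0 : (lead_coef q)^-1 != 0 by rewrite invr_eq0 lead_coef_eq0.
have sp : size p = size q by rewrite size_scale.
have p0 : p != 0 by rewrite -size_poly_eq0 sp size_poly_eq0.
have mp : min_pivot A p by split=> // *; rewrite sp; apply: qmin.
have eB' : pequiv A ((lead_coef q)^-1%:P%:M *m
    (tperm_mx (lshift n 0) i *m B *m tperm_mx (lshift n 0) j)).
  apply: (pequiv_trans eB); apply: (@pequiv_trans _ _ (tperm_mx (lshift n 0) i *m B *m
    tperm_mx (lshift n 0) j)).
    by exists (tperm_mx (lshift n 0) i), (tperm_mx (lshift n 0) j); rewrite !unitmx_perm.
  apply: pequiv_mull; rewrite unitmxE det_scalar unitrX //.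
  by rewrite poly_unitE coefC eqxx size_polyC lq0 unitfE lq0.
set B' := _ *m _ in eB'.
have eB'p : B' (lshift n 0) (lshift n 0) = p.
  rewrite /B' mul_scalar_mx mxE -xrowE -xcolE !mxE !tpermL eq /p mul_polyC.
  by [].
move: B' eB' eB'p => {eB eq B i j}B eB eq.
have eul : ulsubmx B = p%:M.
  by apply/matrixP => a b; rewrite !ord1 !mxE eqxx mulr1n -eq.
have eBb : B = block_mx p%:M (ursubmx B) (dlsubmx B) (drsubmx B).
  by rewrite -eul submxK.
move: eB; rewrite eBb; move: (ursubmx B) (dlsubmx B) (drsubmx B) => x y D eD.
have [x' ex] := min_pivot_row mp eD; have [y' ey] := min_pivot_col mp eD.
pose U : 'M[{poly F}]_(1 + n) := block_mx 1%:M 0 (- y') 1%:M.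
pose V : 'M[{poly F}]_(1 + n) := block_mx 1%:M (- x') 0 1%:M.
pose C : 'M[{poly F}]_n := D - p *: (y' *m x').
have eC : pequiv A (block_mx p%:M 0 0 C).
  apply: (pequiv_trans eD); exists U, V; split; rewrite ?unit_lower ?unit_upper //.
  rewrite /U /V !mulmx_block !(mul1mx, mulmx1, mul0mx, mulmx0, addr0, add0r).
  rewrite ex ey !mulNmx !mulmxN !mul_mx_scalar !mul_scalar_mx /C.
  have e0 : - (p *: y') + p *: y' = 0 by rewrite addNr.
  rewrite e0 mul0mx oppr0 add0r addNr -scalemxAr; congr block_mx.
  by rewrite addrC.
exists p, C; split=> //; first by rewrite monicE lead_coefZ mulVf // lead_coef_eq0.
move=> a b.
(* Adding row [a] of [C] to the pivot row puts its entries next to the pivot, where minimality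
   forces divisibility. *)
have eR : pequiv A (block_mx p%:M (row a C) 0 C).
  apply: (pequiv_trans eC); pose E : 'M[{poly F}]_(1 + n) := block_mx 1%:M (delta_mx 0 a) 0 1%:M.
  have -> : block_mx p%:M (row a C) 0 C = E *m block_mx p%:M 0 0 C.
    by rewrite /E mulmx_block !(mul1mx, mulmx1, mul0mx, mulmx0, addr0, add0r) rowE.
  by apply: pequiv_mull; apply: unit_upper.
have [z ez] := min_pivot_row mp eR.
have := congr1 (fun w : 'rV_n => w 0 b) ez; rewrite !mxE => ->.
exact: dvdp_mulr.
Qed.

Lemma dvdp_mulmx m n k l p (A : 'M[{poly F}]_(m, n)) (C : 'M_(n, k)) (B : 'M_(k, l)) :
  (forall i j, p %| C i j) -> forall i j, p %| (A *m C *m B) i j.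
Proof.
move=> dC i j; rewrite mxE; elim/big_ind: _ => [|a b da db|h _]; rewrite ?dvdp0 ?dvdp_add //.
apply: dvdp_mulr; rewrite mxE; elim/big_ind: _ => [|a b da db|h' _];
  rewrite ?dvdp0 ?dvdp_add //.
exact: dvdp_mull.
Qed.

Theorem smith_exists n (A : 'M[{poly F}]_n) : exists s, smith_invariants A s.
Proof.
elim: n A => [|n IHn] A.
  exists [::]; split=> //; exists 1%:M, 1%:M; split; rewrite ?unitmx1 //.
  by apply/matrixP => -[].
have [-> | A0] := eqVneq A 0.
  exists [::]; split=> //; exists 1%:M, 1%:M; split; rewrite ?unitmx1 //.
  by rewrite mulmx0 mul0mx; apply/matrixP => i j; rewrite !mxE nth_nil mul0rn.
have [p [C [mp [U [V [uU uV eA]]] dC]]] := smith_step (A0 : (A : 'M_(1 + n)) != 0).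
have [s [ss ms so [U' [V' [uU' uV' eC]]]]] := IHn C.
exists (p :: s); split=> //=; first by rewrite mp ms.
  case: s ss ms so eC => //= q s ss _ -> eC; rewrite andbT.
  have n0 : (0 < n)%N by case: (n) ss.
  have := dvdp_mulmx U' V' dC (Ordinal n0) (Ordinal n0).
  by rewrite eC mxE eqxx.
exists (block_mx 1%:M 0 0 U' *m U : 'M_(1 + n)), (V *m block_mx 1%:M 0 0 V' : 'M_(1 + n)).
split.
- by rewrite unitmx_mul uU andbT; exact: unit_diag.
- by rewrite unitmx_mul uV; exact: unit_diag.
have key : (block_mx 1%:M 0 0 U' : 'M_(1 + n)) *m block_mx p%:M 0 0 C *m
    (block_mx 1%:M 0 0 V' : 'M_(1 + n)) = block_mx p%:M 0 0 (U' *m C *m V').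
  by rewrite !mulmx_block !(mul1mx, mulmx1, mul0mx, mulmx0, addr0, add0r).
transitivity (block_mx p%:M 0 0 (U' *m C *m V') : 'M_(1 + n)).
  by rewrite -key eA !mulmxA.
rewrite eC; apply/matrixP => a b; rewrite !mxE -val_eqE /=.
case: (@splitP 1 n a) => a' ->; rewrite !mxE; case: (@splitP 1 n b) => b' ->.
all: by rewrite !mxE ?ord1.
Qed.

Lemma smith_factor n (P : 'M[{poly F}]_n) s : smith_invariants P s ->
  exists (A : 'M_(n, size s)) (B : 'M_(size s, n)) A' B',
  [/\ P = A *m diag_mx (\row_i s`_i) *m B, A' *m A = 1%:M & B *m B' = 1%:M].
Proof.
case=> ss ms so [U [V [uU uV e]]].
pose E : 'M[{poly F}]_(size s, n) := \matrix_(i, j) (val i == val j)%:R.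
have EE : E *m E^T = 1%:M.
  apply/matrixP => i j; rewrite !mxE (bigD1 (widen_ord ss i)) //= !mxE eqxx mul1r.
  rewrite big1 ?addr0 => [|l ne]; last first.
    rewrite !mxE; case: eqP => [e'|]; last by rewrite mul0r.
    by case/eqP: ne; apply/val_inj.
  by rewrite eq_sym.
have eD : \matrix_(i < n, j < n) (s`_i *+ (i == j)) = E^T *m diag_mx (\row_i s`_i) *m E.
  apply/matrixP => i j; rewrite mul_mx_diag !mxE.
  have [lt | ge] := ltnP i (size s); last first.
    rewrite nth_default // mul0rn big1 // => l _; rewrite !mxE.
    by rewrite (ltn_eqF (leq_trans (ltn_ord l) ge)) !mul0r.
  rewrite (bigD1 (Ordinal lt)) //= !mxE /= eqxx mul1r big1 => [|l ne].
    by rewrite addr0 mulr_natr.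
  rewrite !mxE; case: eqP => [e'|]; last by rewrite !mul0r.
  by case/eqP: ne; apply/val_inj.
exists (invmx U *m E^T), (E *m invmx V), (E *m U), (V *m E^T); split.
- transitivity (invmx U *m (E^T *m diag_mx (\row_i s`_i) *m E) *m invmx V).
    by rewrite -eD -e !mulmxA mulVmx // mul1mx -mulmxA mulmxV // mulmx1.
  by rewrite !mulmxA.
- by rewrite mulmxA -[E *m U *m _]mulmxA mulmxV // mulmx1.
by rewrite mulmxA -[_ *m invmx V *m V]mulmxA mulVmx // mulmx1.
Qed.

Lemma smith_prod_neq0 (s : seq {poly F}) : all (fun p => p \is monic) s ->
  \prod_(p <- s) p != 0.
Proof. by move=> /allP ms; rewrite prodf_seq_neq0; apply/allP => p /ms/monic_neq0. Qed.

(** Write [P = A D B] with [A] left and [B] right invertible. Both factor through [W], as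
    [A = W Y^T] and [B = Z W^T]; then [G = Y^T D Z], and the one-sided inverses make [det Y] and
    [det Z] units. *)
Lemma smith_det n r q (P : 'M[{poly F}]_n) (N : 'M_(q, n)) (W : 'M_(n, r)) eta
    (G : 'M_r) s :
  smith_invariants P s -> N *m P = 0 -> P *m N^T = 0 -> null_basis N^T W^T eta ->
  P = W *m G *m W^T -> \det G != 0 -> \det G %= \prod_(p <- s) p.
Proof.
move=> sP NP0 PN0 nb eP dG.
have [A [B [A' [B' [eAB AA BB]]]]] := smith_factor sP.
have can := null_basis_tr_free nb.
set D := diag_mx _ in eAB.
have eD : \det D = \prod_(p <- s) p.
  rewrite det_diag (big_nth 0) big_mkord; apply: eq_bigr => i _; by rewrite mxE.
have D0 : \det D != 0 by rewrite eD; case: sP => _ ms _ _; exact: smith_prod_neq0.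
have [Y [eY _]] : exists Y, A^T = Y *m W^T /\ True.
  have : A^T *m N^T = 0.
    rewrite -trmx_mul; suff -> : N *m A = 0 by rewrite trmx0.
    apply: (det_neq0_cancel D0).
    have : N *m P *m B' = 0 by rewrite NP0 mul0mx.
    by rewrite eAB !mulmxA -[_ *m B *m B']mulmxA BB mulmx1.
  by move=> /(null_basis_mx nb)[Y [e _]]; exists Y.
have [Z [eZ _]] : exists Z, B = Z *m W^T /\ True.
  have : B *m N^T = 0.
    have DT0 : \det D^T != 0 by rewrite det_tr.
    apply: trmx_inj; rewrite trmx0; apply: (det_neq0_cancel DT0).
    have : A' *m (P *m N^T) = 0 by rewrite PN0 mulmx0.
    rewrite eAB !mulmxA AA mul1mx -trmx_mul => e.
    by rewrite mulmxA e trmx0.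
  by move=> /(null_basis_mx nb)[Z [e _]]; exists Z.
have {}eY : A = W *m Y^T by rewrite -[LHS]trmxK eY trmx_mul trmxK.
have eG : G = Y^T *m D *m Z.
  have e : W *m (G - Y^T *m D *m Z) *m W^T = 0.
    by rewrite mulmxBr mulmxBl -eP {1}eAB eZ {1}eY !mulmxA subrr.
  have /can e2 := e; have /can : (G - Y^T *m D *m Z)^T *m W^T = 0.
    by rewrite -trmx_mul e2 trmx0.
  by move/(congr1 trmx); rewrite trmxK trmx0 => /eqP; rewrite subr_eq0 => /eqP.
have er : size s = r.
  apply/eqP; rewrite eqn_leq; apply/andP; split.
    have : (\rank (ratmx B) <= r)%N.
      by rewrite eZ ratmxM (leq_trans (mxrankM_maxl _ _)) // rank_leq_col.
    apply: leq_trans; have /row_freeP : exists B1, ratmx B *m B1 = 1%:M.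
      by exists (ratmx B'); rewrite -ratmxM BB /ratmx map_mx1.
    by move/eqP ->.
  move: dG; rewrite pmxrank_det => /eqP <-.
  rewrite /pmxrank eG !ratmxM (leq_trans (mxrankM_maxl _ _)) //.
  by rewrite (leq_trans (mxrankM_maxl _ _)) // rank_leq_col.
move: A B A' B' D Y Z eAB AA BB eD D0 eY eZ eG; rewrite er.
move=> A B A' B' D Y Z eAB AA BB eD D0 eY eZ eG.
have uY : \det Y %= 1.
  rewrite -size_poly_eq1 -dvdp1; have := congr1 (fun M : 'M_r => \det M) AA.
  rewrite /= det1 eY mulmxA det_mulmx det_tr => <-; exact: dvdp_mulIr.
have uZ : \det Z %= 1.
  rewrite -size_poly_eq1 -dvdp1; have := congr1 (fun M : 'M_r => \det M) BB.
  rewrite /= det1 eZ -mulmxA det_mulmx => <-; exact: dvdp_mulIl.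
rewrite eG !det_mulmx det_tr -eD -[X in _ %= X]mul1r -[X in _ %= X]mulr1.
by apply: (eqp_trans (eqp_mull _ uZ)); do 2!apply: eqp_mulr.
Qed.

End Smith.

(** * Simple roots on the projective line and elementary divisors *)

Section Points.
Variable F : closedFieldType.
Implicit Types (g p : {poly F}) (nu : seq (option F)).

(* Roots of a polynomial of grade [N] on the projective line, [None] standing
   for the point at infinity. *)
Definition proot (N : nat) g (e : option F) : bool :=
  if e is Some mu then root g mu else g`_N == 0.

Lemma mem_finite nu mu : (mu \in pmap id nu) = (Some mu \in nu).
Proof. by rewrite mem_pmap map_id. Qed.

Lemma size_finite nu : uniq nu -> (size (pmap id nu) + (None \in nu) = size nu)%N.
Proof.
move=> u; rewrite size_pmap -count_uniq_mem // -(count_predC (fun x : option F => x) nu).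
by congr addn; apply: eq_count => -[].
Qed.

Lemma uniq_finite nu : uniq nu -> uniq (pmap id nu).
Proof. by apply: (pmap_uniq (g := Some)) => -[]. Qed.

Lemma mup_prod_roots c (rs : seq F) x : c != 0 ->
  mup x (c *: \prod_(z <- rs) ('X - z%:P)) = count_mem x rs.
Proof.
move=> c0; have rc : ~~ root c%:P x by rewrite rootC.
rewrite -mul_polyC mupMr //; elim: rs => [|z rs IHrs] /=.
  by rewrite big_nil mupNroot // rootC oner_eq0.
rewrite big_cons mupM ?polyXsubC_eq0 //; last first.
  by rewrite prodf_seq_neq0; apply/allP => y _; rewrite polyXsubC_eq0.
by rewrite IHrs -['X - _]expr1 mup_XsubCX; case: eqP.
Qed.

Lemma mup_rev N g : g != 0 -> (size g <= N.+1)%N ->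
  mup 0 (moeb 0 N g) = (N - (size g).-1)%N.
Proof.
move=> g0 sg; set m := (size g).-1; set e := (N - m)%N.
have sg0 : size g = m.+1 by rewrite prednK // size_poly_gt0.
have eN : N = (e + m)%N by rewrite subnK // -ltnS -sg0.
have -> : moeb 0 N g = 'X^e * moeb 0 m g.
  rewrite {1}eN -[g in LHS]mul1r moebM ?size_poly1 ?sg0 //.
  have := @moebXn F 0 e 0 (leq0n _); rewrite expr0 => ->.
  by rewrite expr0 mul1r subn0.
rewrite mupMl; last by rewrite /root horner_moeb0 -lead_coefE lead_coef_eq0.
by rewrite -['X]subr0 -polyC0 mup_XsubCX eqxx.
Qed.

(** A nonzero polynomial of grade [N] has at most [N] roots on the projective line, so [N] distinct
    ones are all of them and each is simple. The multiplicity at infinity is that of the reversal at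
    0. *)
Lemma simple_points g N nu : g != 0 -> (size g <= N.+1)%N -> uniq nu ->
  (N <= size nu)%N -> all (proot N g) nu ->
  [/\ forall mu, mup mu g = (Some mu \in nu), mup 0 (moeb 0 N g) = (None \in nu)
    & size nu = N].
Proof.
move=> g0 sg u le /allP rts.
have rf : all (root g) (pmap id nu).
  by apply/allP => mu; rewrite mem_finite => /rts.
have lt := max_poly_roots g0 rf (uniq_finite u).
have sn := size_finite u.
have sg' : ((None \in nu) + size g <= N.+1)%N.
  case: (boolP (None \in nu)) => [/rts /= /eqP gN | _] //=.
  rewrite add1n ltnS; apply/leq_sizeP => j; rewrite leq_eqVlt => /orP[/eqP <- //|lt'].
  by rewrite nth_default // (leq_trans sg).
have es : size g = (size (pmap id nu)).+1.
  move: sn sg' lt le; move: (nat_of_bool _) (size (pmap id nu)) (size nu) (size g).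
  by clear; lia.
have eN : size nu = N.
  move: es sn sg' lt le; move: (nat_of_bool _) (size (pmap id nu)) (size nu) (size g).
  by clear; lia.
have eg := all_roots_prod_XsubC es rf _; rewrite uniq_rootsE in eg.
have lg : lead_coef g != 0 by rewrite lead_coef_eq0.
split=> // [mu|].
  by rewrite {1}(eg (uniq_finite u)) mup_prod_roots // count_uniq_mem ?uniq_finite // mem_finite.
by rewrite mup_rev // es /= -eN -sn addKn.
Qed.

Lemma simple_points_conv g N nu : g != 0 -> (size g <= N.+1)%N -> uniq nu ->
  (forall mu, mup mu g = (Some mu \in nu)) -> mup 0 (moeb 0 N g) = (None \in nu) ->
  size nu = N /\ all (proot N g) nu.
Proof.
move=> g0 sg u fin inf.
have [rs eg] := closed_field_poly_normal g.
have lg : lead_coef g != 0 by rewrite lead_coef_eq0.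
have sr : size g = (size rs).+1.
  by rewrite eg size_scale // size_prod_XsubC.
have prs : perm_eq rs (pmap id nu).
  apply/allP => mu _ /=; rewrite -(mup_prod_roots _ _ lg) -eg fin.
  by rewrite count_uniq_mem ?uniq_finite // mem_finite.
have := size_finite u; rewrite -(perm_size prs); move: inf; rewrite mup_rev // sr /= => inf.
have lr : (size rs <= N)%N by rewrite -ltnS -sr.
split; first by move: lr; lia.
apply/allP => -[mu | ] mem /=; last first.
  apply/eqP/nth_default; rewrite sr; move: inf; rewrite mem; lia.
apply: contraT => /mupNroot; by rewrite fin mem.
Qed.

Lemma mup_eqp p g x : p != 0 -> p %= g -> mup x p = mup x g.
Proof.
move=> p0 e.
have g0 : g != 0 by apply: contraNneq p0 => g0; rewrite -eqp0 -g0.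
apply/eqP; rewrite eqn_leq; apply/andP; split.
  by rewrite mup_geq // -(eqp_dvdr _ e) -mup_geq.
by rewrite mup_geq // (eqp_dvdr _ e) -mup_geq.
Qed.

Lemma mup_prod (s : seq {poly F}) x : all (fun p => p \is monic) s ->
  mup x (\prod_(p <- s) p) = (\sum_(p <- s) mup x p)%N.
Proof.
elim: s => [|p s IHs] /=; first by rewrite !big_nil mupNroot // rootC oner_eq0.
case/andP => mp ms; by rewrite !big_cons mupM ?IHs ?(monic_neq0 mp) ?smith_prod_neq0.
Qed.

Lemma sum_by_value (T : eqType) (s : seq T) (P : pred T) (f : T -> nat) K :
  {in s, forall x, (f x < K)%N} ->
  (\sum_(x <- s | P x) f x = \sum_(k < K) k * count (fun x => P x && (f x == k)) s)%N.
Proof.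
elim: s => [|x s IHs] H; first by rewrite big_nil big1 // => k _; rewrite muln0.
rewrite big_cons /= IHs => [|y ys]; last by apply: H; rewrite inE ys orbT.
have ltK := H x (mem_head _ _).
under [in RHS]eq_bigr do rewrite mulnDr.
have key : (\sum_(k < K) k * (P x && (f x == k)) = if P x then f x else 0)%N.
  rewrite (bigD1 (Ordinal ltK)) //= eqxx andbT big1 => [|k ne]; last first.
    suff -> : (f x == k) = false by rewrite andbF muln0.
    by apply/negP => /eqP e; case/eqP: ne; apply/val_inj.
  by case: (P x); rewrite ?muln1 ?muln0 addn0.
by rewrite big_split /= key; case: (P x); rewrite ?add0n.
Qed.

Lemma count_sum_bool (T : Type) (s : seq T) (f : T -> nat) (b : bool) k :
  (\sum_(x <- s) f x = b)%N ->
  count (fun x => (0 < k)%N && (f x == k)) s = ((k == 1%N) && b)%N.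
Proof.
elim: s b => [|x s IHs] b; rewrite ?big_nil ?big_cons /=; first by case: b; rewrite ?andbF.
case: (f x) => [|[|m]] e; last by case: b e.
  by rewrite (IHs b) //; case: (k).
have e0 : (\sum_(y <- s) f y = false)%N by case: b e; rewrite add1n // => -[].
by rewrite (IHs false) // andbF addn0; case: b e => //; case: (k) => [|[|k']].
Qed.

(** Smith forms are used only through the total multiplicity at each point. When it is at most one,
    it determines the elementary divisors there. *)
Lemma eld_mult_sum (s : seq {poly F}) (E : seq (option F * nat)) e x :
  (forall k, count_mem (e, k) E = count (fun p => (0 < k)%N && (mup x p == k)) s) ->
  (\sum_(y <- E | y.1 == e) y.2 = \sum_(p <- s) mup x p)%N.
Proof.
move=> cE.
pose K := (\sum_(y <- E) y.2 + \sum_(p <- s) mup x p).+1%N.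
rewrite (@sum_by_value _ E _ _ K) => [|y yE]; last first.
  by rewrite ltnS (big_rem y yE) /= -addnA leq_addr.
rewrite (@sum_by_value _ s predT _ K) => [|p ps]; last first.
  by rewrite ltnS [X in (_ <= _ + X)%N](big_rem p ps) /= addnCA leq_addr.
apply: eq_bigr => -[[|k] _] _ /=; first by rewrite !mul0n.
congr (_ * _)%N; transitivity (count_mem (e, k.+1) E); last by rewrite cE; apply: eq_count.
apply: eq_count => -[a b] /=.
by rewrite xpair_eqE.
Qed.

Lemma eld_of_simple (s : seq {poly F}) nu e x k : uniq nu ->
  (\sum_(p <- s) mup x p)%N = (e \in nu) ->
  count_mem (e, k) [seq (y, 1%N) | y <- nu] =
  count (fun p => (0 < k)%N && (mup x p == k)) s.
Proof.
move=> u /count_sum_bool ->; rewrite count_map.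
case: (k =P 1%N) => [-> | ne].
  transitivity (count_mem e nu); last by rewrite count_uniq_mem.
  by apply: eq_count => y; rewrite /= xpair_eqE eqxx andbT.
rewrite (eq_count (a2 := pred0)) ?count_pred0 // => y /=.
by rewrite xpair_eqE; apply/negP => /andP[_ /eqP e1]; case: ne.
Qed.

End Points.

(** * Symmetric matrix polynomials *)

Section Indices.

(** The multiplicity of [k] is the second difference at [k] of [h |-> \sum (h - x)]. These are the
    sums that ranks of coefficient matrices compute, so ranks determine the multiset of indices. *)
Lemma count_by_defects (l : seq nat) k :
  (count_mem k l + 2 * \sum_(x <- l) (k - x) =
   \sum_(x <- l) (k.+1 - x) + \sum_(x <- l) (k.-1 - x))%N.
Proof.
elim: l => [|x l IHl]; rewrite ?big_nil ?big_cons //=.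
have e : ((x == k) + 2 * (k - x) = (k.+1 - x) + (k.-1 - x))%N.
  by case: (x =P k) => [->|]; lia.
by rewrite mulnDr addnACA e IHl addnACA.
Qed.

Lemma perm_by_defects (l l' : seq nat) :
  (forall h, \sum_(x <- l) (h - x) = \sum_(x <- l') (h - x))%N -> perm_eq l l'.
Proof.
move=> e; apply/allP => k _ /=; apply/eqP.
have := count_by_defects l k; have := count_by_defects l' k.
by rewrite -!e => <- /eqP; rewrite eqn_add2r => /eqP.
Qed.

Definition balanced q al s : seq nat := nseq s al.+1 ++ nseq (q - s) al.

Lemma sum_balanced q al s (f : nat -> nat) :
  (\sum_(x <- balanced q al s) f x = s * f al.+1 + (q - s) * f al)%N.
Proof. by rewrite big_cat !big_nseq !iter_addn_0 !(mulnC (f _)). Qed.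

(** No entry is below [al] and at most [q - s] entries equal [al], so the sum is at least
    [al * q + s]. The opposite bound leaves no freedom. *)
Lemma balancedP (l : seq nat) q al s : size l = q -> (s <= q)%N ->
  (\sum_(x <- l) (al - x) = 0)%N -> (\sum_(x <- l) (al.+1 - x) <= q - s)%N ->
  (\sum_(x <- l) x <= al * q + s)%N ->
  (al * q + s)%N = (\sum_(x <- l) x)%N /\ perm_eq l (balanced q al s).
Proof.
move=> sl lesq z1 z2 z3.
have key (l0 : seq nat) : (\sum_(x <- l0) (al - x) = 0)%N ->
    (size l0 * al + size l0 <= \sum_(x <- l0) x + \sum_(x <- l0) (al.+1 - x))%N /\
    ((size l0 * al + size l0 = \sum_(x <- l0) x + \sum_(x <- l0) (al.+1 - x))%N ->
     all (fun x => (x == al) || (x == al.+1)) l0 /\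
     count_mem al l0 = (\sum_(x <- l0) (al.+1 - x))%N).
  elim: l0 => [|x l0 IHl]; rewrite ?big_nil ?big_cons //= => /eqP.
  rewrite addn_eq0 => /andP[/eqP e /eqP /IHl[h1 h2]].
  rewrite mulSn; split; first by move: h1 e; lia.
  move=> e2; have [|h3 ->] := h2 _; first by move: h1 e e2; lia.
  rewrite h3 andbT; split; first by move: h1 e e2; lia.
  by congr addn; case: (x =P al) => [->|ne]; move: h1 e e2; lia.
have [k1 k2] := key l z1.
have eq1 : (size l * al + size l = \sum_(x <- l) x + \sum_(x <- l) (al.+1 - x))%N.
  by move: k1 z2 z3 lesq; rewrite sl mulnC; lia.
have [al1 c1] := k2 eq1.
have c2 : count_mem al l = (q - s)%N.
  by rewrite c1; move: eq1 k1 z2 z3 lesq; rewrite sl mulnC; lia.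
split; first by move: c2 eq1; rewrite c1 sl mulnC; lia.
have c3 : count_mem al.+1 l = s.
  suff : (count_mem al l + count_mem al.+1 l = size l)%N by rewrite c2 sl; lia.
  elim: l al1 {sl z1 z2 z3 k1 k2 eq1 c1 c2} => //= x l IHl /andP[h /IHl e].
  by rewrite addnACA e; case/orP: h => /eqP ->; rewrite eqxx; lia.
apply/allP => x; rewrite mem_cat /= => mx; rewrite count_cat !count_nseq /=.
have : (x == al) || (x == al.+1).
  case/orP: mx => [/(allP al1) // |]; rewrite mem_cat !mem_nseq.
  by case/orP => /andP[_ ->]; rewrite ?orbT.
case/orP => /eqP ->; rewrite eqxx.
  by rewrite c2 (gtn_eqF (ltnSn al)) mul0n mul1n.
by rewrite c3 (ltn_eqF (ltnSn al)) mul0n mul1n addn0.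
Qed.

End Indices.

Section MatPoly.
Variables (F : fieldType) (d n : nat).
Implicit Types (P Q : matpoly F d n).

Lemma matpoly_mxE P i j : matpoly_mx P i j = \sum_(k < d.+1) P k i j *: 'X^k.
Proof.
rewrite /matpoly_mx summxE; apply: eq_bigr => k _.
by rewrite !mxE mulrC mul_polyC.
Qed.

Lemma coef_matpoly P i j (k : 'I_d.+1) : (matpoly_mx P i j)`_k = P k i j.
Proof.
rewrite matpoly_mxE coef_sum (bigD1 k) //= coefZ coefXn eqxx mulr1 big1 ?addr0 // => l ne.
rewrite coefZ coefXn; case: eqP => [e|]; last by rewrite mulr0.
by case/eqP: ne; apply/val_inj.
Qed.

Lemma size_matpoly P i j : (size (matpoly_mx P i j) <= d.+1)%N.
Proof.
rewrite matpoly_mxE; apply: (leq_trans (size_sum _ _ _)); apply/bigmax_leqP => l _.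
by apply: (leq_trans (size_scale_leq _ _)); rewrite size_polyXn.
Qed.

Lemma matpoly_mx_eq P (A : 'M[{poly F}]_n) :
  (forall i j, (size (A i j) <= d.+1)%N) ->
  (forall (k : 'I_d.+1) i j, P k i j = (A i j)`_k) -> matpoly_mx P = A.
Proof.
move=> sA eA; apply/matrixP => i j; apply/polyP => k.
have [lt | ge] := ltnP k d.+1.
  by rewrite (coef_matpoly _ _ _ (Ordinal lt)) eA.
by rewrite !nth_default // (leq_trans _ ge) ?size_matpoly.
Qed.

Lemma matpoly_mx_tr P : POLs P -> (matpoly_mx P)^T = matpoly_mx P.
Proof.
move=> sP; apply/matrixP => i j; rewrite mxE !matpoly_mxE; apply: eq_bigr => k _.
by rewrite -[in LHS](sP k) mxE.
Qed.

Lemma matpoly_mx_rev P : matpoly_mx (rev_matpoly P) = rev_cols (fun _ => d) (matpoly_mx P).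
Proof.
apply: matpoly_mx_eq => [i j | k i j]; first by rewrite mxE size_moeb.
rewrite ffunE mxE coef_rev -ltnS ltn_ord.
by rewrite -[(d - k)%N]/(nat_of_ord (rev_ord k)) coef_matpoly.
Qed.

(** Its corank counts the null vectors of degree below [h]; [h + d] columns suffice for a polynomial
    of grade [d]. *)
Definition phi h Q := pmx (fun _ : 'I_n => h) (fun _ : 'I_n => (h + d)%N) (matpoly_mx Q).

Lemma rank_phi h Q k (N : 'M_(k, n)) eps : null_basis (matpoly_mx Q) N eps ->
  (\rank (phi h Q) + \sum_i (h - eps i) = n * h)%N.
Proof.
move=> nb; apply: (rank_pmx nb); apply: fits_size => i j _ _.
by rewrite -addnS leq_add2l size_matpoly.
Qed.

Lemma min_indices_defect h Q L : left_minimal_indices (matpoly_mx Q) L ->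
  (\rank (phi h Q) + \sum_(x <- L) (h - x) = n * h)%N.
Proof.
case=> k [N [mN pL]]; rewrite -(rank_phi h (null_basis_min mN)); congr addn.
by rewrite (perm_big _ pL) big_map big_enum.
Qed.

Lemma min_indices_unique Q L L' : left_minimal_indices (matpoly_mx Q) L ->
  left_minimal_indices (matpoly_mx Q) L' -> perm_eq L L'.
Proof.
move=> mL mL'; apply: perm_by_defects => h.
by have := min_indices_defect h mL; rewrite -(min_indices_defect h mL') => /eqP;
  rewrite eqn_add2l => /eqP.
Qed.

Lemma min_indices_size Q L : left_minimal_indices (matpoly_mx Q) L ->
  size L = (n - mprank Q)%N.
Proof.
case=> k [N [[/left_null_poly_basisP[_ _ kE] _] /perm_size ->]].
by rewrite size_map -cardE card_ord kE.
Qed.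

Definition sym_data r Q (N : 'M_(n - r, n)) eps (W : 'M_(n, r)) eta G :=
  [/\ POLs Q, left_minimal_basis (matpoly_mx Q) N, null_basis (matpoly_mx Q) N eps,
      eps = (fun i => vdeg (row i N)) & sym_factor d (matpoly_mx Q) N eps W eta G].

Lemma sym_data_exists r Q : POLs Q -> mprank Q = r ->
  exists N eps W eta G, @sym_data r Q N eps W eta G.
Proof.
move=> sQ rQ; have [N [eps [mN nb e]]] := null_basis_exists (matpoly_mx Q).
have rk : pmxrank (matpoly_mx Q) = r by [].
move: N eps mN nb e; rewrite rk => N eps mN nb e.
have le_rn : (r <= n)%N by rewrite -rQ; apply: rank_leq_row.
have [W [eta [G h]]] := sym_factor_exists (matpoly_mx_tr sQ) (size_matpoly Q) nb rk
  (esym (subnK le_rn)).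
by exists N, eps, W, eta, G; split.
Qed.

Lemma smith_sym_data r Q N eps W eta G s : @sym_data r Q N eps W eta G ->
  smith_invariants (matpoly_mx Q) s ->
  \det G %= \prod_(p <- s) p.
Proof.
case=> sQ mN [NP0 _ _ _] _ [nbW eQ symG sG [dG _]] sm.
apply: (smith_det sm NP0 _ nbW eQ dG).
by rewrite -(matpoly_mx_tr sQ) -trmx_mul NP0 trmx0.
Qed.

Lemma rev_factor r (W : 'M[{poly F}]_(n, r)) (eta : 'I_r -> nat) (G : 'M[{poly F}]_r) :
  (forall i j, (size (W i j) <= (eta j).+1)%N) ->
  (forall j l, (size (G j l) <= d.+1 - eta j - eta l)%N) ->
  rev_cols (fun _ => d) (W *m G *m W^T) =
  rev_cols eta W *m (\matrix_(j, l) moeb 0 (d - eta j - eta l) (G j l)) *m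
    (rev_cols eta W)^T.
Proof.
move=> sW sG; apply/matrixP => i j; rewrite !mxE linear_sum /=; apply: eq_bigr => l _.
rewrite !mxE !mulr_suml linear_sum /=; apply: eq_bigr => k _; rewrite !mxE.
have [-> | g0] := eqVneq (G k l) 0; first by rewrite !(mulr0, mul0r, linear0).
have le_d : (eta k + eta l <= d)%N.
  by have := sG k l; move: g0; rewrite -size_poly_gt0; move: (size _); lia.
have s1 : (size (G k l) <= (d - eta k - eta l).+1)%N.
  by have := sG k l; move: (size _); lia.
rewrite -!moebM //.
  by congr (moeb 0 _ _); lia.
apply: (size_mul_bound (sW _ _) s1); lia.
Qed.

Lemma moeb_neq0 N (g : {poly F}) : g != 0 -> (size g <= N.+1)%N -> moeb 0 N g != 0.
Proof.
by move=> g0 sg; apply: contraNneq g0 => e; rewrite -(moeb0K sg) e linear0.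
Qed.

(** Reversing [N], [W] and [G] along their grades gives a factorization of the reversed polynomial
    of the same kind, to which [smith_det] applies again. *)
Lemma smith_sym_data_rev r Q N eps W eta G t : @sym_data r Q N eps W eta G ->
  smith_invariants (matpoly_mx (rev_matpoly Q)) t ->
  moeb 0 (r * d - 2 * \sum_i eta i) (\det G) %= \prod_(p <- t) p.
Proof.
case=> sQ mN nb _ [nbW eQ symG sG [dG _]]; rewrite matpoly_mx_rev => sm.
have [sd _] := det_size_sym sG.
have sW i j : (size (W i j) <= (eta j).+1)%N.
  by have [_ h _ _] := nbW; have := h j i; rewrite mxE.
have [_ sN _ _] := nb.
have [NP0 _ _ _] := null_basis_rev (fun i j => size_matpoly Q i j) nb.
have sNt i j : (size (N^T i j) <= (eps j).+1)%N by rewrite mxE.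
have := null_basis_rev sNt nbW.
have -> : rev_cols eps N^T = (rev_rows eps N)^T by apply/matrixP => i j; rewrite !mxE.
have -> : rev_rows eta W^T = (rev_cols eta W)^T by apply/matrixP => i j; rewrite !mxE.
move=> nbr; rewrite -moeb_det //.
apply: (smith_det sm NP0 _ nbr).
- have <- : (rev_cols (fun _ => d) (matpoly_mx Q))^T = rev_cols (fun _ => d) (matpoly_mx Q).
    by apply/matrixP => i j; rewrite !mxE -{1}(matpoly_mx_tr sQ) mxE.
  by rewrite -trmx_mul NP0 trmx0.
- by rewrite eQ (rev_factor sW sG).
by rewrite moeb_det // moeb_neq0.
Qed.

End MatPoly.

(** * Counting simple roots by ranks *)

Section SimpleRoots.
Variable F : closedFieldType.
Implicit Types (f g h p w : {poly F}).

Definition sylv_mx D f : 'M[{poly F}]_(2, 1) :=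
  \matrix_(i, j) (if i == 0 then f else f^`() ^+ D).
(** Bounds for Bezout cofactors: the one of [f'^D] can be reduced modulo [f] to size [D], and then
    the one of [f] has size at most [D * D + 1]. *)
Definition sylv_rows D (i : 'I_2) : nat := if i == 0 then (D * D).+1 else D.
Definition sylv_cols D (j : 'I_1) : nat := (D + (D * D).+1)%N.

(* Rows span the multiples of [gcd(f, f'^D)] of bounded size; that gcd collects
   the multiple roots of [f] with their full multiplicity. *)
Definition sylv D f := pmx (sylv_rows D) (sylv_cols D) (sylv_mx D f).

Lemma sylv_fits D f : (size f <= D.+1)%N -> fits (sylv_rows D) (sylv_cols D) (sylv_mx D f).
Proof.
move=> sf; apply: fits_size => i j; rewrite mxE /sylv_rows /sylv_cols.
case: (i == 0) => _ h; first by rewrite addnC -[X in (_ <= X)%N]addSn leq_add2r.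
rewrite -addnS leq_add2l.
have sd : (size f^`() <= D)%N.
  by apply/leq_sizeP => k le; rewrite coef_deriv nth_default ?mul0rn // (leq_trans sf).
apply: (leq_trans (size_poly_exp_leq _ _)); rewrite ltnS leqW // leq_mul //.
by apply: leq_trans sd; exact: leq_pred.
Qed.

Lemma gcd_rows D p : p != 0 -> (size p <= sylv_cols D ord0)%N ->
  let K := pmx (fun _ : 'I_1 => (sylv_cols D ord0 - (size p).-1)%N) (sylv_cols D) p%:M in
  \rank K = (sylv_cols D ord0 - (size p).-1)%N.
Proof.
move=> p0 sp K; have fK : fits (fun _ : 'I_1 => (sylv_cols D ord0 - (size p).-1)%N)
    (sylv_cols D) (p%:M : 'M_1).
  apply: fits_size => i j; rewrite !ord1 mxE eqxx mulr1n => _.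
  have : (0 < size p)%N by rewrite size_poly_gt0.
  by rewrite /sylv_cols; move: sp; rewrite /sylv_cols; move: (size p); lia.
have := card_sidx (fun _ : 'I_1 => (sylv_cols D ord0 - (size p).-1)%N).
rewrite big_ord1 => eT; apply: etrans eT; apply/eqP/inj_row_free => c.
rewrite mul_pmx => /enc_eq0 e; rewrite -[c]encK.
have : dec c *m p%:M = 0 by apply: e; apply: fK; apply: size_dec.
rewrite mul_mx_scalar => /eqP; rewrite scalemx_eq0 (negbTE p0) /= => /eqP ->.
exact: enc0.
Qed.

Lemma sylv_rank D f : size f = D.+1 ->
  (\rank (sylv D f) + (size (gcdp f (f^`() ^+ D))).-1 = sylv_cols D ord0)%N.
Proof.
move=> sf; set h := _ ^+ D; set p := gcdp f h.
have f0 : f != 0 by rewrite -size_poly_gt0 sf.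
have p0 : p != 0 by rewrite gcdp_eq0 negb_and f0.
have sp : (size p <= D.+1)%N by rewrite -sf dvdp_leq // dvdp_gcdl.
have spT : (size p <= sylv_cols D ord0)%N.
  by apply: leq_trans sp _; rewrite /sylv_cols addnS ltnS leq_addr.
have fS := sylv_fits (eq_leq sf).
set K := pmx (fun _ : 'I_1 => (sylv_cols D ord0 - (size p).-1)%N) (sylv_cols D) p%:M.
have rK : \rank K = (sylv_cols D ord0 - (size p).-1)%N by apply: gcd_rows.
suff -> : \rank (sylv D f) = \rank K.
  by rewrite rK subnK // (leq_trans (leq_pred _)).
apply/eqP; rewrite eqn_leq; apply/andP; split; apply: mxrankS; apply/row_subP => x.
  rewrite rowE mul_pmx; set v := dec _.
  have sv : forall j, (size (v 0%R j) <= sylv_rows D j)%N by move=> j; apply: size_dec.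
  have /dvdpP[y ey] : p %| (v *m sylv_mx D f) 0 0.
    rewrite mxE big_ord_recl big_ord1 !mxE /=; apply: dvdp_add; apply: dvdp_mull.
      exact: dvdp_gcdl.
    exact: dvdp_gcdr.
  have ev : v *m sylv_mx D f = y%:M *m p%:M.
    by apply/matrixP => a b; rewrite !ord1 ey mul_mx_scalar !mxE eqxx mulr1n mulrC.
  have sy : (size y <= sylv_cols D ord0 - (size p).-1)%N.
    have [-> | y0] := eqVneq y 0; first by rewrite size_poly0.
    have := fS v sv 0; rewrite ey size_mul //.
    move: p0 y0; rewrite -!size_poly_gt0.
    by move: (size p) (size y) (sylv_cols D _); clear; lia.
  apply/submxP; exists (enc (fun _ : 'I_1 => (sylv_cols D ord0 - (size p).-1)%N) y%:M).
  rewrite ev mul_pmx decK // => j; rewrite ord1 mxE eqxx mulr1n //.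
rewrite rowE mul_pmx; set v := dec _.
have sv : forall j, (size (v 0%R j) <= sylv_cols D ord0 - (size p).-1)%N.
  by move=> j; apply: size_dec.
set y := v 0 0.
have ev : v = y%:M by rewrite [LHS]mx11_scalar.
have [[u1 u2] /= /eqpP[[c1 c2] /= /andP[c10 c20] eu]] := Bezoutp f h.
have {}eu : p = (c2^-1 * c1) *: (u1 * f + u2 * h).
  by rewrite -scalerA eu scalerA mulVf // scale1r.
(* [c] normalizes the Bezout identity, which holds only up to scalars. The second cofactor is
   replaced by its remainder modulo [f] and the quotient moves to the first, so that both meet the
   size bounds. *)
pose c := c2^-1 * c1; pose y2 := y * (c *: u2).
pose q := y2 %/ f; pose r := y2 %% f; pose q1 := y * (c *: u1) + q * h.
have eyp : y * p = q1 * f + r * h.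
  rewrite eu /q1 -/c -mul_polyC; have := divp_eq y2 f; rewrite -/q -/r => er.
  have -> : r = y2 - q * f by rewrite er addrC addKr.
  by rewrite /y2 -!mul_polyC; ring.
have sr : (size r <= D)%N by rewrite -ltnS -sf ltn_modp.
have s_yp : (size (y * p)%R <= sylv_cols D ord0)%N.
  have := sv 0; rewrite -/y => sy; apply: (size_mul_bound sy (leqnn _)).
  by move: p0 spT; rewrite -size_poly_gt0; move: (size p); lia.
have s_rh : (size (r * h)%R <= sylv_cols D ord0)%N.
  have := fS (\row_i (if i == 0 then 0 else r)) _ 0.
  rewrite mxE big_ord_recl big_ord1 !mxE /= mul0r add0r; apply => j.
  by rewrite mxE /sylv_rows; case: (j == 0); rewrite ?size_poly0.
have s_q1 : (size q1 <= (D * D).+1)%N.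
  have [-> | q10] := eqVneq q1 0; first by rewrite size_poly0.
  have : (size (q1 * f)%R <= sylv_cols D ord0)%N.
    have -> : q1 * f = y * p - r * h by rewrite eyp addrK.
    by rewrite (leq_trans (size_polyD _ _)) // geq_max s_yp size_polyN.
  rewrite size_mul // sf /sylv_cols; move: (size q1); clear; lia.
apply/submxP; exists (enc (sylv_rows D) (\row_i (if i == 0 then q1 else r))).
rewrite mul_pmx decK => [|j]; last by rewrite mxE /sylv_rows; case: (j == 0).
congr (enc _ _); apply/matrixP => a b; rewrite !ord1 ev mul_mx_scalar.
by rewrite !mxE big_ord_recl big_ord1 !mxE /= mulr1n mulrC eyp.
Qed.

Lemma deriv_mup p z : mup z p = 1%N -> p^`().[z] != 0.
Proof.
move=> m1; have p0 : p != 0.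
  have : (mup z p < (size p).+1)%N by apply: ltn_ord.
  by rewrite m1 ltnS size_poly_gt0.
have : 'X - z%:P %| p by rewrite XsubC_dvd // m1.
case/dvdpP => q eq; rewrite eq derivM derivXsubC mulr1 !hornerE subrr mulr0 add0r.
apply/negP => /eqP qz.
have : root q z by rewrite /root qz.
case/factor_theorem => q' eq'.
have : (2 <= mup z p)%N by rewrite mup_geq // eq eq' -mulrA -expr2 dvdp_mull.
by rewrite m1.
Qed.

(** A multiple root of multiplicity [m <= D] occurs with full multiplicity in [f'^D], hence in the
    gcd. Therefore [f] divided by the gcd has exactly simple roots, and the rank bounds the degree
    of the gcd. *)
Lemma simple_roots_of_rank D f e : size f = D.+1 ->
  (sylv_cols D ord0 <= \rank (sylv D f) + e)%N ->
  exists rs : seq F, [/\ uniq rs, (D <= size rs + e)%N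
    & forall z, z \in rs -> root f z /\ f^`().[z] != 0].
Proof.
move=> sf; rewrite -(sylv_rank sf) leq_add2l; set h := _ ^+ D; set p := gcdp f h => lep.
have f0 : f != 0 by rewrite -size_poly_gt0 sf.
have p0 : p != 0 by rewrite gcdp_eq0 negb_and f0.
have ef : f = f %/ p * p by rewrite divpK // dvdp_gcdl.
set k := f %/ p in ef.
have k0 : k != 0 by apply: contraNneq f0 => e0; rewrite ef e0 mul0r.
have [rs ek] := closed_field_poly_normal k.
have lk : lead_coef k != 0 by rewrite lead_coef_eq0.
have rk z : (z \in rs) = root k z.
  by rewrite ek rootZ // root_prod_XsubC.
have sk : size k = (size rs).+1 by rewrite ek size_scale // size_prod_XsubC.
have simple z : root k z -> f^`().[z] != 0.
  move=> kz; apply/negP => /eqP fz.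
  pose m := mup z f.
  have dm : ('X - z%:P) ^+ m %| f by rewrite -mup_geq.
  have le_mD : (m <= D)%N.
    have := dvdp_leq f0 dm; rewrite sf size_exp_XsubC ltnS //.
  have dp : ('X - z%:P) ^+ m %| p.
    rewrite dvdp_gcd dm (dvdp_trans (dvdp_exp2l _ le_mD)) //.
    by apply: dvdp_exp2r; rewrite dvdp_XsubCl /root fz.
  have : (m.+1 <= mup z f)%N.
    by rewrite mup_geq // ef exprS dvdp_mul // dvdp_XsubCl.
  by rewrite ltnn.
exists rs; split.
- apply: count_mem_uniq => z; rewrite -(mup_prod_roots _ _ lk) -ek rk.
  have [kz | nk] := boolP (root k z); last by rewrite mupNroot.
  apply/eqP; rewrite eqn_leq -XsubC_dvd // dvdp_XsubCl kz andbT leqNgt; apply/negP.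
  rewrite mup_geq // => d2.
  have : ('X - z%:P) ^+ 2 %| f by rewrite ef dvdp_mulr.
  case/dvdpP => q eq; have := simple z kz; rewrite eq expr2 !derivM.
  by rewrite !(hornerXsubC, hornerM, hornerD) subrr !(mulr0, mul0r, addr0) eqxx.
- have : size f = (size rs + size p)%N.
    by rewrite ef size_mul // sk addSn.
  by rewrite sf; move: p0 lep; rewrite -size_poly_gt0; move: (size p); clear; lia.
move=> z; rewrite rk => kz; split; last exact: simple.
by rewrite ef rootM kz.
Qed.

(** The gcd is coprime to [g], as [f'] does not vanish at the roots of [g]; so it divides
    [w ^+ 2]. *)
Lemma rank_of_simple_roots D g w e : size (g * w ^+ 2) = D.+1 ->
  (forall z, root g z -> (g * w ^+ 2)^`().[z] != 0) -> (size w <= e.+1)%N ->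
  (sylv_cols D ord0 <= \rank (sylv D (g * w ^+ 2)) + 2 * e)%N.
Proof.
set f := g * _ => sf simple sw; rewrite -(sylv_rank sf) leq_add2l.
set h := _ ^+ D; set p := gcdp f h.
have f0 : f != 0 by rewrite -size_poly_gt0 sf.
have w0 : w ^+ 2 != 0 by apply: contraNneq f0 => e0; rewrite /f e0 mulr0.
have p0 : p != 0 by rewrite gcdp_eq0 negb_and f0.
have cop : coprimep p g.
  rewrite coprimep_def; apply/negPn/closed_rootP => -[z]; rewrite root_gcd => /andP[pz gz].
  move: pz; rewrite root_gcd => /andP[_]; rewrite /root horner_exp expf_eq0.
  by case/andP => _; rewrite (negbTE (simple z gz)).
have : p %| w ^+ 2 by rewrite -(Gauss_dvdpr _ cop) dvdp_gcdl.
move/(dvdp_leq w0) => le; have le2 := leq_trans le (size_poly_exp_leq w 2).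
rewrite -subn1 leq_subLR add1n (leq_trans le2) // ltnS mulnC leq_mul2l /=.
by move: sw; case: (size w).
Qed.

End SimpleRoots.

(** * Moving a point to infinity, and compressions by constant matrices *)

Section Transport.
Variable F : closedFieldType.
Implicit Types (f g h p w : {poly F}).

Lemma coef_moeb_top c k p : (size p <= k.+1)%N -> (moeb c k p)`_k = p.[c].
Proof.
move=> sp; rewrite coef_sum (horner_coef_wide _ sp); apply: eq_bigr => i _.
have le_ik : (i <= k)%N by rewrite -ltnS.
have s1 : (size (1 + c *: 'X : {poly F})%R <= 2)%N.
  apply: (leq_trans (size_polyD _ _)); rewrite geq_max size_poly1 /=.
  by apply: (leq_trans (size_scale_leq _ _)); rewrite size_polyX.
have H j : (size ((1 + c *: 'X : {poly F}) ^+ j) <= j.+1)%N /\ ((1 + c *: 'X : {poly F}) ^+ j)`_j = c ^+ j.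
  elim: j => [|j [sj cj]]; first by rewrite !expr0 size_poly1 coef1.
  rewrite !exprS; split; first by apply: (size_mul_bound s1 sj).
  by rewrite -add1n (coefM_top s1 sj) cj coefD coefZ coefX coef1 /= mulr1 add0r.
have [si ci] := H i; have s2 : (size ('X^(k - i) : {poly F}) <= (k - i).+1)%N by rewrite size_polyXn.
by have := coefM_top si s2; rewrite coefZ subnKC // => ->; rewrite ci coefXn eqxx mulr1.
Qed.

Lemma moeb_det_rows c r (A : 'M[{poly F}]_r) (eta : 'I_r -> nat) :
  (forall i j, (size (A i j) <= (eta i).+1)%N) ->
  \det (\matrix_(i, j) moeb c (eta i) (A i j)) = moeb c (\sum_i eta i) (\det A).
Proof.
move=> sA; rewrite /determinant linear_sum /=; apply: eq_bigr => s _.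
rewrite (eq_bigr (fun i => moeb c (eta i) (A i (s i)))); last by move=> i _; rewrite mxE.
rewrite -moeb_prod // !mulr_sign.
by case: ifP => _ //; rewrite linearN.
Qed.

(* [None] is the point at infinity, reached at [z = 0]. *)
Definition point_of c (z : F) : option F := if z == 0 then None else Some (c + z^-1).

Lemma point_of_inj c : injective (point_of c).
Proof.
move=> x y; rewrite /point_of; case: eqP => [->|_]; case: eqP => [->|_] // [].
by move/addrI/invr_inj.
Qed.

Lemma root_moeb c N g z : (size g <= N.+1)%N ->
  root (moeb c N g) z = proot N g (point_of c z).
Proof.
move=> sg; rewrite /point_of /root; case: (z =P 0) => [->|/eqP z0] /=; first by rewrite horner_moeb0.
by rewrite horner_moeb // mulf_eq0 expf_eq0 (negbTE z0) andbF.
Qed.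

Definition par_of c (e : option F) : F := if e is Some mu then (mu - c)^-1 else 0.

Lemma par_ofK c e : e != Some c -> point_of c (par_of c e) = e.
Proof.
case: e => [mu|]; rewrite /point_of /par_of; last by rewrite eqxx.
rewrite (inj_eq (@Some_inj _)) -subr_eq0 => ne; rewrite invr_eq0 (negbTE ne) invrK.
by rewrite addrC subrK.
Qed.

(** The change of variable sends [c] to infinity. If [f.[c] != 0], the transform has degree exactly
    [D], so roots of [f] at infinity become finite; the rank bound says that at least [D - 2 * a]
    roots are simple. *)
Definition cond_pt D a c f :=
  (moeb c D f)`_D != 0 /\
  (sylv_cols D ord0 <= \rank (sylv D (moeb c D f)) + 2 * a)%N.

Lemma cond_pt_size D a c f : cond_pt D a c f -> size (moeb c D f) = D.+1.
Proof.
case=> nz _; apply/eqP; rewrite eqn_leq size_moeb ltnNge.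
by apply: contra nz => le; rewrite nth_default.
Qed.

(** The [N] roots of [g] are simple and avoid those of [w], so they stay simple in [g * w ^+ 2]. *)
Lemma cond_pt_intro N a c g w nu : (size g <= N.+1)%N -> (size w <= a.+1)%N ->
  g.[c] != 0 -> w.[c] != 0 -> uniq nu -> (N <= size nu)%N -> all (proot N g) nu ->
  all (fun e => ~~ proot a w e) nu ->
  cond_pt (N + (a + a)) a c (g * w ^+ 2).
Proof.
move=> sg sw gc wc u le rts nrts.
have sw2 : (size (w ^+ 2)%R <= (a + a).+1)%N.
  by rewrite expr2; apply: (size_mul_bound sw sw); rewrite addnS.
have sgw : (size (g * w ^+ 2)%R <= (N + (a + a)).+1)%N.
  by apply: (size_mul_bound sg sw2); rewrite addnS.
have g0 : g != 0 by apply: contraNneq gc => ->; rewrite horner0.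
have top : (moeb c (N + (a + a)) (g * w ^+ 2))`_(N + (a + a)) != 0.
  by rewrite coef_moeb_top // hornerM horner_exp mulf_neq0 ?expf_neq0.
split=> //.
have eM : moeb c (N + (a + a)) (g * w ^+ 2) = moeb c N g * moeb c a w ^+ 2.
  by rewrite moebM // !expr2 moebM.
rewrite eM; apply: rank_of_simple_roots; last exact: size_moeb.
  rewrite -eM; apply/eqP; rewrite eqn_leq size_moeb ltnNge.
  by apply: contra top => le'; rewrite nth_default.
have [_ _ sN] := simple_points g0 sg u le rts.
have cnu e : e \in nu -> e != Some c.
  move/(allP rts); case: e => // mu /=; apply: contraTneq => -[->].
  exact: gc.
pose rs := map (par_of c) nu.
have urs : uniq rs.
  rewrite map_inj_in_uniq // => x y /cnu nx /cnu ny e.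
  by rewrite -(par_ofK nx) e par_ofK.
have rrs : all (root (moeb c N g)) rs.
  apply/allP => _ /mapP[e enu ->]; rewrite root_moeb // par_ofK ?cnu //.
  exact: (allP rts).
have sgh : size (moeb c N g) = (size rs).+1.
  rewrite size_map sN; apply/eqP; rewrite eqn_leq size_moeb ltnNge.
  apply: contra gc => le'; rewrite -(coef_moeb_top c sg) nth_default //.
move=> z gz.
have eg := all_roots_prod_XsubC sgh rrs _; rewrite uniq_rootsE in eg.
have lg : lead_coef (moeb c N g) != 0.
  by rewrite lead_coef_eq0 -size_poly_eq0 sgh.
have zrs : z \in rs by move: gz; rewrite (eg urs) rootZ // root_prod_XsubC.
have m1 : mup z (moeb c N g) = 1%N.
  by rewrite (eg urs) mup_prod_roots // count_uniq_mem // zrs.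
have wz : ~~ root (moeb c a w) z.
  rewrite root_moeb //; apply: (allP nrts).
  by case/mapP: zrs => e enu ->; rewrite par_ofK ?cnu.
move: gz; rewrite /root => /eqP gz.
rewrite derivM hornerD !hornerM gz mul0r addr0 mulf_neq0 ?deriv_mup //.
by rewrite mulf_neq0.
Qed.

(** A root of [w] is at least double in [g * w ^+ 2], so all simple roots that the rank provides
    belong to [g]. *)
Lemma cond_pt_elim N a b c g w : (size g <= N.+1)%N -> (size w <= b.+1)%N ->
  cond_pt (N + (b + b)) a c (g * w ^+ 2) ->
  exists nu, [/\ uniq nu, (N + 2 * b <= size nu + 2 * a)%N & all (proot N g) nu].
Proof.
move=> sg sw cp; have sf := cond_pt_size cp; case: cp => _ rk.
have [rs [u le simple]] := simple_roots_of_rank sf rk.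
exists (map (point_of c) rs); split.
- by rewrite map_inj_uniq //; exact: point_of_inj.
- by rewrite size_map mul2n -addnn.
apply/allP => _ /mapP[z /simple[fz dz] ->]; rewrite -root_moeb //.
have sw2 : (size (w ^+ 2)%R <= (b + b).+1)%N.
  by rewrite expr2; apply: (size_mul_bound sw sw); rewrite addnS.
move: fz dz; rewrite moebM // expr2 moebM // -expr2 rootM.
case/orP => // wz; rewrite derivM expr2 !derivM.
have {}wz : (moeb c b w).[z] = 0.
  by move: wz; rewrite rootE horner_exp expf_eq0 => /andP[_ /eqP].
by rewrite !(hornerM, hornerD) wz !(mulr0, mul0r, addr0) eqxx.
Qed.

(** Induction along a line: [X] serves the old matrices, a right inverse [Y] serves the new one, and
    all but finitely many points [X + t Y] serve them all. *)
Lemma generic_compression n r (Ms : seq 'M[F]_(r, n)) : all (fun M => row_free M) Ms ->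
  exists X : 'M[F]_(n, r), all (fun M => \det (M *m X) != 0) Ms.
Proof.
elim: Ms => [|M Ms IHMs] /=; first by exists 0.
case/andP => /row_freeP[Y eY] /IHMs[X aX].
pose Z := map_mx polyC X + 'X *: map_mx polyC Y : 'M[{poly F}]_(n, r).
pose dd (M' : 'M_(r, n)) := \det (map_mx polyC M' *m Z).
have ev (M' : 'M_(r, n)) t : (dd M').[t] = \det (M' *m (X + t *: Y)).
  rewrite /dd -[LHS]/(horner_eval t _) -det_map_mx map_mxM; congr (\det (_ *m _)).
    by apply/matrixP => i j; rewrite !mxE; exact: hornerC.
  by apply/matrixP => i j; rewrite !mxE; apply: (etrans (hornerD _ _ _)); rewrite hornerM hornerX !hornerC.
have nzMs M' : M' \in Ms -> dd M' != 0.
  move/(allP aX) => h; apply: contraNneq h => e.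
  by have := ev M' 0; rewrite e horner0 scale0r addr0 => <-.
have nzM : dd M != 0.
  (* The same line seen from infinity: at 0 it takes the value [Y], so the determinant for [M] is
     not identically zero. *)
  pose Z' := 'X *: map_mx polyC X + map_mx polyC Y : 'M[{poly F}]_(n, r).
  pose d' := \det (map_mx polyC M *m Z').
  have ev' t : d'.[t] = \det (M *m (t *: X + Y)).
    rewrite /d' -[LHS]/(horner_eval t _) -det_map_mx map_mxM; congr (\det (_ *m _)).
      by apply/matrixP => i j; rewrite !mxE; exact: hornerC.
    by apply/matrixP => i j; rewrite !mxE; apply: (etrans (hornerD _ _ _)); rewrite hornerM hornerX !hornerC.
  have d'0 : d' != 0.
    apply/eqP => e; have := ev' 0; rewrite e horner0 scale0r add0r eY det1 => /esym/eqP.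
    by rewrite oner_eq0.
  have /closed_nonrootP[t] : 'X * d' != 0 by rewrite mulf_neq0 ?polyX_eq0.
  rewrite rootM rootX negb_or => /andP[t0 nt]; apply: contraNneq nt => e.
  rewrite /root ev'.
  have -> : t *: X + Y = t *: (X + t^-1 *: Y).
    by rewrite scalerDr scalerA mulfV // scale1r.
  by rewrite -scalemxAr detZ -ev e horner0 mulr0.
have /closed_nonrootP[t nt] : dd M * \prod_(M' <- Ms) dd M' != 0.
  rewrite mulf_neq0 // prodf_seq_neq0; apply/allP => M' /nzMs -> //.
exists (X + t *: Y); move: nt; rewrite rootM negb_or => /andP[h1 h2].
apply/andP; split; first by rewrite -ev.
apply/allP => M' mem; rewrite -ev; move: h2; rewrite /root horner_prod.
by rewrite prodf_seq_neq0 => /allP/(_ M' mem).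
Qed.

End Transport.

(** * Generic eigenstructures as open conditions *)

Section Generic.
Variables (F : closedFieldType) (d n r : nat).
Implicit Types (Q : matpoly F d n) (X : 'M[F]_(n, r)).

Definition compress X (A : 'M[{poly F}]_n) : {poly F} :=
  \det ((map_mx polyC X)^T *m A *m map_mx polyC X).

Lemma compress_factor X (W : 'M[{poly F}]_(n, r)) G :
  compress X (W *m G *m W^T) = \det G * \det (W^T *m map_mx polyC X) ^+ 2.
Proof.
rewrite /compress !mulmxA -[_ *m W^T *m _]mulmxA !det_mulmx.
by rewrite -[(_)^T *m W]trmxK trmx_mul trmxK det_tr; ring.
Qed.

Lemma compress_rank X (A : 'M[{poly F}]_n) : compress X A != 0 -> (r <= pmxrank A)%N.
Proof.
rewrite pmxrank_det => /eqP <-; rewrite /pmxrank !ratmxM.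
by apply: (leq_trans (mxrankM_maxl _ _)); exact: mxrankM_maxr.
Qed.

(* The two rank bounds limit the left null vectors of degree below [al] and [al.+1]; the simple
   roots of the compression bound the sum of the minimal indices from above. *)
Definition open_cond al s Q X c : Prop :=
  [/\ (n * al <= \rank (phi al Q))%N,
      (n * al.+1 <= \rank (phi al.+1 Q) + (n - r - s))%N
    & cond_pt (r * d) (al * (n - r) + s) c (compress X (matpoly_mx Q))].

(** The generic class without a representative [K]; points of [nu] may include infinity, and
    symmetry makes the left indices suffice. *)
Definition generic_at al s Q : Prop :=
  [/\ POLs Q, mprank Q = r, left_minimal_indices (matpoly_mx Q) (balanced (n - r) al s)
    & exists nu : seq (option F), [/\ uniq nu,
        size nu = (r * d - 2 * (al * (n - r) + s))%N
      & elementary_divisors Q [seq (x, 1%N) | x <- nu]]].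

Lemma sum_mup_smith (s : seq {poly F}) g x : g != 0 -> all (fun p => p \is monic) s ->
  g %= \prod_(p <- s) p -> (\sum_(p <- s) mup x p)%N = mup x g.
Proof. by move=> g0 ms e; rewrite (mup_eqp x g0 e) mup_prod. Qed.

Lemma sym_data_det_size Q N eps W eta G : @sym_data F d n r Q N eps W eta G ->
  (size (\det G) <= (r * d - 2 * \sum_i eta i).+1)%N /\ (2 * \sum_i eta i <= r * d)%N.
Proof.
case=> _ _ _ _ [_ _ _ sG [dG _]]; have [h1 h2] := det_size_sym sG.
by split=> //; apply: h2.
Qed.

Lemma sym_data_col_size Q N eps W eta G X : @sym_data F d n r Q N eps W eta G ->
  (size (\det (W^T *m map_mx polyC X)) <= (\sum_i eta i).+1)%N.
Proof.
case=> _ _ _ _ [[_ sW _ _] _ _ _ _]; apply: det_size_rows => i j.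
rewrite mxE; apply: (leq_trans (size_sum _ _ _)); apply/bigmax_leqP => l _.
rewrite !mxE mulrC mul_polyC; apply: (leq_trans (size_scale_leq _ _)).
by have := sW i l; rewrite mxE.
Qed.

Lemma eld_sums Q N eps W eta G E : @sym_data F d n r Q N eps W eta G ->
  elementary_divisors Q E ->
  (forall mu, \sum_(y <- E | y.1 == Some mu) y.2 = mup mu (\det G))%N /\
  (\sum_(y <- E | y.1 == None) y.2 =
   mup 0 (moeb 0 (r * d - 2 * \sum_i eta i) (\det G)))%N.
Proof.
move=> sd [s [t [ss st cE]]]; have [sG _] := sym_data_det_size sd.
have [_ _ _ _ [_ _ _ _ [dG _]]] := sd.
have [_ ms _ _] := ss; have [_ mt _ _] := st.
split=> [mu|].
  rewrite (@eld_mult_sum _ s E (Some mu) mu) => [|k]; last exact: cE.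
  by apply: sum_mup_smith => //; exact: smith_sym_data sd ss.
rewrite (@eld_mult_sum _ t E None 0) => [|k]; last exact: cE.
apply: sum_mup_smith => //; first exact: moeb_neq0.
exact: smith_sym_data_rev sd st.
Qed.

Lemma eld_exists Q N eps W eta G nu : @sym_data F d n r Q N eps W eta G -> uniq nu ->
  (forall mu, mup mu (\det G) = (Some mu \in nu)) ->
  mup 0 (moeb 0 (r * d - 2 * \sum_i eta i) (\det G)) = (None \in nu) ->
  elementary_divisors Q [seq (x, 1%N) | x <- nu].
Proof.
move=> sd u fin inf; have [sG _] := sym_data_det_size sd.
have [_ _ _ _ [_ _ _ _ [dG _]]] := sd.
have [s ss] := smith_exists (matpoly_mx Q).
have [t st] := smith_exists (matpoly_mx (rev_matpoly Q)).
have [_ ms _ _] := ss; have [_ mt _ _] := st.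
exists s, t; split=> // -[mu|] k; apply: eld_of_simple => //.
  by rewrite (sum_mup_smith _ dG ms) // (smith_sym_data sd ss).
rewrite (sum_mup_smith _ (moeb_neq0 dG sG) mt) //; exact: smith_sym_data_rev sd st.
Qed.

(** Put [a = al * (n - r) + s]. The ranks give [\sum eps >= a]. The compression gives at least
    [r * d - 2 * a] simple points of [\det G], whose grade is [r * d - 2 * \sum eta], so
    [\sum eta <= a]. The two sums agree, so both bounds are equalities. *)
Lemma generic_of_open_cond al s Q X c : (r <= n)%N -> (s <= n - r)%N ->
  POLs_rank r Q -> open_cond al s Q X c -> generic_at al s Q.
Proof.
move=> le_rn lesq [sQ rQ] [c1 c2 c3].
have rk : mprank Q = r.
  apply/eqP; rewrite eqn_leq rQ; apply: (@compress_rank X).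
  have := cond_pt_size c3; case: eqP => // ->.
  by rewrite linear0 size_poly0.
have [N [eps [W [eta [G sd]]]]] := sym_data_exists sQ rk.
have [sG le2] := sym_data_det_size sd.
have sW := sym_data_col_size X sd.
have [_ mN nb e_eps [_ eQ _ _ [dG e_sum]]] := sd.
pose q := (n - r)%N; pose l := [seq eps i | i <- enum 'I_q].
have sl f : (\sum_(x <- l) f x = \sum_i f (eps i))%N by rewrite big_map big_enum.
have z1 : (\sum_(x <- l) (al - x) = 0)%N.
  by have := rank_phi al nb; rewrite sl; move: c1; move: (\rank _); lia.
have z2 : (\sum_(x <- l) (al.+1 - x) <= q - s)%N.
  by have := rank_phi al.+1 nb; rewrite sl; move: c2; rewrite -/q; move: (\rank _); lia.
have szl : size l = q by rewrite size_map -cardE card_ord.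
have ge : (al * q + s <= \sum_i eps i)%N.
  have : (q * al.+1 <= \sum_i (eps i + (al.+1 - eps i)))%N.
    rewrite -[X in (X * _)%N]card_ord -sum_nat_const; apply: leq_sum => i _; lia.
  rewrite big_split /=; move: z2; rewrite sl mulnS mulnC.
  by move: (\sum_i _)%N (\sum_i _)%N lesq; rewrite -/q; lia.
move: c3; rewrite eQ compress_factor.
have eN : (r * d = (r * d - 2 * \sum_i eta i) + (\sum_i eta i + \sum_i eta i))%N.
  by rewrite addnn -mul2n subnK.
rewrite {1}eN => /(cond_pt_elim sG sW)[nu [u le rts]].
have le' : (r * d - 2 * \sum_i eta i <= size nu)%N.
  move: le ge le2; rewrite -/q e_sum.
  by move: (\sum_i eta i)%N (size nu) (r * d)%N (al * q + s)%N; clear; lia.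
have [fin inf szn] := simple_points dG sG u le' rts.
have z3 : (\sum_(x <- l) x <= al * q + s)%N.
  rewrite sl e_sum; move: le le2; rewrite szn -/q.
  by move: (\sum_i eta i)%N (r * d)%N (al * q + s)%N; clear; lia.
have [ea pl] := balancedP szl lesq z1 z2 z3.
split=> //.
  exists q, N; split=> //; rewrite perm_sym.
  by move: pl; rewrite /l e_eps.
exists nu; split=> //; last exact: eld_exists sd u fin inf.
by rewrite szn -e_sum -(sl id) -ea.
Qed.

(** It remains to choose [X] such that [w = \det (W^T X)] avoids the eigenvalues, including
    infinity, and then a point [c] that is a root of neither [\det G] nor [w]. *)
Lemma open_cond_of_generic al s Q : (r <= n)%N -> (s <= n - r)%N ->
  (2 * (al * (n - r) + s) <= r * d)%N ->
  generic_at al s Q -> exists X c, open_cond al s Q X c.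
Proof.
move=> le_rn lesq le2a [sQ rk mL [nu [u szn eld]]].
have [N [eps [W [eta [G sd]]]]] := sym_data_exists sQ rk.
have [sG le2] := sym_data_det_size sd.
have [sum_fin sum_inf] := eld_sums sd eld.
have [_ mN nb e_eps [nbW eQ _ _ [dG e_sum]]] := sd.
have mult e : (\sum_(y <- [seq (x, 1%N) | x <- nu] | y.1 == e) y.2 = (e \in nu))%N.
  rewrite big_map /= (eq_bigr (fun _ => 1%N)) // sum1_count.
  by rewrite count_uniq_mem.
have fin mu : mup mu (\det G) = (Some mu \in nu) by rewrite -sum_fin mult.
have inf : mup 0 (moeb 0 (r * d - 2 * \sum_i eta i) (\det G)) = (None \in nu).
  by rewrite -sum_inf mult.
have [szN rts] := simple_points_conv dG sG u fin inf.
have ea : (\sum_i eta i = al * (n - r) + s)%N.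
  by move: szn le2 le2a; rewrite szN; clear; lia.
(* The value at infinity is that of the reversed matrix at 0. All values have full rank because
   minimal bases have no zeros. *)
pose Mat (e : option F) : 'M[F]_(r, n) :=
  if e is Some mu then map_mx (horner_eval mu) W^T
  else map_mx (horner_eval 0) (rev_rows eta W^T).
have sNt i j : (size (N^T i j) <= (eps j).+1)%N by have [_ h _ _] := nb; rewrite mxE.
(* The extra point [Some 0] ensures [w != 0] even if [nu] is empty. *)
have [X aX] : exists X : 'M[F]_(n, r), all (fun M => \det (M *m X) != 0) (map Mat (Some 0 :: nu)).
  apply: generic_compression; apply/allP => _ /mapP[e _ ->]; case: e => [mu|].
    exact: null_basis_eval nbW.
  exact: null_basis_eval (null_basis_rev sNt nbW).
pose w := \det (W^T *m map_mx polyC X).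
have sw : (size w <= (\sum_i eta i).+1)%N by apply: sym_data_col_size sd.
have ew mu : w.[mu] = \det (Mat (Some mu) *m X).
  rewrite -[LHS]/(horner_eval mu _) -det_map_mx map_mxM; congr (\det (_ *m _)).
  by apply/matrixP => i j; rewrite !mxE; exact: hornerC.
have ewinf : w`_(\sum_i eta i) = \det (Mat None *m X).
  rewrite -(horner_moeb0 0) -moeb_det_rows => [|i j]; last first.
    rewrite mxE; apply: (leq_trans (size_sum _ _ _)); apply/bigmax_leqP => l _.
    rewrite !mxE mulrC mul_polyC; apply: (leq_trans (size_scale_leq _ _)).
    by have [_ h _ _] := nbW; have := h i l; rewrite mxE.
  rewrite -[LHS]/(horner_eval 0 _) -det_map_mx; congr (\det _).
  apply/matrixP => i j; rewrite !mxE -[LHS]/((_).[0]) linear_sum /= horner_sum.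
  apply: eq_bigr => l _; rewrite !mxE.
  by rewrite mulrC mul_polyC linearZ /= hornerZ mulrC.
have w0 : w != 0.
  have /andP[h _] := aX; apply: contraNneq h => e.
  by rewrite -ew e horner0.
have nrts : all (fun e => ~~ proot (\sum_i eta i) w e) nu.
  apply/allP => e enu; have := allP aX (Mat e).
  rewrite map_f ?inE ?enu ?orbT // => /(_ isT).
  by case: e {enu} => [mu|] /=; rewrite -?ew -?ewinf.
have /closed_nonrootP[c nc] : \det G * w != 0 by rewrite mulf_neq0.
move: nc; rewrite rootM negb_or => /andP[gc wc].
exists X, c; split.
- have := min_indices_defect al mL; rewrite sum_balanced.
  by rewrite subnn [(al - al.+1)%N](eqP (leqnSn al)) !muln0 !addn0 => ->.
- have := min_indices_defect al.+1 mL; rewrite sum_balanced subnn muln0 add0n.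
  by rewrite subSnn muln1 => <-.
rewrite eQ compress_factor -ea.
have {1}-> : (r * d = (r * d - 2 * \sum_i eta i) + (\sum_i eta i + \sum_i eta i))%N.
  by rewrite addnn -mul2n subnK.
by apply: (cond_pt_intro sG sw gc wc u _ rts nrts); rewrite szN.
Qed.

End Generic.

(** * Polynomial functions of the coefficients *)

Lemma rank_witness (F : fieldType) m p (A : 'M[F]_(m, p)) :
  exists (L : 'M_(\rank A, m)) R, L *m A *m R = 1%:M.
Proof.
have [L eL] := row_fullP (col_base_full A).
have [R eR] := row_freeP (row_base_free A).
have e : L *m (col_base A *m row_base A) *m R = 1%:M.
  by rewrite mulmxA eL mul1mx.
by exists L, R; rewrite -e mulmx_base.
Qed.

Section PolyFun.
Variables (F : closedFieldType) (d n : nat).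
Local Notation T := (matpoly F d n).

(** An inductive closure rather than multivariate polynomials: local Lipschitz bounds and
    restriction to polynomial curves both follow by induction on it. *)
Inductive polyfun : (T -> F) -> Prop :=
| polyfun_coord k i j : polyfun (fun Q => Q k i j)
| polyfun_const a : polyfun (fun _ => a)
| polyfun_add f g : polyfun f -> polyfun g -> polyfun (fun Q => f Q + g Q)
| polyfun_mul f g : polyfun f -> polyfun g -> polyfun (fun Q => f Q * g Q).

Lemma polyfun_ext f g : f =1 g -> polyfun f -> polyfun g.
Proof. by move/funext ->. Qed.

Lemma polyfun_sum (I : Type) (s : seq I) (P : pred I) (f : I -> T -> F) :
  (forall i, polyfun (f i)) -> polyfun (fun Q => \sum_(i <- s | P i) f i Q).
Proof.
move=> pf; elim: s => [|i s IHs].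
  by apply: (@polyfun_ext (fun _ => 0)); [move=> Q; rewrite big_nil | exact: polyfun_const].
case: (boolP (P i)) => Pi.
  apply: (@polyfun_ext (fun Q => f i Q + \sum_(j <- s | P j) f j Q)).
    by move=> Q; rewrite big_cons Pi.
  exact: polyfun_add.
by apply: polyfun_ext IHs => Q; rewrite big_cons (negbTE Pi).
Qed.

Lemma polyfun_prod (I : Type) (s : seq I) (P : pred I) (f : I -> T -> F) :
  (forall i, polyfun (f i)) -> polyfun (fun Q => \prod_(i <- s | P i) f i Q).
Proof.
move=> pf; elim: s => [|i s IHs].
  by apply: (@polyfun_ext (fun _ => 1)); [move=> Q; rewrite big_nil | exact: polyfun_const].
case: (boolP (P i)) => Pi.
  apply: (@polyfun_ext (fun Q => f i Q * \prod_(j <- s | P j) f j Q)).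
    by move=> Q; rewrite big_cons Pi.
  exact: polyfun_mul.
by apply: polyfun_ext IHs => Q; rewrite big_cons (negbTE Pi).
Qed.

Lemma polyfun_det m (A : T -> 'M[F]_m) :
  (forall i j, polyfun (fun Q => A Q i j)) -> polyfun (fun Q => \det (A Q)).
Proof.
move=> pA; apply: polyfun_sum => s; apply: polyfun_mul; first exact: polyfun_const.
by apply: polyfun_prod => i; apply: pA.
Qed.

Definition ppoly (p : T -> {poly F}) := forall k, polyfun (fun Q => (p Q)`_k).

Lemma ppoly_ext f g : f =1 g -> ppoly f -> ppoly g.
Proof. by move/funext ->. Qed.

Lemma ppoly_const p : ppoly (fun _ => p).
Proof. by move=> k; exact: polyfun_const. Qed.

Lemma ppoly_mul f g : ppoly f -> ppoly g -> ppoly (fun Q => f Q * g Q).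
Proof.
move=> pf pg k; apply: (@polyfun_ext (fun Q => \sum_(j < k.+1) (f Q)`_j * (g Q)`_(k - j))).
  by move=> Q; rewrite coefM.
by apply: polyfun_sum => j; exact: polyfun_mul.
Qed.

Lemma ppoly_sum (I : Type) (s : seq I) (P : pred I) (f : I -> T -> {poly F}) :
  (forall i, ppoly (f i)) -> ppoly (fun Q => \sum_(i <- s | P i) f i Q).
Proof.
move=> pf k; apply: (@polyfun_ext (fun Q => \sum_(i <- s | P i) (f i Q)`_k)).
  by move=> Q; rewrite coef_sum.
by apply: polyfun_sum => i; exact: pf.
Qed.

Lemma ppoly_prod (I : Type) (s : seq I) (P : pred I) (f : I -> T -> {poly F}) :
  (forall i, ppoly (f i)) -> ppoly (fun Q => \prod_(i <- s | P i) f i Q).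
Proof.
move=> pf; elim: s => [|i s IHs].
  by apply: (@ppoly_ext (fun _ => 1)); [move=> Q; rewrite big_nil | exact: ppoly_const].
case: (boolP (P i)) => Pi.
  apply: (@ppoly_ext (fun Q => f i Q * \prod_(j <- s | P j) f j Q)).
    by move=> Q; rewrite big_cons Pi.
  exact: ppoly_mul.
by apply: ppoly_ext IHs => Q; rewrite big_cons (negbTE Pi).
Qed.

Lemma ppoly_exp f m : ppoly f -> ppoly (fun Q => f Q ^+ m).
Proof.
move=> pf; elim: m => [|m IHm]; first exact: ppoly_const.
by apply: (@ppoly_ext (fun Q => f Q * f Q ^+ m)); [move=> Q; rewrite exprS | exact: ppoly_mul].
Qed.

Lemma ppoly_deriv f : ppoly f -> ppoly (fun Q => (f Q)^`()).
Proof.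
move=> pf k; apply: (@polyfun_ext (fun Q => k.+1%:R * (f Q)`_k.+1)).
  by move=> Q; rewrite coef_deriv mulr_natl.
by apply: polyfun_mul; [exact: polyfun_const | exact: pf].
Qed.

Lemma ppoly_moeb c D f : ppoly f -> ppoly (fun Q => moeb c D (f Q)).
Proof.
move=> pf; apply: ppoly_sum => i k.
apply: (@polyfun_ext (fun Q => (f Q)`_i * ((1 + c *: 'X) ^+ i * 'X^(D - i))`_k)).
  by move=> Q; rewrite coefZ.
by apply: polyfun_mul; [exact: pf | exact: polyfun_const].
Qed.

Lemma ppoly_det m (A : T -> 'M[{poly F}]_m) :
  (forall i j, ppoly (fun Q => A Q i j)) -> ppoly (fun Q => \det (A Q)).
Proof.
move=> pA; apply: ppoly_sum => s; apply: ppoly_mul; first exact: ppoly_const.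
by apply: ppoly_prod => i; apply: pA.
Qed.

Lemma ppoly_mulmx m p q (A : T -> 'M[{poly F}]_(m, p)) (B : T -> 'M_(p, q)) :
  (forall i j, ppoly (fun Q => A Q i j)) -> (forall i j, ppoly (fun Q => B Q i j)) ->
  forall i j, ppoly (fun Q => (A Q *m B Q) i j).
Proof.
move=> pA pB i j; apply: (@ppoly_ext (fun Q => \sum_l A Q i l * B Q l j)).
  by move=> Q; rewrite mxE.
by apply: ppoly_sum => l; apply: ppoly_mul; [exact: pA | exact: pB].
Qed.

Lemma ppoly_matpoly i j : ppoly (fun Q => matpoly_mx Q i j).
Proof.
move=> k; have [lt | ge] := ltnP k d.+1.
  apply: (@polyfun_ext (fun Q => Q (Ordinal lt) i j)); last exact: polyfun_coord.
  by move=> Q; rewrite -coef_matpoly.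
apply: (@polyfun_ext (fun _ => 0)); last exact: polyfun_const.
by move=> Q; rewrite nth_default // (leq_trans (size_matpoly _ _ _)).
Qed.

Lemma polyfun_pmx m p (dm : 'I_m -> nat) (dp : 'I_p -> nat) (A : T -> 'M[{poly F}]_(m, p)) :
  (forall i j, ppoly (fun Q => A Q i j)) ->
  forall x y, polyfun (fun Q => pmx dm dp (A Q) x y).
Proof.
move=> pA x y; apply: (@polyfun_ext (fun Q => ('X^(iexp x) * A Q (ivar x) (ivar y))`_(iexp y))).
  by move=> Q; rewrite mxE.
by apply: ppoly_mul; [exact: ppoly_const | exact: pA].
Qed.

(** Lower semicontinuity of the rank in algebraic form. A compressed minor that is the identity at
    [Q0] certifies the rank wherever its determinant is nonzero; openness and density both use this
    function. *)
Lemma rank_certificate m p (A : T -> 'M[F]_(m, p)) Q0 :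
  (forall i j, polyfun (fun Q => A Q i j)) ->
  exists f, [/\ polyfun f, f Q0 != 0
    & forall Q, f Q != 0 -> (\rank (A Q0) <= \rank (A Q))%N].
Proof.
move=> pA.
have [L [R eLR]] := rank_witness (A Q0).
exists (fun Q => \det (L *m A Q *m R)); split.
- apply: polyfun_det => i j.
  apply: (@polyfun_ext (fun Q => \sum_l (\sum_l' L i l' * A Q l' l) * R l j)).
    by move=> Q; rewrite mxE; apply: eq_bigr => l _; rewrite mxE.
  apply: polyfun_sum => l; apply: polyfun_mul; last exact: polyfun_const.
  apply: polyfun_sum => l'; apply: polyfun_mul; last exact: pA.
  exact: polyfun_const.
- by rewrite eLR det1 oner_eq0.
move=> Q; rewrite -unitfE -unitmxE -row_free_unit => /eqP <-.
by rewrite (leq_trans (mxrankM_maxl _ _)) // mxrankM_maxr.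
Qed.

Lemma cond_pt_certificate D a c (f : T -> {poly F}) Q0 : ppoly f ->
  cond_pt D a c (f Q0) ->
  exists g, [/\ polyfun g, g Q0 != 0 & forall Q, g Q != 0 -> cond_pt D a c (f Q)].
Proof.
move=> /(ppoly_moeb c D) pf [c1 c2].
have psylv x y : polyfun (fun Q => sylv D (moeb c D (f Q)) x y).
  apply: polyfun_pmx => i j.
  case e : (i == 0); first by apply: ppoly_ext pf => Q; rewrite mxE e.
  by apply: ppoly_ext (ppoly_exp D (ppoly_deriv pf)) => Q; rewrite mxE e.
have [g [pg g0 h]] := rank_certificate Q0 psylv.
exists (fun Q => g Q * (moeb c D (f Q))`_D); split.
- exact: polyfun_mul pg (pf D).
- by rewrite mulf_neq0.
move=> Q; rewrite mulf_eq0 negb_or => /andP[n1 n2]; split; first exact: n2.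
by apply: leq_trans c2 _; rewrite leq_add2r; exact: h.
Qed.

Lemma ppoly_compress r (X : 'M[F]_(n, r)) : ppoly (fun Q => compress X (matpoly_mx Q)).
Proof.
apply: ppoly_det; apply: ppoly_mulmx; last by move=> i j; exact: ppoly_const.
apply: ppoly_mulmx; last exact: ppoly_matpoly.
by move=> i j; exact: ppoly_const.
Qed.

Lemma open_cond_certificate r al s Q0 (X : 'M[F]_(n, r)) c : open_cond al s Q0 X c ->
  exists f, [/\ polyfun f, f Q0 != 0
    & forall Q, f Q != 0 -> open_cond al s Q X c].
Proof.
case=> c1 c2 c3.
have pphi h x y : polyfun (fun Q => phi h Q x y).
  by apply: polyfun_pmx => i j; exact: ppoly_matpoly.
have [f1 [pf1 f10 h1]] := rank_certificate Q0 (pphi al).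
have [f2 [pf2 f20 h2]] := rank_certificate Q0 (pphi al.+1).
have [f3 [pf3 f30 h3]] := cond_pt_certificate (ppoly_compress X) c3.
exists (fun Q => f1 Q * (f2 Q * f3 Q)); split.
- exact: polyfun_mul pf1 (polyfun_mul pf2 pf3).
- by rewrite !mulf_neq0.
move=> Q; rewrite !mulf_eq0 !negb_or => /andP[n1 /andP[n2 n3]].
split; [exact: leq_trans c1 (h1 _ n1) | | exact: h3].
by apply: leq_trans c2 _; rewrite leq_add2r h2.
Qed.

End PolyFun.

(** * Metric estimates *)

Section Metric.
Variable R : realType.
Local Notation C := R[i].
Local Notation nc := (@Normc.normc R).

Lemma nc_ge0 (x : C) : 0 <= nc x.
Proof. by case: x => a b; exact: sqrtr_ge0. Qed.

Lemma nc0 : nc 0 = 0. Proof. exact: Normc.normc0. Qed.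

Lemma nc_gt0 (x : C) : x != 0 -> 0 < nc x.
Proof.
move=> x0; rewrite lt0r nc_ge0 andbT; apply: contraNneq x0 => /Normc.eq0_normc ->.
exact: eqxx.
Qed.

Lemma ncM (x y : C) : nc (x * y) = nc x * nc y. Proof. exact: Normc.normcM. Qed.
Lemma ncN (x : C) : nc (- x) = nc x. Proof. exact: normcN. Qed.
Lemma ncD (x y : C) : nc (x + y) <= nc x + nc y. Proof. exact: le_normcD. Qed.

Lemma nc_real (x : R) : 0 <= x -> nc (real_complex R x) = x.
Proof. by move=> x0; rewrite /nc /= expr0n /= addr0 sqrtr_sqr ger0_norm. Qed.

Section Dist.
Variables (d n : nat).
Implicit Types (P Q : matpoly C d n).

Lemma le_sqrt_sum (I : finType) (f : I -> R) i : f i ^+ 2 <= \sum_j f j ^+ 2.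
Proof. by rewrite (bigD1 i) //= lerDl sumr_ge0 // => j _; exact: sqr_ge0. Qed.

Lemma mpdist_coord P Q k i j : nc (P k i j - Q k i j) <= mpdist P Q.
Proof.
have h1 : nc (P k i j - Q k i j) <= frobenius_norm (P k - Q k).
  rewrite -[X in X <= _]ger0_norm ?nc_ge0 // -sqrtr_sqr ler_wsqrtr //.
  have -> : P k i j - Q k i j = (P k - Q k) i j by rewrite !mxE.
  apply: le_trans (le_sqrt_sum (fun j => nc ((P k - Q k) i j)) j) _.
  rewrite [X in _ <= X](bigD1 i) //= lerDl sumr_ge0 // => i' _; apply: sumr_ge0 => j' _.
  exact: sqr_ge0.
apply: (le_trans h1).
rewrite -[X in X <= _]ger0_norm ?sqrtr_ge0 // -[X in X <= _]sqrtr_sqr ler_wsqrtr //.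
exact: (le_sqrt_sum (fun k => frobenius_norm (P k - Q k)) k).
Qed.

(** The constant only has to exceed the square root of the number of entries [d.+1 * (n * n)]; the
    [.+1] keeps it positive. *)
Lemma mpdist_le P Q e : 0 <= e -> (forall k i j, nc (P k i j - Q k i j) <= e) ->
  mpdist P Q <= (d.+1 * (n * n)).+1%:R * e.
Proof.
move=> e0 H.
have frob k : frobenius_norm (P k - Q k) ^+ 2 <= (n * n)%:R * e ^+ 2.
  rewrite sqr_sqrtr; last by apply: sumr_ge0 => i _; apply: sumr_ge0 => j _; exact: sqr_ge0.
  have -> : (n * n)%:R * e ^+ 2 = \sum_(i < n) \sum_(j < n) e ^+ 2.
    by rewrite !sumr_const !card_ord -mulrnA mulr_natl.
  apply: ler_sum => i _; apply: ler_sum => j _; rewrite !mxE.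
  by rewrite ler_sqr ?nnegrE ?nc_ge0.
have M0 : 0 <= (d.+1 * (n * n)).+1%:R * e by rewrite mulr_ge0.
rewrite -[X in _ <= X]ger0_norm // -sqrtr_sqr ler_wsqrtr //.
apply: (@le_trans _ _ (\sum_(i < d.+1) (n * n)%:R * e ^+ 2)).
  by apply: ler_sum => k _; exact: frob.
rewrite sumr_const card_ord -mulrnAl -mulrnA exprMn.
rewrite ler_wpM2r ?sqr_ge0 // -natrX ler_nat.
by rewrite mulnC; move: (d.+1 * (n * n))%N => m; rewrite expnS expn1; nia.
Qed.

Lemma mpdist_ge0 P Q : 0 <= mpdist P Q. Proof. exact: sqrtr_ge0. Qed.

Lemma polyfun_lipschitz (f : matpoly C d n -> C) P : polyfun f ->
  exists2 K : R, 0 <= K & forall Q, mpdist P Q <= 1 -> nc (f Q - f P) <= K * mpdist P Q.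
Proof.
elim=> [k i j | a | g h _ [K K0 HK] _ [L L0 HL] | g h _ [K K0 HK] _ [L L0 HL]].
- exists 1 => // Q _; rewrite mul1r -ncN opprB; exact: mpdist_coord.
- by exists 0 => // Q _; rewrite subrr nc0 mul0r.
- exists (K + L); first exact: addr_ge0.
  move=> Q le1; rewrite opprD addrACA mulrDl.
  by apply: (le_trans (ncD _ _)); apply: lerD; [exact: HK | exact: HL].
exists (K * (nc (h P) + L) + nc (g P) * L).
  by rewrite addr_ge0 ?mulr_ge0 ?addr_ge0 ?nc_ge0.
move=> Q le1.
have -> : g Q * h Q - g P * h P = (g Q - g P) * h Q + g P * (h Q - h P) by ring.
have hb : nc (h Q) <= nc (h P) + L.
  have -> : h Q = h P + (h Q - h P) by rewrite addrC subrK.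
  apply: (le_trans (ncD _ _)); rewrite lerD2l; apply: (le_trans (HL Q le1)).
  by rewrite -[X in _ <= X]mulr1 ler_wpM2l.
apply: (le_trans (ncD _ _)); rewrite !ncM mulrDl; apply: lerD.
  rewrite [K * _ * _]mulrAC; apply: ler_pM; rewrite ?nc_ge0 //; exact: HK.
by rewrite -mulrA ler_wpM2l ?nc_ge0 // HL.
Qed.

Lemma polyfun_open (f : matpoly C d n -> C) P : polyfun f -> f P != 0 ->
  exists2 e : R, 0 < e & forall Q, mpdist P Q < e -> f Q != 0.
Proof.
move=> pf fP; have [K K0 HK] := polyfun_lipschitz P pf.
have a0 := nc_gt0 fP; have K1 : 0 < K + 1 by rewrite ltr_wpDl.
exists (Num.min 1 (nc (f P) / (K + 1))); first by rewrite lt_min ltr01 divr_gt0.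
move=> Q; rewrite lt_min => /andP[l1 l2]; apply/eqP => fQ.
have := HK Q (ltW l1); rewrite fQ sub0r ncN; apply/negP; rewrite -ltNge.
move: l2; rewrite ltr_pdivlMr // mulrDr mulr1 mulrC.
by have := mpdist_ge0 P Q; lra.
Qed.

End Dist.

Lemma poly_bounded (p : {poly C}) :
  exists2 K : R, 0 <= K & forall t, nc t <= 1 -> nc p.[t] <= K.
Proof.
elim/poly_ind: p => [|p c [K K0 HK]].
  by exists 0 => // t _; rewrite horner0 nc0.
exists (K + nc c); first by rewrite addr_ge0 ?nc_ge0.
move=> t t1; rewrite hornerMXaddC; apply: (le_trans (ncD _ _)); rewrite lerD2r ncM.
by rewrite -[X in _ <= X]mulr1; apply: ler_pM; rewrite ?nc_ge0 ?HK.
Qed.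

Lemma poly_small (p : {poly C}) :
  exists2 K : R, 0 <= K & forall t, nc t <= 1 -> nc (p.[0] - p.[t]) <= K * nc t.
Proof.
elim/poly_ind: p => [|p c _].
  by exists 0 => // t _; rewrite !horner0 subrr nc0 mul0r.
have [K K0 HK] := poly_bounded p; exists K => // t t1.
rewrite !hornerMXaddC mulr0 add0r opprD addrCA subrr addr0 ncN ncM.
by rewrite ler_wpM2r ?nc_ge0 ?HK.
Qed.

Lemma small_nonroot (g : {poly C}) (e : R) : g != 0 -> 0 < e ->
  exists2 t : C, nc t < e & g.[t] != 0.
Proof.
move=> g0 e0; apply: contrapT => no.
pose t (k : nat) : C := real_complex R (e / k.+2%:R).
have tpos k : 0 <= e / k.+2%:R by rewrite divr_ge0 // ltW.
pose rs := [seq t k | k <- iota 0 (size g)].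
have rts : all (root g) rs.
  apply/allP => _ /mapP[k _ ->]; apply: contraT => nr; case: no; exists (t k) => //.
  rewrite /t nc_real // ltr_pdivrMr ?ltr0n // ltr_pMr // ltr1n //.
have urs : uniq rs.
  rewrite map_inj_uniq ?iota_uniq // => x y [] /mulfI.
  rewrite gt_eqF // => /(_ isT)/invr_inj/eqP; rewrite eqr_nat => /eqP[].
  by [].
by have := max_poly_roots g0 rts urs; rewrite size_map size_iota ltnn.
Qed.

Section Curves.
Variables (d n : nat).

Definition curve (p : 'I_d.+1 -> 'M[{poly C}]_n) (t : C) : matpoly C d n :=
  [ffun k => map_mx (horner_eval t) (p k)].

Lemma curveE p t k i j : curve p t k i j = (p k i j).[t].
Proof. by rewrite ffunE mxE. Qed.

Lemma polyfun_curve (f : matpoly C d n -> C) p : polyfun f ->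
  exists g : {poly C}, forall t, f (curve p t) = g.[t].
Proof.
elim=> [k i j | a | g h _ [a ea] _ [b eb] | g h _ [a ea] _ [b eb]].
- by exists (p k i j) => t; rewrite curveE.
- by exists a%:P => t; rewrite hornerC.
- by exists (a + b) => t; rewrite hornerD ea eb.
by exists (a * b) => t; rewrite hornerM ea eb.
Qed.

Lemma curve_near p (e : R) : 0 < e ->
  exists2 h : R, 0 < h & forall t, nc t < h -> mpdist (curve p 0) (curve p t) < e.
Proof.
move=> e0.
have [K KP] : exists K : R, 0 <= K /\ forall k i j t, nc t <= 1 ->
    nc ((p k i j).[0] - (p k i j).[t]) <= K * nc t.
  have H (x : 'I_d.+1 * 'I_n * 'I_n) : exists K : R, 0 <= K /\ forall t, nc t <= 1 ->
    nc ((p x.1.1 x.1.2 x.2).[0] - (p x.1.1 x.1.2 x.2).[t]) <= K * nc t.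
    by have [K K0 HK] := poly_small (p x.1.1 x.1.2 x.2); exists K.
  have [f fP] := fin_all_exists H.
  exists (\sum_x f x); split; first by apply: sumr_ge0 => x _; case: (fP x).
  move=> k i j t t1; have [_ /(_ t t1)] := fP (k, i, j).
  move/le_trans; apply; rewrite ler_wpM2r ?nc_ge0 // (bigD1 (k, i, j)) //=.
  by rewrite lerDl sumr_ge0 // => x _; case: (fP x).
have [K0 {}KP] := KP; set M : R := (d.+1 * (n * n)).+1%:R.
have M0 : 0 < M by rewrite ltr0n.
have K1 : 0 < M * (K + 1) by rewrite mulr_gt0 // ltr_wpDl.
exists (Num.min 1 (e / (M * (K + 1)))); first by rewrite lt_min ltr01 divr_gt0.
move=> t; rewrite lt_min => /andP[t1 t2].
have [t0 | nz] := eqVneq t 0.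
  apply: (@le_lt_trans _ _ (M * 0)); last by rewrite mulr0.
  by apply: mpdist_le => // k i j; rewrite !curveE t0 subrr nc0.
apply: (@le_lt_trans _ _ (M * (K * nc t))).
  apply: mpdist_le; first by rewrite mulr_ge0 ?nc_ge0.
  by move=> k i j; rewrite !curveE; apply: KP; exact: ltW.
move: t2; rewrite ltr_pdivlMr // mulrC => t2; apply: le_lt_trans t2.
by rewrite -mulrA ler_wpM2l ?(ltW M0) // ler_wpM2r ?nc_ge0 // lerDl ler01.
Qed.

(** Along the curve [f] is a polynomial in [t], nonzero because of [t1], so it has non-roots
    arbitrarily close to 0. *)
Lemma curve_dense (f : matpoly C d n -> C) p t1 (e : R) : polyfun f ->
  f (curve p t1) != 0 -> 0 < e ->
  exists t, f (curve p t) != 0 /\ mpdist (curve p 0) (curve p t) < e.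
Proof.
move=> pf ft1 e0; have [g eg] := polyfun_curve p pf.
have g0 : g != 0 by apply: contraNneq ft1 => g0; rewrite eg g0 horner0.
have [h h0 H] := curve_near p e0.
have [t th gt] := small_nonroot g0 h0.
by exists t; rewrite eg; split=> //; exact: H.
Qed.

End Curves.
End Metric.

(** * Bundles and generic eigenstructures *)

Section Bundles.
Variables (R : realType) (d n r : nat).
Local Notation C := R[i].
Implicit Types (P Q : matpoly C d n).

(** With zero exponents excluded, a total exponent of at most one at each point leaves only single
    entries of exponent 1. *)
Lemma simple_list (T : eqType) (E : seq (T * nat)) (nu : seq T) : uniq nu ->
  (forall e, (\sum_(y <- E | y.1 == e) y.2)%N = (e \in nu)) ->
  (forall e, (e, 0%N) \notin E) ->
  perm_eq [seq y.1 | y <- E] nu /\ E = [seq (x, 1%N) | x <- [seq y.1 | y <- E]].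
Proof.
move=> u sE nz.
have pos y : y \in E -> (0 < y.2)%N.
  by case: y => e [|k] // yE; have := nz e; rewrite yE.
have ub y : y \in E -> (y.2 <= (y.1 \in nu))%N.
  by move=> yE; rewrite -sE (big_rem y yE) /= eqxx leq_addr.
have one y : y \in E -> y.2 = 1%N.
  by move=> yE; have := pos y yE; have := ub y yE; case: (_ \in _); lia.
split; last first.
  rewrite -map_comp -[LHS]map_id; apply/eq_in_map => -[e k] yE /=.
  by rewrite -[k]/((e, k).2) one.
apply/allP => e _ /=; rewrite [X in _ == X]count_uniq_mem // -sE count_map -sum1_count.
rewrite big_seq_cond [X in _ == X]big_seq_cond; apply/eqP/eq_bigr => y /andP[yE _].
by rewrite one.
Qed.

Lemma perm_min_indices Q L L' : perm_eq L L' -> left_minimal_indices (matpoly_mx Q) L ->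
  left_minimal_indices (matpoly_mx Q) L'.
Proof.
by move=> p [k [N [mN pL]]]; exists k, N; split=> //; apply: perm_trans pL; rewrite perm_sym.
Qed.

Lemma eld_pos Q E e : elementary_divisors Q E -> (e, 0%N) \notin E.
Proof.
move=> [s [t [_ _ cE]]]; apply/negP => /count_memPn; rewrite cE; apply.
by case: e => [mu|]; rewrite (eq_count (a2 := pred0)) ?count_pred0.
Qed.

(** Renaming eigenvalues preserves only their number and exponents, so every bundle of a generic [K]
    is a class [generic_at]. The list [E] in [sym_bundle] may be any list valid for [K]; total
    multiplicities identify it with the given one up to order. *)
Lemma bundle_generic a (K : matpoly C d n) Q : (r <= n)%N -> is_generic_sym r a K ->
  sym_bundle K Q <-> generic_at r (a %/ (n - r)) (a %% (n - r)) Q.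
Proof.
move=> le_rn [sK K0 rK [mu [szm um [eK lK _]]]].
have ea : (a %/ (n - r) * (n - r) + a %% (n - r))%N = a by rewrite -divn_eq.
pose mu' := [seq Some x | x <- mu].
have um' : uniq mu' by rewrite map_inj_uniq // => x y [].
have e0 : [seq (Some x, 1%N) | x <- mu] = [seq (x, 1%N) | x <- mu'] by rewrite -map_comp.
have [N [eps [W [eta [G sd]]]]] := sym_data_exists sK rK.
have mult e : (\sum_(y <- [seq (x, 1%N) | x <- mu'] | y.1 == e) y.2 = (e \in mu'))%N.
  rewrite big_map /= (eq_bigr (fun _ => 1%N)) // sum1_count.
  by rewrite count_uniq_mem.
split=> [[sQ [E [L [M [f [[eE lE _] injf [eQ lQ _]]]]]]] | [sQ rQ lQ [nu [unu sznu eQ]]]].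
  have [f1 i1] := eld_sums sd eK; have [f2 i2] := eld_sums sd eE.
  have sE e : (\sum_(y <- E | y.1 == e) y.2)%N = (e \in mu').
    by rewrite -mult -e0; case: e => [x|]; rewrite ?f2 ?f1 ?i2 ?i1.
  have [pE simE] := simple_list um' sE (fun e => eld_pos e eE).
  have rQ : mprank Q = r.
    have := min_indices_size lQ; rewrite (min_indices_size lE) rK.
    have : (mprank Q <= n)%N by exact: rank_leq_row.
    by move: le_rn; move: (mprank Q); clear; lia.
  split; [exact: sQ | exact: rQ | |].
    by apply: perm_min_indices lQ; apply: (min_indices_unique lE lK).
  pose l := map fst E.
  pose l2 := map f l.
  pose g := fun e : option C * nat => (f e.1, e.2).
  have e1 : map (fun x => (x, 1%N)) l2 = map g E.
    rewrite /l2 /l. move: (simE); move: (map _ E) => l' ->; rewrite -!map_comp.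
    exact: eq_map.
  exists l2.
  split; last by rewrite e1; exact: eQ.
  - by rewrite map_inj_in_uniq // (perm_uniq pE).
  - by rewrite size_map (perm_size pE) size_map szm ea.
split; first exact: sQ.
(* The renaming sends the [i]-th eigenvalue of [K] to the [i]-th point of [nu]. *)
exists [seq (Some x, 1%N) | x <- mu], (generic_indices n r a),
  (generic_indices n r a), (fun e => nth None nu (index e mu')).
have sz : size mu' = size nu by rewrite size_map szm sznu ea.
have emap : [seq nth None nu (index e mu') | e <- mu'] = nu.
  apply: (@eq_from_nth _ None); first by rewrite size_map.
  move=> i; rewrite size_map => lt; rewrite (nth_map None) // index_uniq //.
split.
- split; [exact: eK | exact: lK |].
  by rewrite /right_minimal_indices matpoly_mx_tr.
- rewrite -map_comp /= => x y; rewrite -[map _ _]/mu' => xm ym.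
  move/eqP; rewrite nth_uniq ?unu // -?sz ?index_mem // => /eqP.
  exact: index_inj.
have -> : [seq (nth None nu (index e.1 mu'), e.2) | e <- [seq (Some x, 1%N) | x <- mu]] =
    [seq (x, 1%N) | x <- nu] by rewrite e0 -[in RHS]emap -!map_comp.
split; [exact: eQ | exact: lQ |].
by rewrite /right_minimal_indices matpoly_mx_tr.
Qed.

Lemma generic_open al s P : (r <= n)%N -> (s <= n - r)%N ->
  (2 * (al * (n - r) + s) <= r * d)%N -> generic_at r al s P ->
  exists2 e : R, 0 < e & forall Q, POLs_rank r Q -> mpdist P Q < e -> generic_at r al s Q.
Proof.
move=> le_rn le_s le_a gP.
have [X [c oc]] := open_cond_of_generic le_rn le_s le_a gP.
have [f [pf f0 H]] := open_cond_certificate oc.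
have [e e0 He] := polyfun_open pf f0.
exists e; first exact: e0.
move=> Q rQ dQ; apply: (generic_of_open_cond le_rn le_s rQ (X := X) (c := c)).
by apply: H; exact: He.
Qed.

End Bundles.

(** * Explicit degree patterns *)

Section Zigzag.
Variable F : fieldType.

Definition first_col n : 'cV[{poly F}]_n := \col_i (val i == 0%N)%:R.
Definition first_row n : 'rV[{poly F}]_n := \row_i (val i == 0%N)%:R.

Lemma first_colS n : first_col (1 + n) = col_mx 1%:M 0.
Proof.
apply/colP => i; rewrite !mxE /=; case: (splitP i) => j ->; rewrite !mxE ?ord1 //.
Qed.

Lemma first_rowS n : first_row (1 + n) = row_mx 1%:M 0.
Proof.
apply/rowP => i; rewrite !mxE /=; case: (splitP i) => j ->; rewrite !mxE ?ord1 //.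
Qed.

(* The last two clauses only serve the induction, which glues a row or a column to the pair. *)
Definition zigzag_pair n q r (eps eta : nat -> nat) (N : 'M[{poly F}]_(q, n))
    (W : 'M[{poly F}]_(n, r)) : Prop :=
  [/\ forall i j, (size (W i j) <= (eta j).+1)%N, pfree W^T,
      forall v : 'rV_n, v *m W = 0 -> exists u : 'rV_q, v = u *m N /\
        forall h, (forall j, (size (v 0%R j) <= h)%N) ->
          forall i, (size (u 0%R i) <= h - eps i)%N,
      N *m first_col n = 'X^(eps 0%N) *: first_col q & first_row n *m W = first_row r].

Lemma size_mulXn_le (p : {poly F}) e h : (size (p * 'X^e)%R <= h)%N -> (size p <= h - e)%N.
Proof.
have [-> | p0] := eqVneq p 0; first by rewrite size_poly0.
by rewrite size_mulXn // => le; rewrite leq_subRL // (leq_trans _ le) // leq_addr.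
Qed.

(** For a null row [(a, u *m N)] the new column forces [a = X^(eps 0) * u_0], so the size of [a]
    supplies the sharper bound on [u_0] that the larger index [eps 0] demands. *)
Lemma zigzag_col n q r (eps eta : nat -> nat) (N : 'M[{poly F}]_(q, n)) (W : 'M_(n, r)) :
  (eta 0 <= eps 0)%N ->
  zigzag_pair (fun i => if i is 0 then eps 0 - eta 0 else eps i)%N (fun j => eta j.+1) N W ->
  zigzag_pair eps eta (row_mx ('X^(eps 0%N) *: first_col q) N : 'M_(q, 1 + n))
    (block_mx 1%:M 0 (- 'X^(eta 0%N) *: first_col n) W : 'M_(1 + n, 1 + r)).
Proof.
move=> le [sW fW ker eN eW]; split.
- move=> i j; rewrite -[i in X in is_true X](@splitK 1 n i) -[j in X in is_true X](@splitK 1 r j).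
  case: (split i) => i'; case: (split j) => j' /=.
  + by rewrite block_mxEul mxE !ord1 eqxx size_poly1.
  + by rewrite block_mxEur mxE size_poly0.
  + rewrite block_mxEdl !mxE !ord1 /=; case: (_ == _); last by rewrite mulr0 size_poly0.
    by rewrite mulr1 size_polyN size_polyXn.
  by rewrite block_mxEdr; exact: sW.
- move=> u; rewrite -[u]hsubmxK tr_block_mx mul_row_block trmx1 trmx0.
  rewrite !mulmx1 mulmx0 addr0 => /eqP; rewrite row_mx_eq0 => /andP[/eqP u1].
  rewrite u1 mul0mx add0r => /eqP /fW ->; exact: row_mx0.
- move=> v; rewrite -[v]hsubmxK; set a := lsubmx v; set v' := rsubmx v.
  rewrite mul_row_block mulmx1 mulmx0 add0r => /eqP; rewrite row_mx_eq0.
  case/andP => /eqP ea /eqP /ker[u [eu su]].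
  have ea' : a = 'X^(eps 0%N) *: (u *m first_col q).
    move: ea; rewrite scaleNr mulmxN -scalemxAr eu -mulmxA eN -scalemxAr scalerA => /eqP.
    by rewrite subr_eq0 => /eqP ->; rewrite -exprD subnKC.
  exists u; split; first by rewrite mul_mx_row -scalemxAr -ea' -eu.
  move=> h sv i.
  have sa : (size (a 0%R 0%R) <= h)%N.
    by have := sv (lshift n 0); rewrite row_mxEl.
  have sv' j : (size (v' 0%R j) <= h)%N.
    by have := sv (rshift 1 j); rewrite row_mxEr.
  have := su h sv' i; case: i => -[|i] lti //= _.
  apply: size_mulXn_le; apply: leq_trans sa; rewrite ea' !mxE mulrC.
  rewrite (bigD1 (Ordinal lti)) //= big1 ?addr0 => [|l ne]; last first.
    rewrite mxE; case: eqP => [e|]; last by rewrite mulr0.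
    by case/eqP: ne; apply/val_inj.
  by rewrite mxE eqxx mulr1.
- by rewrite first_colS mul_row_col mulmx1 mulmx0 addr0.
by rewrite !first_rowS mul_row_block !mul1mx !mul0mx !addr0.
Qed.

Lemma first_row_col n : (0 < n)%N -> first_row n *m first_col n = 1%:M.
Proof.
move=> n0; apply/matrixP => i j; rewrite !ord1 !mxE (bigD1 (Ordinal n0)) //= !mxE /= mulr1.
rewrite big1 ?addr0 // => l ne; rewrite !mxE; case: eqP => [e|]; last by rewrite mulr0.
by case/eqP: ne; apply/val_inj.
Qed.

(** Column 0 of a null row relation gives [a = X^(eps 0) * x]. Adding [x] times the first unit row
    to the remaining part cancels column 0, since the first row of [W] is the unit row, and yields a
    null row of the smaller [W]. *)
Lemma zigzag_row n q r (eps eta : nat -> nat) (N : 'M[{poly F}]_(q, n)) (W : 'M_(n, r)) :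
  (0 < r)%N -> (eps 0 <= eta 0)%N ->
  zigzag_pair (fun i => eps i.+1) (fun j => if j is 0 then eta 0 - eps 0 else eta j)%N N W ->
  zigzag_pair eps eta (block_mx ('X^(eps 0%N))%:M (- first_row n) 0 N : 'M_(1 + q, 1 + n))
    (col_mx (first_row r)
      (W *m diag_mx (\row_j (if val j == 0%N then 'X^(eps 0%N) else 1))) : 'M_(1 + n, r)).
Proof.
set D := diag_mx _; move=> r0 le [sW fW ker eN eW].
have DX (u : 'rV_r) j : (u *m D) 0 j = u 0 j * (if val j == 0%N then 'X^(eps 0%N) else 1).
  by rewrite mul_mx_diag !mxE.
split.
- move=> i j; rewrite -[i in X in is_true X](@splitK 1 n i).
  case: (split i) => i' /=.
    by rewrite col_mxEu mxE; case: eqP => _; rewrite ?size_poly1 ?size_poly0.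
  rewrite col_mxEd mul_mx_diag !mxE; have := sW i' j; case: j => -[|j] ltj /= sj.
    by apply: (size_mul_bound sj (leqnn _)); rewrite size_polyXn; lia.
  by rewrite mulr1.
- move=> u; rewrite tr_col_mx mul_mx_row => /eqP; rewrite row_mx_eq0 => /andP[_].
  rewrite trmx_mul tr_diag_mx mulmxA => /eqP /fW /rowP e.
  apply/rowP => j; have := e j; rewrite DX [X in _ = X]mxE => /eqP; rewrite mulf_eq0 [X in _ -> _ = X]mxE.
  case/orP => [/eqP //|]; case: (val j == 0%N); last by rewrite oner_eq0.
  by rewrite expf_eq0 polyX_eq0 andbF.
- move=> v; rewrite -[v]hsubmxK; set a := lsubmx v; set v' := rsubmx v.
  rewrite mul_row_col mulmxA.
  have [y ey0] : exists y, y = v' *m W by exists (v' *m W).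
  rewrite -ey0 => ey.
  have DC : D *m first_col r = 'X^(eps 0%N) *: first_col r.
    apply/colP => j; rewrite mul_diag_mx !mxE.
    by case: eqP => _; rewrite ?mulr1 ?mulr0.
  pose x := - (y *m first_col r).
  have ea : a = 'X^(eps 0%N) *: x.
    have := congr1 (mulmxr (first_col r)) ey.
    rewrite /= mulmxDl mul0mx -!mulmxA first_row_col // mulmx1 DC -scalemxAr.
    by rewrite /x scalerN => /eqP; rewrite addr_eq0 => /eqP.
  pose v2 := v' + x *m first_row n.
  have /ker[u [eu su]] : v2 *m W = 0.
    rewrite mulmxDl -mulmxA eW -ey0; apply/rowP => j; rewrite !mxE big_ord1 !mxE /=.
    have [j0 | j0] := eqVneq (val j) 0%N.
      rewrite mulr1 (bigD1 j) //= !mxE j0 eqxx mulr1 big1 ?addr0 ?subrr // => l ne.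
      rewrite !mxE; case: eqP => [e|]; last by rewrite mulr0.
      by case/eqP: ne; apply/val_inj; rewrite e j0.
    rewrite mulr0 addr0; have := congr1 (fun z : 'rV_r => z 0 j) ey.
    by rewrite mxE DX !mxE big_ord1 !mxE (negbTE j0) mulr0 add0r mulr1.
  exists (row_mx x u); split.
    rewrite mul_row_block mulmx0 addr0 mul_mx_scalar -ea mulmxN -eu /v2.
    by rewrite addrC addrK.
  move=> h sv i.
  have sx : (size (x 0%R 0%R) <= h - eps 0)%N.
    apply: size_mulXn_le; have := sv (lshift n 0).
    by rewrite row_mxEl ea mxE mulrC.
  rewrite -[i in X in is_true X](@splitK 1 q i); case: (split i) => i' /=.
    by rewrite row_mxEl ord1.
  rewrite row_mxEr; apply: su => j; rewrite mxE.
  apply: (leq_trans (size_polyD _ _)); rewrite geq_max; apply/andP; split.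
    by have := sv (rshift 1 j); rewrite row_mxEr.
  rewrite mxE big_ord1 [first_row n _ _]mxE.
  case: (val j == 0%N); rewrite ?mulr1 ?mulr0 ?size_poly0 //.
  by rewrite (leq_trans sx) // leq_subr.
- rewrite !first_colS mul_block_col mul0mx !mulmx0 !addr0 mulmx1 scale_col_mx scaler0.
  by rewrite -scalemx1.
by rewrite first_rowS mul_row_col mul1mx mul0mx addr0.
Qed.

(** A subtractive Euclidean scheme on the two degree lists of equal sum: the smaller of the two
    leading degrees is split off as a column of [W] or a row of [N], and the larger one is reduced
    by it. *)
Theorem zigzag_exists n q r (eps eta : nat -> nat) : n = (q + r)%N -> (0 < q)%N ->
  (\sum_(i < q) eps i = \sum_(j < r) eta j)%N ->
  exists (N : 'M_(q, n)) (W : 'M_(n, r)), zigzag_pair eps eta N W.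
Proof.
elim: n q r eps eta => [|n IHn] q r eps eta nE q0 sumE; first by case: q nE q0 {sumE}.
case: r nE sumE => [|r] nE sumE.
  have {}nE : n.+1 = q by rewrite nE addn0.
  subst q; exists 1%:M, 0.
  have e0 i : (i < n.+1)%N -> eps i = 0%N.
    move=> lti; apply/eqP; rewrite -leqn0; move: sumE; rewrite big_ord0 => <-.
    by rewrite (bigD1 (Ordinal lti)) //= leq_addr.
  split.
  - by move=> i [].
  - by move=> u _; apply/rowP => -[].
  - move=> v _; exists v; rewrite mulmx1; split=> // h sv i; rewrite e0 // subn0; exact: sv.
  - by rewrite mul1mx e0 // expr0 scale1r.
  by apply/rowP => -[].
have [le | lt] := leqP (eta 0%N) (eps 0%N).
  have nE' : n = (q + r)%N by move: nE; rewrite addnS => -[].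
  have [|N [W zz]] := IHn q r (fun i => if i is 0 then eps 0 - eta 0 else eps i)%N
    (fun j => eta j.+1) nE' q0.
    case: q q0 sumE {nE nE'} => // q _; rewrite !big_ord_recl => sumE.
    rewrite (eq_bigr (fun i : 'I_q => eps (lift ord0 i))) //= addnBAC // sumE addKn.
    by apply: eq_bigr => j _; rewrite lift0.
  by exists (row_mx ('X^(eps 0%N) *: first_col q) N),
    (block_mx 1%:M 0 (- 'X^(eta 0%N) *: first_col n) W : 'M_(1 + n, 1 + r)); exact: zigzag_col.
case: q nE q0 sumE => // q nE _ sumE.
have q0 : (0 < q)%N.
  case: q sumE {nE} => //; rewrite big_ord1 /= big_ord_recl /= => e.
  by move: lt; rewrite e ltnNge leq_addr.
have nE' : n = (q + r.+1)%N by move: nE => -[].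
have [|N [W zz]] := IHn q r.+1 (fun i => eps i.+1)
    (fun j => if j is 0 then eta 0 - eps 0 else eta j)%N nE' q0.
  move: sumE; rewrite !big_ord_recl /=; move: lt; move: (\sum_(i < q) _)%N (\sum_(i < r) _)%N.
  by move=> x y; move: (eps 0%N) (eta 0%N) => e1 e2; lia.
exists (block_mx ('X^(eps 0%N))%:M (- first_row n) 0 N : 'M_(1 + q, 1 + n)),
  (col_mx (first_row r.+1)
      (W *m diag_mx (\row_j (if val j == 0%N then 'X^(eps 0%N) else 1))) : 'M_(1 + n, r.+1)).
exact: zigzag_row (ltn0Sn _) (ltnW lt) zz.
Qed.

End Zigzag.

(** * Tridiagonal matrices with binomial determinant *)

Section Tridiagonal.
Variable F : fieldType.
Implicit Types (p e : nat -> {poly F}).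

(** The offset [k] keeps trailing blocks in the same form, so the determinant obeys the continuant
    recurrence [tri_detS]. *)
Definition tri p e m k : 'M[{poly F}]_m :=
  \matrix_(i, j) if val i == val j then p (k + i)%N else
    if val j == (val i).+1 then e (k + i)%N else
    if val i == (val j).+1 then e (k + j)%N else 0.

Lemma tri_sym p e m k : (tri p e m k)^T = tri p e m k.
Proof.
apply/matrixP => i j; rewrite !mxE eq_sym; case: eqP => [-> //|_].
case: eqP => [e1|_]; case: eqP => [e2|_] //.
by move: e1 e2; move: (val i) (val j) => x y; lia.
Qed.

Lemma tri_det0 p e k : \det (tri p e 0 k) = 1.
Proof. exact: det_mx00. Qed.

Lemma tri_det1 p e k : \det (tri p e 1 k) = p k.
Proof. by rewrite det_mx11 mxE /= addn0. Qed.

Lemma tri_minor p e m k : row' 0 (col' 0 (tri p e m.+1 k)) = tri p e m k.+1.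
Proof.
apply/matrixP => i j; rewrite !mxE /= /bump /= !add1n eqSS.
by rewrite !eqSS !addSnnS.
Qed.

Lemma tri_detS p e m k :
  \det (tri p e m.+2 k) = p k * \det (tri p e m.+1 k.+1) - e k ^+ 2 * \det (tri p e m k.+2).
Proof.
rewrite (expand_det_col _ 0) big_ord_recl [X in _ + X]big_ord_recl big1 => [|i _]; last first.
  by rewrite mxE /= mul0r.
rewrite addr0 !mxE /= addn0; congr (_ + _).
  rewrite /cofactor expr0 mul1r; congr (_ * \det _).
  by rewrite -tri_minor; apply/matrixP => i j; rewrite !mxE.
rewrite /cofactor /= addn0 expr1 mulN1r mulrN expr2 -mulrA; congr (- (_ * _)).
rewrite (expand_det_row _ 0) big_ord_recl big1 => [|j _]; last by rewrite !mxE /= mul0r.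
rewrite addr0 !mxE /= addn0; congr (_ * _).
rewrite /cofactor /= expr0 mul1r; congr (\det _).
apply/matrixP => i j; rewrite !mxE /= /bump /= !add1n !eqSS.
by rewrite !addSnnS.
Qed.

Lemma tri_eq p p' e m k : (forall i, (k <= i < k + m)%N -> p i = p' i) ->
  tri p e m k = tri p' e m k.
Proof.
by move=> h; apply/matrixP => i j; rewrite !mxE h // leq_addr ltn_add2l ltn_ord.
Qed.

Variables (r d kk : nat) (eta : nat -> nat).

(* Below [r - 1], even edges are 1 and odd edges are monomials of maximal degree (absent among
   the first [kk] pairs), so that the determinant is a binomial. *)
Definition path_edge (i : nat) : {poly F} :=
  if ~~ odd i then 1 else if (i < kk.*2)%N then 0 else
  'X^(d - eta i - (if i.+1 == r then eta i else eta i.+1)).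

Definition path_end (i : nat) : {poly F} := if i.+1 == r then path_edge i else 0.

(** The loop at [kk.*2] selects the odd edges instead of the even ones. Its coefficient 2 prevents
    the two terms of the determinant from cancelling when the monomial is constant. *)
Definition path_loop (i : nat) : {poly F} :=
  (if i == kk.*2 then 2%:R *: 'X^(d - eta i - eta i) else 0) + path_end i.

Hypothesis edge_le : forall i, (kk.*2 <= i)%N -> odd i -> (i.+1 < r)%N -> (eta i + eta i.+1 <= d)%N.
Hypothesis end_le : forall i, (kk.*2 <= i)%N -> odd i -> i.+1 = r -> (eta i + eta i <= d)%N.
Hypothesis loop_le : (kk.*2 < r)%N -> (eta kk.*2 + eta kk.*2 <= d)%N.

Lemma tail_even m k : (m + k = r)%N -> ~~ odd k ->
  exists2 a : F, a ^+ 2 = 1 & \det (tri path_end path_edge m k) = a%:P.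
Proof.
elim/ltn_ind: m k => -[|[|m]] IHm k mk ek.
- by exists 1; rewrite ?expr1n ?tri_det0.
- exists 1; rewrite ?expr1n ?tri_det1 // /path_end /path_edge ek.
  by rewrite -mk add1n eqxx.
have [||a a2 e] := IHm m (leqW (leqnn _)) k.+2.
- by move: mk; rewrite !addSn !addnS.
- by rewrite /= negbK.
exists (- a); first by rewrite sqrrN.
have kr : (k.+1 == r) = false by apply/eqP; lia.
by rewrite tri_detS e {1}/path_end kr mul0r add0r /path_edge ek expr1n mul1r polyCN.
Qed.

Lemma tail_odd m k : (m + k = r)%N -> odd k -> (kk.*2 <= k)%N ->
  exists a : F, exists2 M, a ^+ 2 = 1 &
    \det (tri path_end path_edge m k) = a *: 'X^M /\
    (M + 2 * \sum_(i < m) eta (k + i) = m * d)%N.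
Proof.
elim/ltn_ind: m k => -[|[|m]] IHm k mk ok le_k.
- by exists 1, 0%N; rewrite ?expr1n ?tri_det0 ?expr0 ?scale1r ?big_ord0.
- have le2 := end_le le_k ok mk.
  exists 1, (d - eta k - eta k)%N; rewrite ?expr1n ?tri_det1 // /path_end /path_edge ok.
  rewrite ltnNge le_k -mk add1n eqxx scale1r; split=> //.
  by rewrite big_ord1 addn0; lia.
have [|||a [M a2 [e eM]]] := IHm m (leqW (leqnn _)) k.+2.
- by move: mk; rewrite !addSn !addnS.
- by rewrite /= negbK.
- by rewrite (leq_trans le_k) // leqW // leqnSn.
have lt_kr : (k.+1 < r)%N by lia.
have le2 := edge_le le_k ok lt_kr.
exists (- a), ((d - eta k - eta k.+1) * 2 + M)%N; first by rewrite sqrrN.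
rewrite tri_detS e; split.
  have kr : (k.+1 == r) = false by apply/eqP; lia.
  rewrite {1}/path_end kr mul0r add0r /path_edge ok ltnNge le_k kr /=.
  by rewrite -exprM -scalerAr -exprD scaleNr.
rewrite !big_ord_recl /= addn0 (eq_bigr (fun i : 'I_m => eta (k.+2 + i)%N)); last first.
  by move=> i _; congr eta; rewrite /bump /=; lia.
move: eM; rewrite /bump /= addn1; move: (\sum_(i < m) _)%N => x; rewrite !mulSn; lia.
Qed.

(** The determinant is affine in the loop at [kk.*2]. Without the loop only the even edges
    contribute, up to a loop at the end, and give a constant; with it the odd edges give the
    monomial of full degree. *)
Lemma path_det_mid : (kk.*2 < r)%N ->
  exists a b : F, exists2 M, a ^+ 2 = 1 /\ b ^+ 2 = 1 &
    \det (tri path_loop path_edge (r - kk.*2) kk.*2) = a%:P + (2%:R * b) *: 'X^M /\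
    (M + 2 * \sum_(i < r - kk.*2) eta (kk.*2 + i) = (r - kk.*2) * d)%N.
Proof.
move=> lt; have le2 := loop_le lt.
have [m em] : exists m, (r - kk.*2 = m.+1)%N by exists (r - kk.*2).-1; lia.
have e0 := subnK (ltnW lt); rewrite em in e0 *.
have [a a2 ea] := tail_even e0 (negbT (odd_double kk)).
have [|||b [M b2 [eb eM]]] := @tail_odd m kk.*2.+1.
- by rewrite addnS -addSn.
- by rewrite /= odd_double.
- exact: leqnSn.
have tail : tri path_loop path_edge m kk.*2.+1 = tri path_end path_edge m kk.*2.+1.
  apply: tri_eq => i /andP[lt_i _]; rewrite /path_loop gtn_eqF ?add0r //.
exists a, b, (d - eta kk.*2 - eta kk.*2 + M)%N => //; split; last first.
  rewrite big_ord_recl /= addn0 (eq_bigr (fun i : 'I_m => eta (kk.*2.+1 + i)%N)); last first.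
    by move=> i _; congr eta; rewrite /bump /=; lia.
  by move: eM; move: (\sum_(i < m) _)%N => x; rewrite mulSn; lia.
have step : \det (tri path_loop path_edge m.+1 kk.*2) =
   2%:R *: 'X^(d - eta kk.*2 - eta kk.*2) * \det (tri path_end path_edge m kk.*2.+1) +
   \det (tri path_end path_edge m.+1 kk.*2).
  case: m {em eM eb e0 ea} tail => [|m] tail.
    by rewrite !tri_det1 tri_det0 mulr1 /path_loop eqxx.
  rewrite !tri_detS tail {1}/path_loop eqxx mulrDl -!addrA; congr (_ + (_ - _ * \det _)).
  apply: tri_eq => i /andP[lt_i _]; rewrite /path_loop gtn_eqF ?add0r //.
  exact: ltnW.
rewrite step eb ea addrC -scalerAl -scalerAr scalerA -exprD; congr (_ + _ *: _).
Qed.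

(** Before [kk.*2] there are no loops, so each even edge splits off a factor [-1]. *)
Lemma path_det_head m k : (m + k = r)%N -> (k <= kk.*2)%N -> ~~ odd k -> (kk.*2 <= r)%N ->
  exists2 a : F, a ^+ 2 = 1 &
    \det (tri path_loop path_edge m k) =
    a *: \det (tri path_loop path_edge (r - kk.*2) kk.*2).
Proof.
elim/ltn_ind: m k => m IHm k mk le_k ek le_r.
have [k2 | lt] : k = kk.*2 \/ (k < kk.*2)%N by lia.
  exists 1; rewrite ?expr1n // scale1r k2; congr (\det (tri _ _ _ _)).
  by rewrite -mk k2 addnK.
have lt2 : (k.+1 < kk.*2)%N.
  rewrite ltn_neqAle lt andbT; apply: contraNneq ek => e.
  by have := odd_double kk; rewrite -e /= => /negbFE.
have [m' em] : exists m', m = m'.+2 by exists m.-2; lia.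
subst m; have lt' : (m' < m'.+2)%N by [].
have [||||a a2 ea] := IHm m' lt' k.+2.
- by move: mk; rewrite !addSn !addnS.
- exact: lt2.
- by rewrite /= negbK.
- exact: le_r.
exists (- a); first by rewrite sqrrN.
have kr : (k.+1 == r) = false by apply/eqP; lia.
rewrite tri_detS ea {1}/path_loop ltn_eqF // /path_end kr addr0 mul0r add0r.
by rewrite {1}/path_edge ek expr1n mul1r scaleNr.
Qed.

End Tridiagonal.

(** * Degree patterns and hyperbolic splitting *)

Section Patterns.
Variables (F : numClosedFieldType) (d n r : nat).
Implicit Types (W : 'M[{poly F}]_(n, r)) (G : 'M[{poly F}]_r) (eta : 'I_r -> nat).

Definition col_pattern eta W := forall i j, (size (W i j) <= (eta j).+1)%N.
Definition sym_pattern eta G :=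
  G^T = G /\ forall i j, (size (G i j) <= d.+1 - eta i - eta j)%N.

Lemma pattern_perm eta W G (s : 'S_r) : col_pattern eta W -> sym_pattern eta G ->
  let W' := col_perm s W in let G' := \matrix_(i, j) G (s i) (s j) in
  [/\ col_pattern (eta \o s) W', sym_pattern (eta \o s) G'
    & W' *m G' *m W'^T = W *m G *m W^T].
Proof.
move=> sW [symG sG] W' G'; split.
- by move=> i j; rewrite mxE; exact: sW.
- split; last by move=> i j; rewrite mxE; exact: sG.
  by apply/matrixP => i j; rewrite !mxE -[in LHS]symG mxE.
apply/matrixP => i j; rewrite !mxE [RHS](reindex_perm s) /=; apply: eq_bigr => l _.
rewrite !mxE; congr (_ * _); rewrite [RHS](reindex_perm s) /=.
by apply: eq_bigr => m _; rewrite !mxE.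
Qed.

Lemma sort_perm eta : exists s : 'S_r, forall i j : 'I_r, (i <= j)%N ->
  (eta (s i) <= eta (s j))%N.
Proof.
pose t := sort (relpre eta leq) (enum 'I_r).
have st : size t = r by rewrite size_sort -cardE card_ord.
have ut : uniq t by rewrite sort_uniq enum_uniq.
pose f (i : 'I_r) := nth i t i.
have fi : injective f.
  move=> i j; rewrite /f (set_nth_default i) ?st // => /eqP.
  by rewrite nth_uniq ?st // => /eqP e; apply/val_inj.
exists (perm fi) => i j le_ij; rewrite !permE /f (set_nth_default i j) ?st //.
have so : sorted (relpre eta leq) t.
  by apply: sort_sorted => x y; exact: leq_total.
apply: (@sorted_leq_nth _ (relpre eta leq) _ _ i t so) => //.
- by move=> x y z /=; exact: leq_trans.
- by move=> x /=.
- by rewrite inE st.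
by rewrite inE st.
Qed.

Definition nondecr eta := forall i j : 'I_r, (i <= j)%N -> (eta i <= eta j)%N.

(** Pigeonhole on a permutation with nonzero product. If the sum exceeded [d] with [rev_ord i <= i],
    the [r - i] indices from [i] on would be mapped injectively below [rev_ord i], where there are
    only [r - i - 1]. *)
Lemma nondecr_feasible eta G i : nondecr eta -> sym_pattern eta G -> \det G != 0 ->
  (eta i + eta (rev_ord i) <= d)%N.
Proof.
move=> mon [_ sG] d0.
have /existsP[s /prodf_neq0 nz] : [exists s : 'S_r, \prod_i G i (s i) != 0].
  rewrite -[X in is_true X]negbK negb_exists; apply/negP => /forallP h.
  move: d0; rewrite /determinant big1 ?eqxx // => s _.
  by have /negbNE/eqP -> := h s; rewrite mulr0.
have le_d j : (eta j + eta (s j) <= d)%N.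
  have := nz j isT; rewrite -size_poly_gt0; have := sG j (s j); move: (size _); lia.
wlog le_i : i / (rev_ord i <= i)%N.
  move=> H; case: (leqP (rev_ord i) i) => [|lt]; first exact: H.
  by have := H (rev_ord i); rewrite rev_ordK addnC; apply; exact: ltnW.
rewrite leqNgt; apply/negP => gt.
pose A := [set j : 'I_r | (i <= j)%N]; pose B := [set j : 'I_r | (j < rev_ord i)%N].
have sub : [set s j | j in A] \subset B.
  apply/fintype.subsetP => _ /imsetP[j jA ->]; rewrite !inE in jA *.
  rewrite ltnNge; apply/negP => le2; have := le_d j.
  by have := mon _ _ jA; have := mon _ _ le2; move: gt; lia.
have := subset_leq_card sub; rewrite card_imset; last exact: perm_inj.
have cB : #|B| = rev_ord i.
  have lt : (rev_ord i <= r)%N by exact: ltnW.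
  have -> : B = [set widen_ord lt k | k in 'I_(rev_ord i)].
    apply/setP => j; rewrite !inE; apply/idP/imsetP => [h | [k _ ->]] /=; last exact: ltn_ord.
    by exists (Ordinal h) => //; apply: ord_inj.
  rewrite card_imset ?card_ord // => x y /(congr1 val) /= e.
  exact: ord_inj.
have cA : (#|A| + i = r)%N.
  have lt : (i <= r)%N by exact: ltnW.
  have <- : #|~: A| = i.
    have -> : ~: A = [set widen_ord lt k | k in 'I_i].
      apply/setP => j; rewrite !inE -ltnNge; apply/idP/imsetP => [h | [k _ ->]] /=; last exact: ltn_ord.
      by exists (Ordinal h) => //; apply: ord_inj.
    rewrite card_imset ?card_ord // => x y /(congr1 val) /= e.
    exact: ord_inj.
  by rewrite cardsC card_ord.
rewrite cB /=; move: cA; have := ltn_ord i; move: #|A| => x; lia.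
Qed.

Definition in_top kk (j : 'I_r) := (r - kk <= j)%N.

Lemma half_twice : (2%:R^-1 + 2%:R^-1 : F) = 1.
Proof. by rewrite [RHS]splitr !mul1r. Qed.

(* The columns [j] with [r - kk <= j] pair off with the columns [rev_ord j];
   they absorb all terms of the product involving those and become a
   hyperbolic block. *)
Lemma hyperbolic_split eta W G kk : col_pattern eta W -> sym_pattern eta G ->
  (kk.*2 <= r)%N ->
  (forall a b : 'I_r, in_top kk a -> (kk <= b)%N -> G a b = 0) ->
  (forall j, (eta j + eta (rev_ord j) <= d)%N) ->
  let eta' := fun j => if in_top kk j then (d - eta (rev_ord j))%N else eta j in
  exists W' G', [/\ col_pattern eta' W', sym_pattern eta' G'
    & W' *m G' *m W'^T = W *m G *m W^T].
Proof.
move=> sW [symG sG] le_r zG feas eta'.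
have symE a b : G a b = G b a by rewrite -[in LHS]symG mxE.
pose T j := in_top kk j; pose S (j : 'I_r) := (j < kk)%N.
have ST j : S j -> ~~ T j by rewrite /S /T /in_top -ltnNge => h; move: le_r h; lia.
have revT j : T j = S (rev_ord j).
  by rewrite /S /T /in_top /=; have := ltn_ord j; move: le_r; move: (val j); lia.
have revS j : S j = T (rev_ord j) by rewrite revT rev_ordK.
(* An entry of [G] between two columns of [S] is produced twice by [M *m G' *m M^T], hence the
   halves. *)
pose c (j : 'I_r) : F := if S j then 2%:R^-1 else 1.
pose M : 'M[{poly F}]_r := \matrix_(l, j) (if T j then c l *: G (rev_ord j) l else (l == j)%:R).
(* Paired columns meet only their partners, in an entry 1; this fits the pattern because their new
   degrees add up to exactly [d]. *)
pose G' : 'M[{poly F}]_r := \matrix_(j, l) (if T j || T l then (l == rev_ord j)%:R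
   else if S j || S l then 0 else G j l).
have key : M *m G' *m M^T = G.
  apply/matrixP => a b.
  have M_S j x : S j -> M x j = (x == j)%:R by move=> Sj; rewrite mxE (negbTE (ST _ Sj)).
  have row_MG l : (M *m G') a l = if T l then M a (rev_ord l) else if S l then M a (rev_ord l)
      else if T a || S a then 0 else G a l.
    rewrite mxE; case Tl: (T l); [|case Sl: (S l)].
    - rewrite (bigD1 (rev_ord l)) //= [G' _ _]mxE Tl orbT rev_ordK eqxx mulr1.
      rewrite big1 ?addr0 // => j ne; rewrite [G' _ _]mxE Tl orbT.
      by rewrite -(inj_eq rev_ord_inj) rev_ordK eq_sym (negbTE ne) mulr0.
    - rewrite (bigD1 (rev_ord l)) //= [G' _ _]mxE -revS Sl rev_ordK eqxx mulr1.
      rewrite big1 ?addr0 // => j ne; rewrite [G' _ _]mxE Tl Sl orbT.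
      case: (T j); last by rewrite mulr0.
      by rewrite -(inj_eq rev_ord_inj) rev_ordK eq_sym (negbTE ne) mulr0.
    have -> : \sum_j M a j * G' j l = \sum_j (if T j || S j then 0 else (a == j)%:R * G j l).
      apply: eq_bigr => j _; rewrite [G' _ _]mxE Tl Sl !orbF.
      case Tj: (T j) => /=.
        have -> : (l == rev_ord j) = false; last by rewrite mulr0.
        by apply/negP => /eqP e; rewrite revT -e Sl in Tj.
      by case Sj: (S j); rewrite ?mulr0 // [M _ _]mxE Tj.
    rewrite (bigD1 a) //= eqxx mul1r big1 ?addr0 // => j ne.
    by rewrite eq_sym (negbTE ne) mul0r if_same.
  rewrite mxE.
  pose X l := (if T a || S a then 0 else G a l) * (if T l || S l then 0 else (b == l)%:R).
  have -> : \sum_l (M *m G') a l * M^T l b =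
     \sum_(l | T l) M a (rev_ord l) * M b l + \sum_(l | S l) M a (rev_ord l) * M b l + \sum_l X l.
    rewrite (big_mkcond (fun l => T l)) (big_mkcond (fun l => S l)) /= -!big_split /=.
    apply: eq_bigr => l _; rewrite row_MG [M^T _ _]mxE /X.
    case Tl: (T l) => /=.
      have -> : S l = false by apply/negP => /ST; rewrite Tl.
      by rewrite mulr0 !addr0.
    case Sl: (S l) => /=; first by rewrite mulr0 addr0 add0r.
    by rewrite !add0r [M b l]mxE Tl.
  have -> : \sum_l X l = if [|| T a, S a, T b | S b] then 0 else G a b.
    rewrite (bigD1 b) //= big1 => [|l ne]; last first.
      by rewrite /X eq_sym (negbTE ne) if_same mulr0.
    rewrite /X eqxx addr0; case: (T a); case: (S a) => /=; rewrite ?mul0r //.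
    by case: (T b); case: (S b); rewrite /= ?mulr0 ?mulr1.
  have -> : \sum_(l | S l) M a (rev_ord l) * M b l = if S b then c a *: G b a else 0.
    case Sb: (S b).
      rewrite (bigD1 b) //= (M_S b b) // eqxx mulr1 big1 => [|l /andP[Sl ne]].
        by rewrite addr0 [M _ _]mxE -revS Sb rev_ordK.
      by rewrite (M_S l b) // eq_sym (negbTE ne) mulr0.
    rewrite big1 // => l Sl; rewrite (M_S l b) //; case: eqP => [e|]; last by rewrite mulr0.
    by rewrite e Sl in Sb.
  have -> : \sum_(l | T l) M a (rev_ord l) * M b l = if S a then c b *: G a b else 0.
    case Sa: (S a).
      have Tra : T (rev_ord a) by rewrite -revS.
      rewrite (bigD1 (rev_ord a)) //= rev_ordK (M_S a a) // eqxx mul1r big1 => [|l /andP[Tl ne]].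
        by rewrite addr0 [M _ _]mxE Tra rev_ordK.
      rewrite (M_S (rev_ord l) a) -?revT // -(inj_eq rev_ord_inj) rev_ordK eq_sym.
      by rewrite (negbTE ne) mul0r.
    rewrite big1 // => l Tl; rewrite (M_S (rev_ord l) a) -?revT //; case: eqP => [e|]; last by rewrite mul0r.
    by rewrite e -revT Tl in Sa.
  rewrite /c; case Sa: (S a); case Sb: (S b) => /=; rewrite ?orbT ?addr0 ?add0r.
  - by rewrite symE -scalerDl half_twice scale1r.
  - by rewrite scale1r.
  - by rewrite scale1r symE.
  rewrite orbF; case Ta: (T a) => /=; first by rewrite zG // leqNgt -/(S b) Sb.
  by case Tb: (T b) => //=; rewrite symE zG // leqNgt -/(S a) Sa.
exists (W *m M), G'; split.
- move=> i j; rewrite mxE; apply: (leq_trans (size_sum _ _ _)); apply/bigmax_leqP => l _.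
  rewrite [M _ _]mxE /eta' -/(T j); case: (T j); last first.
    case: eqP => [->|_]; last by rewrite mulr0 size_poly0.
    by rewrite mulr1; exact: sW.
  rewrite -scalerAr; apply: (leq_trans (size_scale_leq _ _)).
  have [-> | g0] := eqVneq (G (rev_ord j) l) 0; first by rewrite mulr0 size_poly0.
  apply: (size_mul_bound (sW i l) (sG (rev_ord j) l)).
  move: g0; rewrite -size_poly_gt0; have := sG (rev_ord j) l; move: (size _); lia.
- split.
    apply/matrixP => j l; rewrite !mxE orbC; case: (T j || T l).
      by rewrite -(inj_eq rev_ord_inj) rev_ordK eq_sym.
    by rewrite orbC; case: ifP => _ //; exact: symE.
  move=> j l; rewrite mxE; case Tjl: (T j || T l).
    case: eqP => [e|_]; last by rewrite size_poly0.
    have f1 := feas j; have f2 := feas l.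
    rewrite size_poly1 /eta' -/(T j) -/(T l) e [T (rev_ord j)]revT rev_ordK.
    have [Sj | nSj] := boolP (S j).
      by rewrite (negbTE (ST _ Sj)); lia.
    move: Tjl; rewrite e [T (rev_ord j)]revT rev_ordK (negbTE nSj) orbF => ->.
    lia.
  have [Tj Tl] : T j = false /\ T l = false by move/norP: Tjl => [/negbTE -> /negbTE ->].
  rewrite /eta' -/(T j) -/(T l) Tj Tl; case: ifP => _; last exact: sG.
  by rewrite size_poly0.
by rewrite trmx_mul !mulmxA -[in RHS]key !mulmxA.
Qed.

(** In characteristic 0 the derivative vanishes only at 0, which is not a root since [a != 0]. *)
Lemma binomial_roots (a b : F) N : a != 0 -> b != 0 ->
  exists nu : seq F, [/\ uniq nu, size nu = N & all (root (a%:P + b *: 'X^N)) nu] .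
Proof.
move=> a0 b0; case: N => [|N]; first by exists [::].
set p := _ + _.
have sp : size p = N.+2.
  rewrite /p addrC size_polyDl size_scale ?size_polyXn // size_polyC a0 //.
have p0 : p != 0 by rewrite -size_poly_eq0 sp.
have [rs ep] := closed_field_poly_normal p.
have lp : lead_coef p != 0 by rewrite lead_coef_eq0.
have rp z : (z \in rs) = root p z by rewrite ep rootZ // root_prod_XsubC.
exists rs; split; last by apply/allP => z; rewrite rp.
  apply: count_mem_uniq => z; rewrite -(mup_prod_roots _ _ lp) -ep rp.
  have [pz | np] := boolP (root p z); last by rewrite mupNroot.
  apply/eqP; rewrite eqn_leq -XsubC_dvd // dvdp_XsubCl pz andbT leqNgt; apply/negP.
  rewrite mup_geq // => /dvdpP[q eq].
  have : p^`().[z] = 0.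
    rewrite eq expr2 !derivM !(hornerXsubC, hornerM, hornerD) subrr.
    by rewrite !(mulr0, mul0r, addr0).
  rewrite /p derivD derivC add0r derivZ derivXn hornerZ hornerMn hornerXn => /eqP.
  rewrite mulf_eq0 (negbTE b0) /= -mulr_natr mulf_eq0 pnatr_eq0 orbF expf_eq0 => /andP[_ /eqP z0].
  move: pz; rewrite /root /p hornerD hornerC hornerZ hornerXn z0 expr0n mulr0 addr0.
  by rewrite (negbTE a0).
by apply/eqP; rewrite -eqSS -(size_prod_XsubC rs id) -(size_scale _ lp) -ep sp.
Qed.

End Patterns.

(** * Patterns of maximal degree sum *)

Section GoodPattern.
Variables (F : numClosedFieldType) (d n r : nat).
Implicit Types (W : 'M[{poly F}]_(n, r)) (G : 'M[{poly F}]_r) (eta : 'I_r -> nat).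

Definition ext eta (i : nat) : nat := if insub i is Some j then eta j else 0%N.

Lemma ext_ord eta (j : 'I_r) : ext eta j = eta j.
Proof. by rewrite /ext valK. Qed.

(* In the order 0, r - 1, 1, r - 2, ... the path underlying [tri] links each [j] with
   [rev_ord j], the pairs whose degrees add up to at most [d]. *)
Definition path_idx (i : nat) : nat := if odd i then (r.-1 - i./2)%N else i./2.

Lemma path_idx_lt (i : 'I_r) : (path_idx i < r)%N.
Proof. by rewrite /path_idx; have := ltn_ord i; case: ifP => _; move: (val i) => x; lia. Qed.

Lemma path_idx_inj : injective (fun i : 'I_r => Ordinal (path_idx_lt i)).
Proof.
move=> i j /(congr1 val) /=; rewrite /path_idx => e; apply: ord_inj.
have := ltn_ord i; have := ltn_ord j; move: e.
have := odd_double_half i; have := odd_double_half j.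
move: (val i) (val j) => x y.
case: (odd x); case: (odd y); move: (x./2) (y./2) => x2 y2 /=; rewrite -!mul2n; lia.
Qed.

Definition factors_as (P : 'M[{poly F}]_n) eta W G : Prop :=
  [/\ col_pattern eta W, sym_pattern d eta G & P = W *m G *m W^T].

Lemma factor_det P eta W G : pmxrank P = r -> factors_as P eta W G -> \det G != 0.
Proof.
move=> rP [_ _ eP]; rewrite pmxrank_det eqn_leq rank_leq_row -{1}rP eP /pmxrank !ratmxM.
by rewrite (leq_trans (mxrankM_maxl _ _)) // mxrankM_maxr.
Qed.

(** The maximum is over all factorizations, minimal or not; it exists because a nonzero determinant
    bounds twice the degree sum by [r * d]. *)
Lemma pattern_max P eta W G : pmxrank P = r -> factors_as P eta W G ->
  exists eta' W' G', factors_as P eta' W' G' /\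
    forall eta2 W2 G2, factors_as P eta2 W2 G2 -> (\sum_i eta2 i <= \sum_i eta' i)%N.
Proof.
move=> rP fP.
pose S m := exists eta W G, factors_as P eta W G /\ (\sum_i eta i)%N = m.
have exS : exists m, `[< S m >].
  by exists (\sum_i eta i)%N; apply/asboolP; exists eta, W, G.
have ubS m : `[< S m >] -> (m <= r * d)%N.
  move=> /asboolP[eta1 [W1 [G1 [f1 <-]]]]; have d1 := factor_det rP f1.
  by case: f1 => _ [_ sG] _; have [_ /(_ d1)] := det_size_sym sG; lia.
case: (ex_maxnP exS ubS) => m /asboolP[eta1 [W1 [G1 [f1 e1]]]] mmax.
exists eta1, W1, G1; split=> // eta2 W2 G2 f2; rewrite e1; apply: mmax; apply/asboolP.
by exists eta2, W2, G2.
Qed.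

Lemma factors_perm P eta W G (s : 'S_r) : factors_as P eta W G ->
  factors_as P (eta \o s) (col_perm s W) (\matrix_(i, j) G (s i) (s j)).
Proof.
by case=> sW sG eP; have [h1 h2 h3] := pattern_perm s sW sG; split=> //; rewrite h3.
Qed.

Lemma pairs_sum (f : nat -> nat) kk :
  (forall i, (i < kk)%N -> f i.*2 + f i.*2.+1 = d)%N ->
  (\sum_(i < kk.*2) f i = kk * d)%N.
Proof.
elim: kk => [|k IHk] H; first by rewrite big_ord0.
rewrite doubleS !big_ord_recr /= IHk => [|i lt]; last by apply: H; rewrite ltnW.
by have := H k (ltnSn k); rewrite mulSn; lia.
Qed.

(** The critical inequality makes [G] vanish on the block required by [hyperbolic_split]. The
    splitting raises the degree of each of the last [kk] columns to [d] minus that of its partner,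
    so maximality means that equality held already. *)
Lemma max_pairs P eta W G kk : factors_as P eta W G -> pmxrank P = r -> nondecr eta ->
  (forall eta2 W2 G2, factors_as P eta2 W2 G2 -> (\sum_i eta2 i <= \sum_i eta i)%N) ->
  (kk.*2 <= r)%N -> (0 < kk)%N -> (d < ext eta (r - kk) + ext eta kk)%N ->
  forall i : 'I_r, (i < kk)%N -> (eta i + eta (rev_ord i) = d)%N.
Proof.
move=> fP rP mon mx le_r kk0 crit i lt_i.
have dG := factor_det rP fP; have [sW sG eP] := fP.
have feas j := nondecr_feasible j mon sG dG.
have l1 : (r - kk < r)%N by lia.
have l2 : (kk < r)%N by lia.
have zG (a b : 'I_r) : in_top kk a -> (kk <= b)%N -> G a b = 0.
  rewrite /in_top => ta tb; apply/eqP; rewrite -size_poly_eq0 -leqn0.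
  have [_ sGs] := sG; apply: (leq_trans (sGs a b)).
  have h1 := mon (Ordinal l1) a ta; have h2 := mon (Ordinal l2) b tb.
  move: crit; rewrite -[(r - kk)%N]/(val (Ordinal l1)) -[in ext eta kk]/(val (Ordinal l2)).
  by rewrite (ext_ord eta (Ordinal l1)) (ext_ord eta (Ordinal l2)); lia.
have [W' [G' [h1 h2 h3]]] := hyperbolic_split sW sG le_r zG feas.
have := mx _ W' G' (And3 h1 h2 (etrans eP (esym h3))).
move=> le; apply/eqP; rewrite eqn_leq feas leqNgt; apply/negP => lt.
move: le; apply/negP; rewrite -ltnNge.
have ti : in_top kk (rev_ord i) by rewrite /in_top /=; move: lt_i le_r; lia.
rewrite [X in (X < _)%N](bigD1 (rev_ord i)) //= [X in (_ < X)%N](bigD1 (rev_ord i)) //= ti rev_ordK.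
rewrite -addSn leq_add //; first by move: lt; lia.
apply: leq_sum => j _; case: ifP => // _.
by have := feas j; lia.
Qed.

(** [Gb] is unrelated to [P]: it only shows that the pattern admits a determinant with simple roots.
    The density argument then moves from [G] to nearby matrices of the same pattern. *)
Lemma good_pattern P eta0 W0 G0 : pmxrank P = r -> factors_as P eta0 W0 G0 ->
  exists eta W G Gb, [/\ factors_as P eta W G, sym_pattern d eta Gb, \det Gb != 0,
    (2 * \sum_i eta i <= r * d)%N
  & exists nu : seq F, [/\ uniq nu, (r * d - 2 * \sum_i eta i <= size nu)%N
    & all (root (\det Gb)) nu]].
Proof.
move=> rP /(pattern_max rP)[eta1 [W1 [G1 [f1 mx1]]]].
have [s mon] := sort_perm eta1.
pose eta := eta1 \o s.
have f2 : factors_as P eta (col_perm s W1) (\matrix_(i, j) G1 (s i) (s j)) by exact: factors_perm.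
have mx2 eta2 W2 G2 : factors_as P eta2 W2 G2 -> (\sum_i eta2 i <= \sum_i eta i)%N.
  have e : (\sum_i eta1 i = \sum_i eta i)%N by rewrite (reindex_perm s).
  by move/mx1; rewrite e.
have {}mon : nondecr eta := mon.
move: f2 mx2; move: (col_perm _ _) (\matrix_(_, _) _); clearbody eta => W G fP mx.
have dG := factor_det rP fP; have [sW sG eP] := fP.
have feas j := nondecr_feasible j mon sG dG.
pose h := ext eta.
have hE i (lt : (i < r)%N) : h i = eta (Ordinal lt) by rewrite -ext_ord.
have hfeas i : (i < r)%N -> (h i + h (r.-1 - i) <= d)%N.
  move=> lt; have lt' : (r.-1 - i < r)%N by lia.
  rewrite (hE _ lt) (hE _ lt'); have := feas (Ordinal lt).
  suff -> : rev_ord (Ordinal lt) = Ordinal lt' by [].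
  by apply: ord_inj => /=; lia.
(* [kk] counts the outermost pairs forced by the maximality of the degree sum to have
   complementary degrees. *)
pose crit k := (k == 0%N) || ((k.*2 <= r) && (d < h (r - k) + h k))%N.
have ex_crit : exists k, crit k by exists 0%N.
have ub_crit k : crit k -> (k <= r)%N by case/orP => [/eqP -> //|/andP[le _]]; lia.
case: (ex_maxnP ex_crit ub_crit) => kk ck kmax {ex_crit ub_crit}.
have le_kk : (kk.*2 <= r)%N by case/orP: ck => [/eqP -> //|/andP[]].
have nocrit k : (kk < k)%N -> (k.*2 <= r)%N -> (h (r - k) + h k <= d)%N.
  move=> lt le; rewrite leqNgt; apply/negP => gt.
  have := kmax k; rewrite /crit le gt orbT => /(_ isT); lia.
have pairs i : (i < kk)%N -> (h i + h (r.-1 - i) = d)%N.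
  move=> lt; have lt_r : (i < r)%N by lia.
  have lt' : (r.-1 - i < r)%N by lia.
  have [/eqP k0 | /andP[_ cr]] := orP ck; first by rewrite k0 in lt.
  have := max_pairs fP rP mon mx le_kk (leq_ltn_trans (leq0n _) lt) cr (i := Ordinal lt_r) lt.
  rewrite (hE _ lt_r) (hE _ lt').
  suff -> : rev_ord (Ordinal lt_r) = Ordinal lt' by [].
  by apply: ord_inj => /=; lia.
pose etap i := h (path_idx i).
have etap2 i : etap i.*2 = h i by rewrite /etap /path_idx odd_double doubleK.
have etap2S i : etap i.*2.+1 = h (r.-1 - i)%N.
  by rewrite /etap /path_idx /= odd_double /= uphalf_double.
have oddP i : odd i -> exists a, i = a.*2.+1.
  by move=> oi; exists i./2; have := odd_double_half i; rewrite oi add1n.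
have evenP i : ~~ odd i -> exists a, i = a.*2.
  by move=> oi; exists i./2; have := odd_double_half i; rewrite (negbTE oi).
have edge_le i : (kk.*2 <= i)%N -> odd i -> (i.+1 < r)%N -> (etap i + etap i.+1 <= d)%N.
  move=> le_i /oddP[a ea] lt; subst i.
  rewrite etap2S -doubleS etap2.
  have -> : (r.-1 - a = r - a.+1)%N by lia.
  by apply: nocrit; lia.
have end_le i : (kk.*2 <= i)%N -> odd i -> i.+1 = r -> (etap i + etap i <= d)%N.
  move=> le_i /oddP[a ea] lt; subst i; rewrite etap2S.
  have -> : (r.-1 - a = r - a.+1)%N by lia.
  have := nocrit a.+1; have -> : h a.+1 = h (r - a.+1)%N by congr h; lia.
  by apply; lia.
have loop_le : (kk.*2 < r)%N -> (etap kk.*2 + etap kk.*2 <= d)%N.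
  move=> lt; rewrite etap2; have lt1 : (kk < r)%N by lia.
  have lt2 : (r.-1 - kk < r)%N by lia.
  have := hfeas kk lt1; have : (h kk <= h (r.-1 - kk))%N.
    by rewrite (hE _ lt1) (hE _ lt2); apply: mon => /=; lia.
  lia.
have even_le i : ~~ odd i -> (i.+1 < r)%N -> (etap i + etap i.+1 <= d)%N.
  by move=> /evenP[a ->] lt; rewrite etap2 etap2S; apply: hfeas; lia.
have even_end i : ~~ odd i -> i.+1 = r -> (etap i + etap i <= d)%N.
  move=> /evenP[a ->] er; rewrite etap2; have := hfeas a.
  have -> : h (r.-1 - a)%N = h a by congr h; lia.
  by apply; lia.
pose v := perm path_idx_inj.
have etaE (i : 'I_r) : eta (v i) = etap i.
  by rewrite permE /etap -ext_ord.
pose Gb : 'M[{poly F}]_r := tri (path_loop F r d kk etap) (path_edge F r d kk etap) r 0.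
have sumE : (\sum_i (eta \o v) i = \sum_(i < r) etap i)%N by apply: eq_bigr => i _; exact: etaE.
have size_edge i : (i.+1 < r)%N -> (size (path_edge F r d kk etap i) <= d.+1 - etap i - etap i.+1)%N.
  move=> lt; rewrite /path_edge; case oi: (odd i) => /=.
    case: (ltnP i kk.*2) => le; first by rewrite size_poly0.
    rewrite ltn_eqF // size_polyXn; have := edge_le i le oi lt; lia.
  by rewrite size_poly1; have := even_le i (negbT oi) lt; lia.
have size_end i : (size (path_end F r d kk etap i) <= d.+1 - etap i - etap i)%N.
  rewrite /path_end; case: eqP => er; last by rewrite size_poly0.
  rewrite /path_edge er eqxx; case oi: (odd i) => /=.
    case: (leqP r kk.*2) => le; first by rewrite size_poly0.
    have le' : (kk.*2 <= i)%N by rewrite -ltnS er.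
    by rewrite size_polyXn; have := end_le i le' oi er; lia.
  by rewrite size_poly1; have := even_end i (negbT oi) er; lia.
have size_loop i : (i < r)%N -> (size (path_loop F r d kk etap i) <= d.+1 - etap i - etap i)%N.
  move=> lt; rewrite /path_loop; apply: (leq_trans (size_polyD _ _)).
  rewrite geq_max size_end andbT; case: eqP => [e|_]; last by rewrite size_poly0.
  apply: (leq_trans (size_scale_leq _ _)).
  rewrite size_polyXn e; move: lt; rewrite e => lt; have := loop_le lt; lia.
have sGb : sym_pattern d (eta \o v) Gb.
  split; first exact: tri_sym.
  move=> i j; rewrite /= !etaE mxE; case: eqP => [<-|_]; first by rewrite add0n; apply: size_loop; exact: ltn_ord.
  have li := ltn_ord i; have lj := ltn_ord j.
  case: eqP => [ej | _]; first by rewrite add0n (ej : nat_of_ord j = _); apply: size_edge; rewrite -ej.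
  case: eqP => [ei | _]; last by rewrite size_poly0.
  by rewrite add0n subnAC (ei : nat_of_ord i = _); apply: size_edge; rewrite -ei.
have head : (\sum_(i < kk.*2) etap i = kk * d)%N.
  by apply: pairs_sum => i lt; rewrite etap2 etap2S; exact: pairs.
have [t t2 et] := path_det_head F loop_le (addn0 r) (leq0n _) isT le_kk.
have t0 : t != 0 by apply: contra_eq_neq t2 => ->; rewrite expr0n eq_sym oner_eq0.
exists (eta \o v), (col_perm v W), (\matrix_(i, j) G (v i) (v j)), Gb.
have [|lt] := leqP r kk.*2.
  (* All columns are paired with complementary degrees, so the grade of the determinant is 0 and no
     eigenvalue is left. *)
  move=> le; have er : r = kk.*2 by apply/eqP; rewrite eqn_leq le le_kk.
  have eD : \det Gb = t%:P.
    rewrite /Gb et; have : (r - kk.*2 = 0)%N by lia.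
    by move: (r - kk.*2)%N => x ->; rewrite tri_det0 -mul_polyC mulr1.
  have sE : (2 * \sum_i (eta \o v) i = r * d)%N.
    rewrite sumE; have : (\sum_(i < kk.*2) etap i = kk * d)%N := head.
    by rewrite -er => ->; rewrite mulnA mul2n -er.
  split; [exact: factors_perm | exact: sGb | by rewrite eD polyC_eq0 | by rewrite sE |].
  by exists [::]; rewrite sE subnn.
have [a [b [M [a2 b2] [em eM]]]] := path_det_mid F edge_le end_le loop_le lt.
have a0 : a != 0 by apply: contra_eq_neq a2 => ->; rewrite expr0n eq_sym oner_eq0.
have b0 : b != 0 by apply: contra_eq_neq b2 => ->; rewrite expr0n eq_sym oner_eq0.
have eN : (M + 2 * \sum_i (eta \o v) i = r * d)%N.
  have er : (r = kk.*2 + (r - kk.*2))%N by rewrite subnKC // ltnW.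
  have -> : (\sum_i (eta \o v) i = kk * d + \sum_(i < r - kk.*2) etap (kk.*2 + i))%N.
    rewrite sumE -head; transitivity (\sum_(i < kk.*2 + (r - kk.*2)) etap i)%N.
      by rewrite -er.
    by rewrite big_split_ord.
  move: eM; rewrite mulnBl -mul2n; move: (\sum_(i < _) _)%N => x.
  have : (2 * kk * d <= r * d)%N by rewrite leq_mul2r mul2n le_kk orbT.
  move: (r * d)%N => y; nia.
have eD : \det Gb = (t * a)%:P + (t * (2%:R * b)) *: 'X^M.
  by rewrite /Gb et em scalerDr scalerA -mul_polyC -polyCM.
have ta0 : t * a != 0 by rewrite mulf_neq0.
have tb0 : t * (2%:R * b) != 0 by rewrite !mulf_neq0 ?pnatr_eq0.
have [nu [unu sznu rnu]] := binomial_roots M ta0 tb0.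
have eN' : (r * d - 2 * \sum_i (eta \o v) i = M)%N by rewrite -eN addnK.
have dGb : \det Gb != 0.
  rewrite eD; apply/eqP => e; have := congr1 (fun p : {poly F} => p`_0) e.
  rewrite coefD coefC eqxx coefZ coefXn coef0 -mulrA -mulrDr => /eqP.
  rewrite mulf_eq0 (negbTE t0) /=; case: (0%N =P M) => _; rewrite ?mulr1 ?mulr0 ?addr0 ?(negbTE a0) //.
  (* Here the monomial is constant, and [a = - 2 b] would give [1 = 4]. *)
  rewrite addr_eq0 => /eqP ea; move: a2; rewrite ea sqrrN exprMn b2 mulr1 -natrX => /eqP.
  by rewrite pnatr_eq1.
split; [exact: factors_perm | exact: sGb | exact: dGb | by rewrite -eN leq_addl |].
by exists nu; rewrite eN' sznu eD.
Qed.

End GoodPattern.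

(** * Density *)

Section Assembly.
Variables (F : fieldType) (d n : nat).

Definition of_mx (A : 'M[{poly F}]_n) : matpoly F d n :=
  [ffun k : 'I_d.+1 => \matrix_(i, j) (A i j)`_k].

Lemma of_mxK (A : 'M[{poly F}]_n) : (forall i j, (size (A i j) <= d.+1)%N) -> matpoly_mx (of_mx A) = A.
Proof. by move=> sA; apply: matpoly_mx_eq => // k i j; rewrite ffunE mxE. Qed.

Lemma matpoly_mxK Q : of_mx (matpoly_mx Q) = Q.
Proof.
apply/ffunP => k; rewrite ffunE; apply/matrixP => i j.
by rewrite mxE coef_matpoly.
Qed.

Lemma of_mx_sym (A : 'M[{poly F}]_n) : A^T = A -> POLs (of_mx A).
Proof.
by move=> sA k; rewrite ffunE; apply/matrixP => i j; rewrite !mxE -[in RHS]sA mxE.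
Qed.

End Assembly.

Lemma sum_step q s (a b : nat) (f : nat -> nat) : (s <= q)%N ->
  (\sum_(i < q) f (if i < s then a else b) = s * f a + (q - s) * f b)%N.
Proof.
move=> le; rewrite -[q in LHS](subnKC le) big_split_ord /=; congr (_ + _)%N.
  rewrite (eq_bigr (fun _ => f a)) => [|i _]; last by rewrite ltn_ord.
  by rewrite sum_nat_const card_ord.
rewrite (eq_bigr (fun _ => f b)) => [|i _]; last by rewrite ltnNge leq_addr.
by rewrite sum_nat_const card_ord.
Qed.

(** * Families with a fixed degree pattern *)

Section Families.
Variables (R : realType) (d n r : nat).
Local Notation C := R[i].
Local Notation nc := (@Normc.normc R).
Implicit Types (P Q : matpoly C d n) (eta : 'I_r -> nat).

Definition line m p (A B : 'M[{poly C}]_(m, p)) (t : C) := A + t%:P *: (B - A).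

Lemma line0 m p (A B : 'M[{poly C}]_(m, p)) : line A B 0 = A.
Proof. by rewrite /line scale0r addr0. Qed.

Lemma line1 m p (A B : 'M[{poly C}]_(m, p)) : line A B 1 = B.
Proof. by rewrite /line scale1r addrC subrK. Qed.

Lemma size_line m p (A B : 'M[{poly C}]_(m, p)) t i j h :
  (size (A i j) <= h)%N -> (size (B i j) <= h)%N -> (size (line A B t i j) <= h)%N.
Proof.
move=> sA sB; rewrite !mxE; apply: (leq_trans (size_polyD _ _)); rewrite geq_max sA.
rewrite mul_polyC; apply: (leq_trans (size_scale_leq _ _)).
by apply: (leq_trans (size_polyD _ _)); rewrite geq_max sB size_polyN.
Qed.

(** In [{poly {poly C}}] the outer variable is that of the matrix polynomial and the inner one the
    parameter [t], so the outer coefficients of the lifted product form the curve. *)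
Lemma curve_line (W0 W1 : 'M[{poly C}]_(n, r)) G0 G1 : exists p, forall t,
  curve p t = of_mx d (line W0 W1 t *m line G0 G1 t *m (line W0 W1 t)^T).
Proof.
pose lift m k (A B : 'M[{poly C}]_(m, k)) : 'M[{poly {poly C}}]_(m, k) :=
  map_mx (map_poly polyC) A + ('X%:P) *: map_mx (map_poly polyC) (B - A).
have liftE m k (A B : 'M[{poly C}]_(m, k)) t :
    map_mx (map_poly (horner_eval t)) (lift m k A B) = line A B t.
  have K (p : {poly C}) : map_poly (horner_eval t) (map_poly polyC p) = p.
    by apply/polyP => l; rewrite !coef_map /= /horner_eval hornerC.
  apply/matrixP => i j; rewrite !mxE rmorphD rmorphM /= map_polyC /= /horner_eval hornerX.
  by rewrite !K.
pose A := lift n r W0 W1 *m lift r r G0 G1 *m (lift n r W0 W1)^T.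
exists (fun k => map_mx (coefp k) A) => t; apply/ffunP => k; rewrite !ffunE.
apply/matrixP => i j; rewrite mxE mxE [RHS]mxE -!liftE map_trmx -!map_mxM.
by rewrite [in RHS]mxE coef_map.
Qed.

Definition family eta Q := exists W G, factors_as d (matpoly_mx Q) eta W G.

Lemma size_factors eta (W : 'M[{poly C}]_(n, r)) G i j :
  col_pattern eta W -> sym_pattern d eta G -> (size ((W *m G *m W^T) i j) <= d.+1)%N.
Proof.
move=> sW [_ sG]; rewrite mxE; apply: (leq_trans (size_sum _ _ _)); apply/bigmax_leqP => k _.
rewrite [W^T _ _]mxE mxE mulr_suml.
apply: (leq_trans (size_sum _ _ _)); apply/bigmax_leqP => l _.
have [-> | G0] := eqVneq (G l k) 0; first by rewrite mulr0 mul0r size_poly0.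
have := sG l k; have := sW i l; have := sW j k.
rewrite -size_poly_gt0 in G0; have := size_polyMleq (W i l * G l k) (W j k).
have := size_polyMleq (W i l) (G l k).
move: (size _) (size _) (size _) (size _) (size _) G0.
clear; lia.
Qed.

Lemma family_of_factors eta (W : 'M[{poly C}]_(n, r)) G :
  col_pattern eta W -> sym_pattern d eta G -> family eta (of_mx d (W *m G *m W^T)).
Proof.
move=> sW sG; exists W, G; split; [exact: sW | exact: sG |].
by rewrite of_mxK // => i j; exact: (size_factors i j sW sG).
Qed.

Lemma family_POLs eta Q : family eta Q -> POLs_rank r Q.
Proof.
case=> W [G [_ [sG _] eQ]]; split.
  rewrite -[Q]matpoly_mxK eQ; apply: of_mx_sym.
  by rewrite !trmx_mul trmxK sG mulmxA.
rewrite /mprank eQ /pmxrank !ratmxM.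
by rewrite (leq_trans (mxrankM_maxl _ _)) // (leq_trans (mxrankM_maxr _ _)) // rank_leq_row.
Qed.

Lemma family_line eta Q0 Q1 : family eta Q0 -> family eta Q1 ->
  exists p, [/\ curve p 0 = Q0, curve p 1 = Q1 & forall t, family eta (curve p t)].
Proof.
move=> [W0 [G0 [sW0 [tG0 sG0] e0]]] [W1 [G1 [sW1 [tG1 sG1] e1]]].
have [p ep] := curve_line W0 W1 G0 G1.
exists p; rewrite !ep !line0 !line1 -e0 -e1 !matpoly_mxK; split=> // t.
rewrite ep; apply: family_of_factors; first by move=> i j; exact: size_line.
split; last by move=> i j; exact: size_line.
by rewrite /line linearD linearZ linearB /= tG0 tG1.
Qed.

Lemma family_dense eta f Q0 Q1 (e : R) : polyfun f -> family eta Q0 -> family eta Q1 ->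
  f Q1 != 0 -> 0 < e -> exists Q, [/\ family eta Q, f Q != 0 & mpdist Q0 Q < e].
Proof.
move=> pf F0 F1 nz e0; have [p [p0 p1 fam]] := family_line F0 F1.
rewrite -p1 in nz; have [t [nt dt]] := curve_dense pf nz e0.
by exists (curve p t); split; [exact: fam | exact: nt | rewrite -p0].
Qed.

(** A form of irreducibility: on the curve joining [Q0] and [Q1] both functions are nonzero
    polynomials in one parameter, so their product has a non-root. *)
Lemma family_mul eta f g Q0 Q1 : polyfun f -> polyfun g ->
  family eta Q0 -> family eta Q1 -> f Q0 != 0 -> g Q1 != 0 ->
  exists2 Q, family eta Q & f Q * g Q != 0.
Proof.
move=> pf pg F0 F1 nf ng; have [p [p0 p1 fam]] := family_line F0 F1.
have [a ea] := polyfun_curve p pf; have [b eb] := polyfun_curve p pg.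
have a0 : a != 0 by apply: contraNneq nf => a0; rewrite -p0 ea a0 horner0.
have b0 : b != 0 by apply: contraNneq ng => b0; rewrite -p1 eb b0 horner0.
have [t _] := small_nonroot (mulf_neq0 a0 b0) (ltr01 : 0 < 1 :> R).
by rewrite hornerM -ea -eb; exists (curve p t).
Qed.

(** With [\det Gb != 0] the null space depends on the zigzag factor [W] alone, whose degrees [eta]
    have the same sum as the prescribed balanced indices. *)
Lemma index_point eta al s (Gb : 'M[{poly C}]_r) : (r < n)%N -> (s <= n - r)%N ->
  (al * (n - r) + s = \sum_i eta i)%N -> sym_pattern d eta Gb -> \det Gb != 0 ->
  exists Q : matpoly C d n, [/\ family eta Q, (n * al <= \rank (phi al Q))%N
    & (n * al.+1 <= \rank (phi al.+1 Q) + (n - r - s))%N].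
Proof.
move=> lt_rn le_s sumE sG dG.
pose eps i := if (i < s)%N then al.+1 else al.
have nE : n = (n - r + r)%N by rewrite subnK // ltnW.
have [||N [W [sW fW sat _ _]]] := @zigzag_exists C n (n - r) r eps (ext eta) nE.
- by rewrite subn_gt0.
- rewrite (sum_step _ _ id le_s) (eq_bigr eta) => [|j _]; last by rewrite ext_ord.
  by rewrite -sumE mulnBl mulnS; have : (s * al <= (n - r) * al)%N; [rewrite leq_mul2r le_s orbT | lia].
have {}sW : col_pattern eta W by move=> i j; have := sW i j; rewrite ext_ord.
have fQ := family_of_factors sW sG.
pose Q := of_mx d (W *m Gb *m W^T).
have eQ : matpoly_mx Q = W *m Gb *m W^T by apply: of_mxK => i j; exact: (size_factors i j sW sG).
have low h : (n * h <= \rank (phi h Q) + \sum_(i < n - r) (h - eps i))%N.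
  apply: (@rank_pmx_ge _ _ _ _ _ N (fun i : 'I_(n - r) => eps i)).
    move=> v; rewrite eQ !mulmxA => e; apply: sat.
    exact: det_neq0_cancel dG (pfree_mul fW e).
  apply: fits_size => i j _ _.
  by rewrite -addnS leq_add2l size_matpoly.
exists Q; split; first exact: fQ.
  have := low al; rewrite (sum_step _ _ (fun x => al - x)%N le_s).
  by rewrite subnn (eqP (_ : al - al.+1 == 0)%N) ?subn_eq0 // !muln0 !addn0.
have := low al.+1; rewrite (sum_step _ _ (fun x => al.+1 - x)%N le_s).
by rewrite subnn subSnn muln0 muln1.
Qed.

Lemma compress_pid (G : 'M[{poly C}]_r) : (r <= n)%N ->
  compress (pid_mx r : 'M[C]_(n, r)) (map_mx polyC (pid_mx r) *m G *m (map_mx polyC (pid_mx r))^T)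
  = \det G.
Proof.
move=> le; rewrite compress_factor map_trmx -map_mxM tr_pid_mx pid_mx_id // pid_mx_1.
by rewrite map_mx1 det1 expr1n mulr1.
Qed.

(** [W] is the constant matrix [pid_mx]; compressing by the same matrix returns [\det Gb], with
    square factor 1. *)
Lemma divisor_point eta (Gb : 'M[{poly C}]_r) (nu : seq C) : (r <= n)%N ->
  sym_pattern d eta Gb -> \det Gb != 0 -> (2 * \sum_i eta i <= r * d)%N ->
  uniq nu -> (r * d - 2 * \sum_i eta i <= size nu)%N -> all (root (\det Gb)) nu ->
  exists (Q : matpoly C d n) (X : 'M[C]_(n, r)) c,
    family eta Q /\ cond_pt (r * d) (\sum_i eta i) c (compress X (matpoly_mx Q)).
Proof.
move=> le_rn sG dG le2 u sznu rnu.
have [c _ gc] := small_nonroot dG (ltr01 : 0 < 1 :> R).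
have sW : col_pattern eta (map_mx polyC (pid_mx r : 'M[C]_(n, r))).
  by move=> i j; rewrite mxE; apply: (leq_trans (size_polyC_leq1 _)).
exists (of_mx d (map_mx polyC (pid_mx r) *m Gb *m (map_mx polyC (pid_mx r))^T)), (pid_mx r), c.
split; first exact: family_of_factors.
rewrite of_mxK; last by move=> i j; exact: (size_factors i j sW sG).
rewrite compress_pid // -[\det Gb]mulr1 -[X in _ * X](expr1n _ 2).
rewrite -[X in cond_pt X](subnK le2) mul2n -addnn.
apply: (@cond_pt_intro _ _ _ _ _ _ (map Some nu)).
- by rewrite addnn -mul2n; have [_ sGs] := sG; have [] := det_size_sym sGs.
- by rewrite size_poly1.
- exact: gc.
- by rewrite hornerC oner_eq0.
- by rewrite map_inj_uniq // => x y [].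
- by rewrite size_map addnn -mul2n.
- by apply/allP => _ /mapP[z zn ->] /=; exact: (allP rnu).
by apply/allP => _ /mapP[z zn ->] /=; rewrite root1.
Qed.

(** Balanced indices and simple roots are exhibited at two different members of the family. Each is
    certified by a nonvanishing polynomial function, so both hold at a common member, hence at
    members arbitrarily close to [P], which lies in the same family. *)
Lemma approx_exact_rank P (e : R) : (r < n)%N -> POLs P -> mprank P = r -> 0 < e ->
  exists a Q, [/\ (a <= (r * d) %/ 2)%N, generic_at r (a %/ (n - r)) (a %% (n - r)) Q
    & mpdist P Q < e].
Proof.
move=> lt_rn sP rP e0.
have [N [eps [W0 [eta0 [G0 [_ _ _ _ [[_ sW0 _ _] eP tG0 sG0 _]]]]]]] := sym_data_exists sP rP.
have f0 : factors_as d (matpoly_mx P) eta0 W0 G0.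
  by split=> // i j; have := sW0 j i; rewrite mxE.
have [eta [W [G [Gb [fP sGb dGb le2 [nu [u sznu rnu]]]]]]] := good_pattern rP f0.
pose a := (\sum_i eta i)%N; pose al := (a %/ (n - r))%N; pose s := (a %% (n - r))%N.
have q0 : (0 < n - r)%N by rewrite subn_gt0.
have le_s : (s <= n - r)%N by rewrite ltnW // ltn_mod.
have aE : (al * (n - r) + s = a)%N by rewrite -divn_eq.
have [Qa [Fa ca1 ca2]] := index_point lt_rn le_s aE sGb dGb.
have [Qb [X [c [Fb cb]]]] := divisor_point (ltnW lt_rn) sGb dGb le2 u sznu rnu.
have pphi h x y : polyfun (fun Q : matpoly C d n => phi h Q x y).
  by apply: polyfun_pmx => i j; exact: ppoly_matpoly.
have [f1 [pf1 f10 h1]] := rank_certificate Qa (pphi al).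
have [f2 [pf2 f20 h2]] := rank_certificate Qa (pphi al.+1).
have [f3 [pf3 f30 h3]] := cond_pt_certificate (ppoly_compress d X) cb.
have pf12 := polyfun_mul pf1 pf2.
have [Q1 FQ1 nz1] := family_mul pf12 pf3 Fa Fb (mulf_neq0 f10 f20) f30.
have FP : family eta P by exists W, G.
have [Q [FQ nzQ dQ]] := family_dense (polyfun_mul pf12 pf3) FP FQ1 nz1 e0.
exists a, Q; split; [by rewrite leq_divRL // mulnC | | exact: dQ].
move: nzQ; rewrite !mulf_eq0 !negb_or => /andP[/andP[n1 n2] n3].
apply: (@generic_of_open_cond _ _ _ _ _ _ _ X c (ltnW lt_rn) le_s (family_POLs FQ)).
split; [exact: leq_trans ca1 (h1 _ n1) | | by rewrite aE; exact: h3].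
by apply: leq_trans ca2 _; rewrite leq_add2r h2.
Qed.

End Families.

(** Take a unit row [e] outside the row space of [B] and [y] with [B y = 0] and [e y != 0]. Then
    [y^T (B + c e^T e)] is a nonzero multiple of [e], so the new row space contains [e], hence also
    that of [B]. *)
Lemma rank_sym_bump (K : fieldType) n (B : 'M[K]_n) : B^T = B -> (\rank B < n)%N ->
  exists i, forall c, c != 0 -> \rank (B + c *: delta_mx i i)%R = (\rank B).+1.
Proof.
move=> sB lt.
have [i ni] : exists i, ~~ ((delta_mx 0 i : 'rV[K]_n) <= B)%MS.
  apply/existsP; apply: contraLR lt; rewrite negb_exists => /forallP full.
  rewrite -leqNgt -[n in X in (X <= _)%N](mxrank1 K n) mxrankS //; apply/row_subP => i.
  by rewrite rowE mulmx1; have := full i; rewrite negbK.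
exists i => c c0; pose e : 'rV[K]_n := delta_mx 0 i; pose M := B + c *: delta_mx i i.
have eE : delta_mx i i = e^T *m e by rewrite trmx_delta mul_delta_mx.
have sM : M^T = M by rewrite linearD linearZ /= sB trmx_delta.
have eM : (e <= M)%MS.
  have /rV0Pn[j ej] : e *m cokermx B != 0 by rewrite -submxE.
  have {ej} : e *m col j (cokermx B) != 0.
    apply: contraNneq ej => e0.
    have : (e *m col j (cokermx B)) 0 0 = 0 by rewrite e0 mxE.
    by rewrite colE mulmxA -colE mxE => ->.
  set y := col j _ => ey.
  have By : B *m y = 0 by rewrite /y colE mulmxA mulmx_coker mul0mx.
  have yM : y^T *m M = (c * (e *m y) 0 0) *: e.
    rewrite -[LHS]trmxK trmx_mul trmxK sM mulmxDl By add0r -scalemxAl eE -mulmxA.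
    by rewrite [e *m y]mx11_scalar mul_mx_scalar scalerA linearZ /= trmxK !mxE.
  have nz : c * (e *m y) 0 0 != 0.
    rewrite mulf_neq0 //; apply: contra_neq ey => e0.
    by rewrite [e *m y]mx11_scalar e0 raddf0.
  by rewrite -(eqmx_scale e nz) -yM submxMl.
have BM : (B <= M)%MS.
  have -> : B = M - c *: delta_mx i i by rewrite addrK.
  rewrite addmx_sub // eqmx_opp eqmx_scale // eE; exact: mulmx_sub.
apply/eqP; rewrite eqn_leq; apply/andP; split.
  apply: (leq_trans (mxrank_add _ _)); rewrite -addn1 leq_add2l.
  by rewrite (leq_trans (mxrank_scale _ _)) // mxrank_delta.
have : (B < M)%MS by rewrite /ltmx BM; apply: contra ni; exact: submx_trans.
by rewrite ltmxErank => /andP[].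
Qed.

(** * Approximation from smaller rank *)

Section Density.
Variables (R : realType) (d n : nat).
Local Notation C := R[i].
Local Notation nc := (@Normc.normc R).
Implicit Types (P Q : matpoly C d n).

Lemma raise_rank P (e : R) : POLs P -> (mprank P < n)%N -> 0 < e ->
  exists Q, [/\ POLs Q, mprank Q = (mprank P).+1 & forall k i j, nc (P k i j - Q k i j) <= e].
Proof.
move=> sP lt e0.
have sB : (ratmx (matpoly_mx P))^T = ratmx (matpoly_mx P) by rewrite -ratmxT matpoly_mx_tr.
have [i0 Hi] := rank_sym_bump sB lt.
pose c : C := real_complex R e.
have nce : nc c = e by rewrite nc_real // ltW.
have c0 : c != 0 by apply: contra_eq_neq nce => ->; rewrite nc0 lt_eqF.
pose D : 'M[C]_n := c *: delta_mx i0 i0.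
exists [ffun k => if k == ord0 then P k + D else P k]; split.
- by move=> k; rewrite ffunE; case: eqP => _; rewrite ?linearD ?linearZ /= ?trmx_delta sP.
- rewrite /mprank /pmxrank; set A := matpoly_mx _.
  have -> : A = matpoly_mx P + c%:P *: delta_mx i0 i0.
    rewrite /A /matpoly_mx !big_ord_recl !ffunE /= -addrA [_ + c%:P *: _]addrC addrA.
    congr (_ + _); last by apply: eq_bigr => k _; rewrite ffunE.
    by rewrite !scale1r map_mxD map_mxZ map_delta_mx.
  rewrite /ratmx map_mxD map_mxZ map_delta_mx; apply: Hi.
  by rewrite tofrac_eq0 polyC_eq0.
move=> k i j; rewrite ffunE; case: eqP => _; last by rewrite subrr nc0 ltW.
rewrite !mxE opprD addNKr ncN ncM nce.
case: (_ && _).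
  by rewrite mulr1n Normc.normc1 mulr1.
by rewrite mulr0n nc0 mulr0 ltW.
Qed.

Lemma raise_rank_to r m P (e : R) : POLs P -> (r <= n)%N -> (mprank P + m = r)%N -> 0 < e ->
  exists Q, [/\ POLs Q, mprank Q = r & forall k i j, nc (P k i j - Q k i j) <= e].
Proof.
move=> + le_rn; elim: m P e => [|m IHm] P e sP rP e0.
  exists P; split; [exact: sP | by rewrite -rP addn0 |].
  by move=> k i j; rewrite subrr nc0 ltW.
have e2 : 0 < e / 2%:R by rewrite divr_gt0.
have lt : (mprank P < n)%N by move: rP le_rn; clear; lia.
have [Q [sQ rQ dQ]] := raise_rank sP lt e2.
have rQ' : (mprank Q + m = r)%N by rewrite rQ addSnnS.
have [Q' [sQ' rQ'' dQ']] := IHm Q _ sQ rQ' e2.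
exists Q'; split; [exact: sQ' | exact: rQ'' |].
move=> k i j; rewrite -(subrKA (Q k i j)) (le_trans (ncD _ _)) //.
by rewrite [in X in _ <= X](splitr e); apply: lerD; [exact: dQ | exact: dQ'].
Qed.

Lemma approx_generic r P (e : R) : (r < n)%N -> POLs_rank r P -> 0 < e ->
  exists a Q, [/\ (a <= (r * d) %/ 2)%N, generic_at r (a %/ (n - r)) (a %% (n - r)) Q
    & mpdist P Q < e].
Proof.
move=> lt_rn [sP rP] e0.
pose M : R := (d.+1 * (n * n)).+1%:R.
have M0 : 0 < M by rewrite ltr0n.
(* One [h] pays for raising the rank and one for the generic approximation;
   [M * (h + h) = e / 2]. *)
pose h := e / M / 2%:R / 2%:R.
have h0 : 0 < h by rewrite !divr_gt0.
have [Q [sQ rQ dQ]] := raise_rank_to sP (ltnW lt_rn) (subnKC rP) h0.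
have [a [Q' [le_a gQ dQ']]] := approx_exact_rank lt_rn sQ rQ h0.
exists a, Q'; split; [exact: le_a | exact: gQ |].
apply: (@le_lt_trans _ _ (M * (h + h))).
  apply: mpdist_le => [|k i j]; first by rewrite addr_ge0 ?ltW.
  rewrite -(subrKA (Q k i j)) (le_trans (ncD _ _)) //.
  apply: lerD; first exact: dQ.
  exact: le_trans (mpdist_coord _ _ _ _ _) (ltW dQ').
rewrite -splitr mulrA [M * _]mulrC divfK ?lt0r_neq0 //.
by rewrite ltr_pdivrMr // ltr_pMr // ltr1n.
Qed.

End Density.

Local Open Scope classical_set_scope.

Theorem corollary7p3 (R : realType) (n r d : nat)
    (hn : (2 <= n)%N) (hd : (1 <= d)%N) (hodd : odd d)
    (hr : (1 <= r <= n - 1)%N)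
    (K : nat -> matpoly R[i] d n)
    (hK : forall a : nat, (a <= (r * d) %/ 2)%N -> is_generic_sym r a (K a)) :
  let U := \bigcup_(a in [set a : nat | (a <= (r * d) %/ 2)%N])
             sym_bundle (K a) in
  mp_open_in (@POLs_rank R[i] d n r) U /\
  mp_dense_in (@POLs_rank R[i] d n r) U.
Proof.
move=> U.
have lt_rn : (r < n)%N by lia.
have le_rn := ltnW lt_rn.
have UP Q : U Q <-> exists2 a, (a <= (r * d) %/ 2)%N
    & generic_at r (a %/ (n - r)) (a %% (n - r)) Q.
  by split=> -[a ha] hQ; exists a => //; apply/(bundle_generic Q le_rn (hK a ha)).
have sub : U `<=` @POLs_rank R[i] d n r.
  by move=> Q /UP[a _ [sQ rQ _ _]]; split; [exact: sQ | rewrite rQ].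
split; split=> // P.
  move=> /UP[a ha gP].
  have le_s : (a %% (n - r) <= n - r)%N by rewrite ltnW // ltn_mod subn_gt0.
  have le_a : (2 * (a %/ (n - r) * (n - r) + a %% (n - r)) <= r * d)%N.
    by rewrite -divn_eq; lia.
  have [e e0 He] := generic_open le_rn le_s le_a gP.
  exists e; first exact: e0.
  by move=> Q rQ dQ; apply/UP; exists a; [exact: ha | exact: He].
move=> rP e e0; have [a [Q [ha gQ dQ]]] := approx_generic lt_rn rP e0.
by exists Q; [apply/UP; exists a | exact: dQ].
Qed.
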